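(* Let $\tilde\rho:M\to S^3$ be a minimal immersion of a torus, with $N$, $a$, $W_1$, $W_2$, $f_B$, $h_\theta$ as in the context. Suppose that for some angle $\theta\in\mathbb{R}$ and some matrix $B\in so(4)$ one has $h_\theta=2f_B$ on $M$. Then there exists adapted coordinate data $(\tau,\rho,\nu,V_1,V_2,r)$ for $\tilde\rho$ (as defined in the context), i.e. a covering map $\tau:\mathbb{R}^2\to M$, maps $\rho,\nu,V_1,V_2:\mathbb{R}^2\to S^3$ and a function $r:\mathbb{R}^2\to\mathbb{R}$, such that $$\phi(u,v)=\Big(\rho(u,v),V_1(u,v),V_2(u,v),\nu(u,v),r(u,v),\frac{\partial r}{\partial v}(u,v)\Big)$$ is a solution on $\mathbb{R}^2$ of system (S) (see context) with matrix $B$ and angle $\theta$.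
   Context: Geometric setting. $M$ is an oriented compact surface without boundary diffeomorphic to a torus and $\tilde\rho:M\to S^3\subset\mathbb{R}^4$ is a minimal immersion; $M$ has the induced metric and tangent vectors are identified with their images under $d\tilde\rho$. $N:M\to S^3$ is a Gauss map: $N(m)\perp d\tilde\rho_m(T_mM)$ and $\langle N(m),\tilde\rho(m)\rangle=0$. $a:M\to\mathbb{R}$ is the nonnegative principal curvature function; for a torus $a$ is everywhere positive (Lawson) and smooth, and $W_1,W_2$ are fixed smooth unit tangent vector fields on $M$ with $dN(W_1)=-aW_1$, $dN(W_2)=aW_2$. $so(4)$ is the space of real skew-symmetric $4\times 4$ matrices. For $B\in so(4)$, $f_B:M\to\mathbb{R}$ is $f_B(m)=\langle B\tilde\rho(m),N(m)\rangle$. For $\theta\in\mathbb{R}$, $h_\theta=\cos(\theta)\,a^{-3/2}W_1(a)+\sin(\theta)\,a^{-3/2}W_2(a)$. Adapted coordinate data for $\tilde\rho$: a covering map $\tau:\mathbb{R}^2\to M$, a doubly periodic conformal immersion $\rho=\tilde\rho\circ\tau:\mathbb{R}^2\to S^3$, $\nu=N\circ\tau$, $V_1=W_1\circ\tau$, $V_2=W_2\circ\tau$, and a smooth function $r:\mathbb{R}^2\to\mathbb{R}$, such that $e^{-2r}=\langle\rho_u,\rho_u\rangle=\langle\rho_v,\rho_v\rangle$, $a\circ\tau=e^{2r}$, and for some constant angle $\alpha$: $V_1=e^r(\cos\alpha\,\rho_u-\sin\alpha\,\rho_v)$, $V_2=e^r(\sin\alpha\,\rho_u+\cos\alpha\,\rho_v)$,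 $\rho_{uu}=-r_u\rho_u+r_v\rho_v+\cos(2\alpha)\nu-e^{-2r}\rho$, $\rho_{vv}=r_u\rho_u-r_v\rho_v-\cos(2\alpha)\nu-e^{-2r}\rho$, $\rho_{uv}=-r_v\rho_u-r_u\rho_v-\sin(2\alpha)\nu$, $\nu_u=e^{2r}(-\cos(2\alpha)\rho_u+\sin(2\alpha)\rho_v)$, $\nu_v=e^{2r}(\sin(2\alpha)\rho_u+\cos(2\alpha)\rho_v)$, $\Delta r+2\sinh(2r)=0$. System (S) with matrix $B\in so(4)$ and angle $\theta\in\mathbb{R}$: for functions $p,V_1,V_2,\nu$ of $(u,v)$ with values in $\mathbb{R}^4$ and real functions $r,s$, $p_u=e^{-r}(\cos\theta V_1+\sin\theta V_2)$, $(V_1)_u=sV_2+\cos\theta(e^r\nu-e^{-r}p)$, $(V_2)_u=-sV_1-\sin\theta(e^r\nu+e^{-r}p)$, $\nu_u=e^r(-\cos\theta V_1+\sin\theta V_2)$, $r_u=\langle Bp,\nu\rangle$, $s_u=\cos\theta\langle BV_2,e^{-r}\nu-e^rp\rangle-\sin\theta\langle BV_1,e^{-r}\nu+e^rp\rangle$, $p_v=e^{-r}(\cos\theta V_2-\sin\theta V_1)$, $(V_1)_v=-\langle Bp,\nu\rangle V_2+\sin\theta(-e^r\nu+e^{-r}p)$, $(V_2)_v=\langle Bp,\nu\rangle V_1-\cos\theta(e^r\nu+e^{-r}p)$, $\nu_v=e^r(\sin\theta V_1+\cos\theta V_2)$, $r_v=s$, $s_v=e^{-2r}-e^{2r}-\sin\theta\langle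 BV_2,e^{-r}\nu-e^rp\rangle-\cos\theta\langle BV_1,e^{-r}\nu+e^rp\rangle$. A solution is written $(p,V_1,V_2,\nu,r,s)$. *)

(* Defs.v *)
From HB Require Import structures.
From mathcomp Require Import all_boot all_order all_algebra.
From mathcomp Require Import all_classical all_reals all_analysis.
From mathcomp Require Import ring lra.

Set Implicit Arguments.
Unset Strict Implicit.
Unset Printing Implicit Defensive.

Import Order.TTheory GRing.Theory Num.Theory.
Import numFieldNormedType.Exports.

Local Open Scope classical_set_scope.
Local Open Scope ring_scope.

Definition partial_u (R : realType) (W : normedModType R) (f : R * R -> W) :
  R * R -> W := 'D_(1, 0) f.

Definition partial_v (R : realType) (W : normedModType R) (f : R * R -> W) :
  R * R -> W := 'D_(0, 1) f.

(* The set U is meant to be open: f is differentiable as a function on the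
   plane at the points of U. *)
Fixpoint Cn_on (R : realType) (W : normedModType R) (n : nat)
    (U : set (R * R)) (f : R * R -> W) : Prop :=
  match n with
  | 0 => forall x, U x -> {for x, continuous f}
  | n'.+1 => (forall x, U x -> differentiable f x) /\
             (forall v, Cn_on n' U ('D_v f))
  end.

Definition smooth_on (R : realType) (W : normedModType R) (U : set (R * R))
    (f : R * R -> W) : Prop := forall n, Cn_on n U f.

Definition smooth_plane (R : realType) (W : normedModType R)
    (f : R * R -> W) : Prop := smooth_on [set: R * R] f.

Record chart (R : realType) (M : topologicalType) := Chart {
  dom : set M;
  cod : set (R * R);
  coord : M -> R * R;
  param : R * R -> M;
  dom_open : open dom;
  cod_open : open cod;
  coord_cod : forall m, dom m -> cod (coord m);
  param_dom : forall x, cod x -> dom (param x);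
  coordK : forall m, dom m -> param (coord m) = m;
  paramK : forall x, cod x -> coord (param x) = x;
  coord_continuous : forall m, dom m -> {for m, continuous coord};
  param_continuous : forall x, cod x -> {for x, continuous param}
}.

(* [atlas] need not be maximal.  The chart [chart_at m] chosen around each point
   only serves to represent tangent vectors at m by elements of R * R. *)
Record smooth_surface (R : realType) := SmoothSurface {
  carrier :> topologicalType;
  atlas : set (chart R carrier);
  chart_at : carrier -> chart R carrier;
  chart_at_atlas : forall m, atlas (chart_at m);
  chart_at_dom : forall m, dom (chart_at m) m;
  atlas_smooth : forall c d, atlas c -> atlas d ->
    smooth_on (cod c `&` param c @^-1` dom d) (coord d \o param c)
}.

Definition jacobian (R : realType) (f : R * R -> R * R) (x : R * R) : R :=
  (partial_u f x).1 * (partial_v f x).2 - (partial_v f x).1 * (partial_u f x).2.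

Definition oriented (R : realType) (M : smooth_surface R) : Prop :=
  forall c d, @atlas R M c -> @atlas R M d ->
  forall x, cod c x -> dom d (param c x) -> 0 < jacobian (coord d \o param c) x.

Definition smooth_fun (R : realType) (M : smooth_surface R)
    (W : normedModType R) (f : M -> W) : Prop :=
  forall c, @atlas R M c -> smooth_on (cod c) (f \o param c).

Definition smooth_map (R : realType) (M M' : smooth_surface R) (f : M -> M') :
    Prop :=
  continuous f /\
  forall c d, @atlas R M c -> @atlas R M' d ->
    smooth_on (cod c `&` (f \o param c) @^-1` dom d)
              (coord d \o f \o param c).

Definition diffeomorphic (R : realType) (M M' : smooth_surface R) : Prop :=
  exists (f : M -> M') (g : M' -> M),
    [/\ cancel f g, cancel g f, smooth_map f & smooth_map g].

Section Torus.
Variable R : realType.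
Local Open Scope quotient_scope.

Definition same_class (x y : R * R) : bool :=
  (x.1 - y.1 \is a Num.int) && (x.2 - y.2 \is a Num.int).

Lemma same_class_equiv : equiv_class_of same_class.
Proof.
split=> [x | x y | y x z].
- by rewrite /same_class !subrr !rpred0.
- by rewrite /same_class -[x.1 - _]opprB -[x.2 - _]opprB !rpredN.
- move=> /andP[a b] /andP[c d]; apply/andP.
  by split; [move: (rpredD a c) | move: (rpredD b d)]; rewrite addrA subrK.
Qed.

Canonical same_class_rel := EquivRelPack same_class_equiv.

Definition torus_space : Type := quotient_topology {eq_quot same_class_rel}.
HB.instance Definition _ := Topological.on torus_space.
HB.instance Definition _ := Quotient.on torus_space.

Local Notation T2 := torus_space.

Definition torus_proj (x : R * R) : T2 := \pi_T2 x.

(* On the image of the square of side 1 around x0: the representative in it. *)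
Definition torus_coord (x0 : R * R) (m : T2) : R * R :=
  let y := repr m in
  (y.1 - (Num.floor (y.1 - x0.1 + 2^-1))%:~R,
   y.2 - (Num.floor (y.2 - x0.2 + 2^-1))%:~R).

Definition torus_dom (x0 : R * R) : set T2 := torus_proj @` ball x0 2^-1.

Lemma half_gt0 : 0 < 2^-1 :> R.
Proof. by rewrite invr_gt0. Qed.

Lemma torus_projP (x y : R * R) :
  reflect (torus_proj x = torus_proj y) (same_class x y).
Proof. exact: eqmodP. Qed.

Lemma torus_proj_shift (x : R * R) (n1 n2 : int) :
  torus_proj (x + (n1%:~R, n2%:~R)) = torus_proj x.
Proof.
apply/torus_projP; rewrite /same_class /=.
by rewrite ![_ + _%:~R]addrC !addrK !rpred_int.
Qed.

Lemma torus_proj_eq (x y : R * R) : torus_proj x = torus_proj y ->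
  exists n1 n2 : int, y = x + (n1%:~R, n2%:~R).
Proof.
move=> /esym/torus_projP/andP[/intrP[n1 e1] /intrP[n2 e2]]; exists n1, n2.
by rewrite -e1 -e2 /GRing.add /= /add_pair /= ![_.1 + _]addrC ![_.2 + _]addrC;
  rewrite !subrK; case: y {e1 e2}.
Qed.

Lemma floor_shift (x0 x : R) (n : int) : `|x0 - x| < 2^-1 ->
  x + n%:~R - (Num.floor (x + n%:~R - x0 + 2^-1))%:~R = x.
Proof.
rewrite ltr_norml => /andP[h1 h2].
rewrite (@floor_def _ _ n) ?addrK// intrD; apply/andP; split; lra.
Qed.

Lemma torus_coordK (x0 x : R * R) :
  ball x0 2^-1 x -> torus_coord x0 (torus_proj x) = x.
Proof.
move=> [h1 h2]; rewrite /torus_coord.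
have /esym/torus_proj_eq[n1 [n2 ->]] :
  torus_proj (repr (torus_proj x)) = torus_proj x by exact: reprK.
rewrite /= !floor_shift//; by case: x {h1 h2}.
Qed.

Lemma torus_proj_continuous : continuous torus_proj.
Proof. exact: pi_continuous. Qed.

Lemma torus_proj_open (A : set (R * R)) : open A -> open (torus_proj @` A).
Proof.
move=> oA.
suff -> : open (torus_proj @` A) = open (torus_proj @^-1` (torus_proj @` A)).
  have -> : torus_proj @^-1` (torus_proj @` A) =
    \bigcup_(n : int * int) ((fun x => x + (n.1%:~R, n.2%:~R)) @^-1` A).
    apply/seteqP; split=> [x [y Ay /esym/torus_proj_eq[n1 [n2 yE]]] | x [n _ An]].
      by exists (n1, n2) => //=; rewrite -yE.
    by eexists; [exact: An | exact: torus_proj_shift].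
  apply: bigcup_open => n _; apply: open_comp => // x _.
  by apply: cvgD; [exact: cvg_id | exact: cvg_cst].
by [].
Qed.

Lemma torus_coord_cod x0 m : torus_dom x0 m -> ball x0 2^-1 (torus_coord x0 m).
Proof. by move=> [x Bx <-]; rewrite torus_coordK. Qed.

Lemma torus_projK x0 m : torus_dom x0 m -> torus_proj (torus_coord x0 m) = m.
Proof. by move=> [x Bx <-]; rewrite torus_coordK. Qed.

Lemma torus_coord_continuous x0 m :
  torus_dom x0 m -> {for m, continuous (torus_coord x0)}.
Proof.
move=> [x Bx <-] A; rewrite torus_coordK // => nA.
have nB : nbhs x (A `&` ball x0 2^-1).
  by apply: filterI => //; apply: open_nbhs_nbhs; split=> //;
     apply: ball_open; exact: half_gt0.
move: nB; rewrite {1}nbhsE => -[V [oV Vx] sV].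
apply: (@filterS _ _ _ (torus_proj @` V)); last first.
  apply: open_nbhs_nbhs; split; first exact: torus_proj_open.
  by exists x.
by move=> _ [y /sV[Ay By] <-] /=; rewrite torus_coordK.
Qed.

Definition torus_chart (x0 : R * R) : chart R T2.
Proof.
refine (@Chart R T2 (torus_dom x0) (ball x0 2^-1) (torus_coord x0) torus_proj
  _ _ (@torus_coord_cod x0) _ (@torus_projK x0) (@torus_coordK x0)
  (@torus_coord_continuous x0) _).
- by apply: torus_proj_open; apply: ball_open; exact: half_gt0.
- by apply: ball_open; exact: half_gt0.
- by move=> x Bx; exists x.
- by move=> x _; exact: torus_proj_continuous.
Defined.

Lemma near_eq_differentiable (W : normedModType R) (f g : R * R -> W) x :
  (\near x, f x = g x) -> differentiable g x -> differentiable f x.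
Proof.
move=> fg /diff_locallyP[dgc dg].
have dE : f \o shift x = cst (f x) + 'd g x +o_ 0 id.
  apply/eqaddoP => e e0; move/eqaddoP: dg => /(_ e e0) ge.
  have fg0 : \forall h \near 0, f (h + x) = g (h + x).
    move: fg; rewrite (near_shift 0 x); apply: filterS => z /=.
    by rewrite subr0.
  near=> h.
  rewrite (_ : _ h = (g \o shift x - (cst (g x) + 'd g x)) h); first by near: h.
  rewrite /= /GRing.add /GRing.opp /= (nbhs_singleton fg); congr (_ - _).
  by near: h.
apply/diff_locallyP.
by rewrite (diff_unique dgc dE).
Unshelve. all: by end_near. Qed.

Lemma Cn_on_cst (W : normedModType R) n (U : set (R * R)) (w : W) :
  Cn_on n U (cst w).
Proof.
elim: n w => [|n IHn] w /=; first by move=> x _; exact: cst_continuous.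
split=> [x _ | v]; first exact: differentiable_cst.
suff -> : 'D_v (cst w) = cst 0 :> (R * R -> W) by exact: IHn.
by apply/funext => x; rewrite derive_cst.
Qed.

Lemma Cn_on_local (W : normedModType R) n (U : set (R * R)) (f : R * R -> W) :
  (forall x, U x -> exists g, Cn_on n setT g /\ \near x, f x = g x) ->
  Cn_on n U f.
Proof.
elim: n f => [|n IHn] f H /=.
  move=> x /H[g [gc fg]].
  rewrite /prop_for /continuous_at (nbhs_singleton fg).
  by apply: cvg_trans (gc x I); apply: near_eq_cvg; apply: filterS fg.
split=> [x /H[g [[gd _] fg]] | v].
  exact: near_eq_differentiable fg (gd x I).
apply: IHn => x /H[g [[_ gd] fg]]; exists ('D_v g); split; first exact: gd.
move: fg => /near_join; apply: filterS => y; exact: near_eq_derive.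
Qed.

Lemma smooth_shift (a : R * R) n : Cn_on n setT (fun x : R * R => x + a).
Proof.
case: n => [|n] /=.
  by move=> x _; apply: cvgD; [exact: cvg_id | exact: cvg_cst].
split=> [x _ | v]; first exact: ex_diff.
suff -> : 'D_v (fun x : R * R => x + a) = cst v :> (R * R -> R * R).
  exact: Cn_on_cst.
apply/funext => x; rewrite deriveD //.
by rewrite derive_id derive_cst addr0.
Qed.

Lemma torus_atlas_smooth (c d : chart R T2) :
  range torus_chart c -> range torus_chart d ->
  smooth_on (cod c `&` param c @^-1` dom d) (coord d \o param c).
Proof.
move=> [x0 _ <-] [y0 _ <-] n; apply: Cn_on_local => x [/= Bx [y By yx]].
have [n1 [n2 yE]] := torus_proj_eq (esym yx).
exists (fun x => x + (n1%:~R, n2%:~R)); split; first exact: smooth_shift.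
have : nbhs x ((fun x : R * R => x + (n1%:~R, n2%:~R)) @^-1` ball y0 2^-1).
  have sc : {for x, continuous (fun x : R * R => x + (n1%:~R, n2%:~R))}.
    by apply: cvgD; [exact: cvg_id | exact: cvg_cst].
  apply: sc; rewrite -yE; apply: open_nbhs_nbhs; split=> //.
  by apply: ball_open; exact: half_gt0.
apply: filterS => z Bz.
by rewrite /= -(torus_proj_shift z n1 n2) torus_coordK.
Qed.

Lemma torus_dom_repr (m : T2) : torus_dom (repr m) m.
Proof. by exists (repr m); [apply: ballxx; exact: half_gt0 | exact: reprK]. Qed.

(* The flat torus R^2 / Z^2. *)
Definition torus : smooth_surface R :=
  @SmoothSurface R T2 (range torus_chart) (fun m => torus_chart (repr m))
    (fun m => imageT torus_chart (repr m)) torus_dom_repr torus_atlas_smooth.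

End Torus.

Definition covering_map (X Y : topologicalType) (p : X -> Y) : Prop :=
  [/\ continuous p, range p = [set: Y] &
   forall y, exists U : set Y, [/\ open U, U y &
     exists F : set (set X),
     [/\ p @^-1` U = \bigcup_(S in F) S, trivIset F id &
       forall S, F S -> open S /\
         exists g : Y -> X,
         [/\ forall z, U z -> S (g z) /\ p (g z) = z,
             forall x, S x -> g (p x) = x &
             forall z, U z -> {for z, continuous g}]]]].

Definition smooth_into (R : realType) (M : smooth_surface R)
    (tau : R * R -> M) : Prop :=
  forall d, @atlas R M d -> smooth_on (tau @^-1` dom d) (coord d \o tau).

Definition dot (R : realType) (x y : 'cV[R]_4) : R := \sum_i x i 0 * y i 0.

Definition so4 (R : realType) (B : 'M[R]_4) : Prop := B^T = - B.

Section Geometry.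
Context (R : realType) (M : smooth_surface R).

(* The differential of f at m; tangent vectors at m are represented by their
   components in the chart [chart_at m]. *)
Definition dmap (W : normedModType R) (f : M -> W) (m : M) (xi : R * R) : W :=
  'D_xi (f \o param (chart_at m)) (coord (chart_at m) m).

Definition immersion_S3 (rho : M -> 'cV[R]_4) : Prop :=
  [/\ smooth_fun rho,
      forall m, dot (rho m) (rho m) = 1 &
      forall m xi, dmap rho m xi = 0 -> xi = 0].

Definition gauss_map (rho N : M -> 'cV[R]_4) : Prop :=
  [/\ smooth_fun N,
      forall m, dot (N m) (N m) = 1,
      forall m xi, dot (N m) (dmap rho m xi) = 0 &
      forall m, dot (N m) (rho m) = 0].

Definition first_form (rho : M -> 'cV[R]_4) (m : M) (xi eta : R * R) : R :=
  dot (dmap rho m xi) (dmap rho m eta).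

(* The shape operator is - dN. *)
Definition second_form (rho N : M -> 'cV[R]_4) (m : M) (xi eta : R * R) : R :=
  - dot (dmap N m xi) (dmap rho m eta).

(* Half the trace of the second fundamental form with respect to the first,
   computed in the basis (1, 0), (0, 1) of the tangent plane. *)
Definition mean_curvature (rho N : M -> 'cV[R]_4) (m : M) : R :=
  let g := first_form rho m in
  let h := second_form rho N m in
  let e1 := (1, 0) in let e2 := (0, 1) in
  (g e2 e2 * h e1 e1 - g e1 e2 * h e2 e1 - g e1 e2 * h e1 e2 + g e1 e1 * h e2 e2)
    / (2 * (g e1 e1 * g e2 e2 - g e1 e2 ^+ 2)).

(* The unit normal of rho in S^3 being unique up to sign, this does not depend on
   the Gauss map N. *)
Definition minimal (rho N : M -> 'cV[R]_4) : Prop :=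
  forall m, mean_curvature rho N m = 0.

Definition nonneg_principal_curvature (rho N : M -> 'cV[R]_4) (a : M -> R) :
    Prop :=
  forall m, 0 <= a m /\
    exists2 xi, xi != 0 & dmap N m xi = - a m *: dmap rho m xi.

(* A tangent vector field W is smooth when the R^4-valued map drho(W) is. *)
Definition principal_field (rho N : M -> 'cV[R]_4) (k : M -> R)
    (W : M -> R * R) : Prop :=
  [/\ smooth_fun (fun m => dmap rho m (W m)),
      forall m, first_form rho m (W m) (W m) = 1 &
      forall m, dmap N m (W m) = - k m *: dmap rho m (W m)].

Definition killing_fun (rho N : M -> 'cV[R]_4) (B : 'M[R]_4) (m : M) : R :=
  dot (B *m rho m) (N m).

Definition h_fun (a : M -> R) (W1 W2 : M -> R * R) (theta : R) (m : M) : R :=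
  cos theta * (a m `^ (- (3 / 2)) * dmap a m (W1 m)) +
  sin theta * (a m `^ (- (3 / 2)) * dmap a m (W2 m)).

Definition doubly_periodic (T : Type) (f : R * R -> T) : Prop :=
  exists w1 w2 : R * R,
    [/\ w1.1 * w2.2 - w1.2 * w2.1 != 0,
        forall x, f (x + w1) = f x &
        forall x, f (x + w2) = f x].

Record adapted_angle (rhoM N : M -> 'cV[R]_4) (a : M -> R) (W1 W2 : M -> R * R)
    (alpha : R) (tau : R * R -> M) (rho nu V1 V2 : R * R -> 'cV[R]_4)
    (r : R * R -> R) : Prop := AdaptedAngle {
  tau_covering : covering_map tau;
  tau_smooth : smooth_into tau;
  rhoE : forall x, rho x = rhoM (tau x);
  nuE : forall x, nu x = N (tau x);
  V1E : forall x, V1 x = dmap rhoM (tau x) (W1 (tau x));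
  V2E : forall x, V2 x = dmap rhoM (tau x) (W2 (tau x));
  rho_smooth : smooth_plane rho;
  rho_periodic : doubly_periodic rho;
  r_smooth : smooth_plane r;
  norm_rho_u : forall x,
    dot (partial_u rho x) (partial_u rho x) = expR (- 2 * r x);
  norm_rho_v : forall x,
    dot (partial_v rho x) (partial_v rho x) = expR (- 2 * r x);
  dot_rho_uv : forall x, dot (partial_u rho x) (partial_v rho x) = 0;
  curvatureE : forall x, a (tau x) = expR (2 * r x);
  V1_frame : forall x, V1 x =
    expR (r x) *: (cos alpha *: partial_u rho x - sin alpha *: partial_v rho x);
  V2_frame : forall x, V2 x =
    expR (r x) *: (sin alpha *: partial_u rho x + cos alpha *: partial_v rho x);
  rho_uu : forall x, partial_u (partial_u rho) x =
    - partial_u r x *: partial_u rho x + partial_v r x *: partial_v rho x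
    + cos (2 * alpha) *: nu x - expR (- 2 * r x) *: rho x;
  rho_vv : forall x, partial_v (partial_v rho) x =
    partial_u r x *: partial_u rho x - partial_v r x *: partial_v rho x
    - cos (2 * alpha) *: nu x - expR (- 2 * r x) *: rho x;
  rho_uv : forall x, partial_v (partial_u rho) x =
    - partial_v r x *: partial_u rho x - partial_u r x *: partial_v rho x
    - sin (2 * alpha) *: nu x;
  nu_u : forall x, partial_u nu x =
    expR (2 * r x) *: (- cos (2 * alpha) *: partial_u rho x
                       + sin (2 * alpha) *: partial_v rho x);
  nu_v : forall x, partial_v nu x =
    expR (2 * r x) *: (sin (2 * alpha) *: partial_u rho x
                       + cos (2 * alpha) *: partial_v rho x);
  (* 2 sinh (2 r) = exp (2 r) - exp (- 2 r) *)
  sinh_gordon : forall x,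
    partial_u (partial_u r) x + partial_v (partial_v r) x
    + (expR (2 * r x) - expR (- 2 * r x)) = 0
}.

Definition adapted_data (rhoM N : M -> 'cV[R]_4) (a : M -> R)
    (W1 W2 : M -> R * R) (tau : R * R -> M)
    (rho nu V1 V2 : R * R -> 'cV[R]_4) (r : R * R -> R) : Prop :=
  exists alpha, adapted_angle rhoM N a W1 W2 alpha tau rho nu V1 V2 r.

End Geometry.

Record solution_S (R : realType) (B : 'M[R]_4) (theta : R)
    (p V1 V2 nu : R * R -> 'cV[R]_4) (r s : R * R -> R) : Prop := SolutionS {
  S_differentiable : forall x,
    [/\ differentiable p x, differentiable V1 x & differentiable V2 x] /\
    [/\ differentiable nu x, differentiable r x & differentiable s x];
  S_p_u : forall x, partial_u p x =
    expR (- r x) *: (cos theta *: V1 x + sin theta *: V2 x);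
  S_V1_u : forall x, partial_u V1 x =
    s x *: V2 x + cos theta *: (expR (r x) *: nu x - expR (- r x) *: p x);
  S_V2_u : forall x, partial_u V2 x =
    - s x *: V1 x - sin theta *: (expR (r x) *: nu x + expR (- r x) *: p x);
  S_nu_u : forall x, partial_u nu x =
    expR (r x) *: (- cos theta *: V1 x + sin theta *: V2 x);
  S_r_u : forall x, partial_u r x = dot (B *m p x) (nu x);
  S_s_u : forall x, partial_u s x =
    cos theta * dot (B *m V2 x) (expR (- r x) *: nu x - expR (r x) *: p x)
    - sin theta * dot (B *m V1 x) (expR (- r x) *: nu x + expR (r x) *: p x);
  S_p_v : forall x, partial_v p x =
    expR (- r x) *: (cos theta *: V2 x - sin theta *: V1 x);
  S_V1_v : forall x, partial_v V1 x =
    - dot (B *m p x) (nu x) *: V2 x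
    + sin theta *: (- expR (r x) *: nu x + expR (- r x) *: p x);
  S_V2_v : forall x, partial_v V2 x =
    dot (B *m p x) (nu x) *: V1 x
    - cos theta *: (expR (r x) *: nu x + expR (- r x) *: p x);
  S_nu_v : forall x, partial_v nu x =
    expR (r x) *: (sin theta *: V1 x + cos theta *: V2 x);
  S_r_v : forall x, partial_v r x = s x;
  S_s_v : forall x, partial_v s x =
    expR (- 2 * r x) - expR (2 * r x)
    - sin theta * dot (B *m V2 x) (expR (- r x) *: nu x - expR (r x) *: p x)
    - cos theta * dot (B *m V1 x) (expR (- r x) *: nu x + expR (r x) *: p x)
}.

(* Main.v *)
(* Pulled back to the plane by a universal covering F of the torus M, the two forms
   sqrt(a) <d rho, E_i>, where (E_1, E_2) is the principal frame rotated by theta,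
   are closed by the Codazzi equations (symmetry of the second derivatives of rho
   and N).  Their primitives form a map Phi of the plane whose differential is
   periodic and invertible, hence uniformly so: Newton's method with uniform
   constants makes Phi surjective, path lifting makes it injective.  The adapted
   coordinates are tau = F o Phi^-1, with alpha = theta and r = ln(a o tau) / 2;
   they are doubly periodic because Phi commutes with the periods up to constants,
   which span the plane since Phi is onto.  In these coordinates h_theta = 2 f_B
   says that r_u = <B rho, nu>; with the structure equations of the frame and the
   Gauss equation (sinh-Gordon), differentiation yields the system. *)

From HB Require Import structures.
Require Import Defs.
From mathcomp Require Import all_boot all_order all_algebra.
From mathcomp Require Import all_classical all_reals all_analysis.
From mathcomp Require Import ring lra.
Set Implicit Arguments.
Unset Strict Implicit.
Unset Printing Implicit Defensive.
Import Order.TTheory GRing.Theory Num.Theory.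
Import numFieldNormedType.Exports.
Local Open Scope classical_set_scope.
Local Open Scope ring_scope.

(** The factor sqrt(a) is dictated by the opposite eigenvalues of dN: comparing the curls of <dN,
    W_i> and <d rho, W_i> shows that d<d rho, W_i> is minus half of da/a wedge <d rho, W_i>, which
    multiplication by sqrt(a) cancels. A constant rotation keeps the forms closed, and theta is the
    angle for which rho_u is cos(theta) W_1 + sin(theta) W_2 divided by sqrt(a): then a_u = a
    h_theta, that is h_theta = 2 r_u. The obstacle is global. Closed forms alone give local
    coordinates, and a local diffeomorphism of the plane need be neither injective nor onto;
    compactness of the torus supplies one radius and one Lipschitz constant valid at every point.
    Orthogonality of W_1 and W_2 is not among the data: it is derived from the symmetry of the
    second fundamental form. Components of tangent vectors refer to a chart chosen separately at
    each point, so second derivatives are taken only of maps pulled back to the plane. *)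

Lemma scale_is_bilinear (R : numFieldType) (W : normedModType R) :
  bilinear_for (GRing.Scale.Law.clone _ _ *:%R _)
    (GRing.Scale.Law.clone _ _ *:%R _) (@GRing.scale R W).
Proof.
split=> [w | k] a x y /=; first by rewrite scalerDl scalerA.
by rewrite scalerDr !scalerA mulrC.
Qed.
(** Makes the differential of continuous bilinear maps apply to [k *: f], whence the product rule
    with values in any normed module. *)
HB.instance Definition _ (R : numFieldType) (W : normedModType R) :=
  bilinear_isBilinear.Build R R W W _ _ (@GRing.scale R W)
    (@scale_is_bilinear R W).

(** * Smooth functions on open sets of the plane *)

Section Calculus.
Context {R : realType}.
Implicit Types (U V : set (R * R)) (W : normedModType R).

Lemma derive_diff W W' (f : W' -> W) x v :
  differentiable f x -> 'D_v f x = 'd f x v.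
Proof. exact: deriveE. Qed.

Lemma differentiable_scale W W' (k : W' -> R) (f : W' -> W) x :
  differentiable k x -> differentiable f x ->
  differentiable (fun y => k y *: f y) x.
Proof.
move=> kd fd.
apply: (@differentiable_comp _ _ (R * W)%type _ (fun y => (k y, f y))
  (fun p => p.1 *: p.2)); first exact: differentiable_pair.
apply: (@differentiable_bilin R R W W (@GRing.scale R W : {bilinear _ -> _ -> _})).
exact: scale_continuous.
Qed.

Lemma derive_scale W W' (k : W' -> R) (f : W' -> W) x v :
  differentiable k x -> differentiable f x ->
  'D_v (fun y => k y *: f y) x = 'D_v k x *: f x + k x *: 'D_v f x.
Proof.
move=> kd fd; rewrite !derive_diff//; last exact: differentiable_scale.
have sc : continuous (fun p : R * W => p.1 *: p.2) by exact: scale_continuous.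
rewrite (@diff_comp _ _ (R * W)%type _ (fun y => (k y, f y))
  (fun p => p.1 *: p.2)); first last.
- exact: (@differentiable_bilin R R W W (@GRing.scale R W : {bilinear _ -> _ -> _})).
- exact: differentiable_pair.
rewrite (@diff_bilin R R W W (@GRing.scale R W : {bilinear _ -> _ -> _}))//=.
by rewrite diff_pair//= addrC.
Qed.

Lemma derive_comp W W' W'' (f : W' -> W) (g : W'' -> W') x v :
  differentiable f (g x) -> differentiable g x ->
  'D_v (f \o g) x = 'D_('D_v g x) f (g x).
Proof.
move=> fd gd; have fgd := differentiable_comp gd fd.
by rewrite (deriveE _ fgd) (deriveE _ gd) (deriveE _ fd) diff_comp.
Qed.

Lemma derive_linear W W' (f : W' -> W) x a v w : differentiable f x ->
  'D_(a *: v + w) f x = a *: 'D_v f x + 'D_w f x.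
Proof. by move=> fd; rewrite !(deriveE _ fd) linearP. Qed.

Lemma plane_basis (v : R * R) : v = v.1 *: (1, 0) + v.2 *: (0, 1).
Proof.
have -> : v.1 *: (1, 0) + v.2 *: (0, 1) =
  (v.1 * 1 + v.2 * 0, v.1 * 0 + v.2 * 1) :> R * R by [].
by rewrite !mulr1 !mulr0 addr0 add0r; case: v.
Qed.

Lemma derive_plane W (f : R * R -> W) x v : differentiable f x ->
  'D_v f x = v.1 *: partial_u f x + v.2 *: partial_v f x.
Proof.
move=> fd; rewrite /partial_u /partial_v !(deriveE _ fd) -!linearZ -linearD.
by rewrite -plane_basis.
Qed.

Lemma derive_entry m n W' (f : W' -> 'M[R]_(m, n)) x v i j :
  derivable f x v -> 'D_v (fun y => f y i j) x = 'D_v f x i j.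
Proof. by move=> fd; rewrite derive_mx// mxE. Qed.

(** Unlike in [Cn_on_local], the local model [g] need be regular only on [V]: the models used later
    are composites with charts, controlled on a part of the plane only. *)
Lemma Cn_on_near W n U (f : R * R -> W) :
  (forall x, U x -> exists V g, [/\ V x, Cn_on n V g & \near x, f x = g x]) ->
  Cn_on n U f.
Proof.
elim: n f => [|n IHn] f H /=.
  move=> x /H[V [g [Vx gc fg]]].
  rewrite /prop_for /continuous_at (nbhs_singleton fg).
  by have gcx := gc x Vx; apply: cvg_trans gcx; apply: near_eq_cvg; apply: filterS fg.
split=> [x /H[V [g [Vx [gd _] fg]]] | v].
  by apply: (near_eq_differentiable fg); exact: gd.
apply: IHn => x /H[V [g [Vx [_ gd] fg]]].
exists V, ('D_v g); split=> //; first exact: gd.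
move: fg => /near_join; apply: filterS => y; exact: near_eq_derive.
Qed.

Lemma Cn_on_eq W n U (f g : R * R -> W) : open U ->
  (forall x, U x -> f x = g x) -> Cn_on n U g -> Cn_on n U f.
Proof.
move=> oU fg gn; apply: Cn_on_near => x Ux; exists U, g; split=> //.
by apply: filterS (open_nbhs_nbhs (conj oU Ux)) => y; exact: fg.
Qed.

Lemma Cn_on_sub W n U V (f : R * R -> W) :
  U `<=` V -> Cn_on n V f -> Cn_on n U f.
Proof.
move=> UV fn; apply: Cn_on_near => x /UV Vx; exists V, f; split=> //.
exact: filterE.
Qed.

Lemma Cn_onS W n U (f : R * R -> W) : Cn_on n.+1 U f -> Cn_on n U f.
Proof.
elim: n f => [|n IHn] f; last first.
  by move=> [fd fn]; split=> // v; apply: IHn; exact: fn.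
by move=> [fd _] x /fd /differentiable_continuous.
Qed.

Lemma smooth_on_differentiable W U (f : R * R -> W) x :
  smooth_on U f -> U x -> differentiable f x.
Proof. by move=> /(_ 1%N)[+ _]; exact. Qed.

Lemma smooth_on_continuous W U (f : R * R -> W) x :
  smooth_on U f -> U x -> {for x, continuous f}.
Proof. by move=> /(_ 0%N); exact. Qed.

Lemma smooth_on_derive W U (f : R * R -> W) v :
  smooth_on U f -> smooth_on U ('D_v f).
Proof. by move=> fs n; have [_ fn] := fs n.+1; exact: fn. Qed.

Lemma Cn_onD W n U (f g : R * R -> W) : open U ->
  Cn_on n U f -> Cn_on n U g -> Cn_on n U (fun x => f x + g x).
Proof.
move=> oU; elim: n f g => [|n IHn] f g /=.
  by move=> fc gc x Ux; apply: cvgD; [exact: fc | exact: gc].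
move=> [fd fn] [gd gn]; split=> [x Ux | v].
  by apply: differentiableD; [exact: fd | exact: gd].
apply: (@Cn_on_eq _ _ _ _ (fun x => 'D_v f x + 'D_v g x)) => //; last exact: IHn.
move=> x Ux; apply: deriveD; apply: diff_derivable; [exact: fd | exact: gd].
Qed.

Lemma Cn_on_scale W n U (k : R * R -> R) (f : R * R -> W) : open U ->
  Cn_on n U k -> Cn_on n U f -> Cn_on n U (fun x => k x *: f x).
Proof.
move=> oU; elim: n k f => [|n IHn] k f.
  by move=> kc fc x Ux; apply: cvgZ; [exact: kc | exact: fc].
move=> kn fn; have [kd kn'] := kn; have [fd fn'] := fn.
split=> [x Ux | v].
  by apply: differentiable_scale; [exact: kd | exact: fd].
apply: (@Cn_on_eq _ _ _ _ (fun x => 'D_v k x *: f x + k x *: 'D_v f x)) => //.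
  by move=> x Ux; apply: derive_scale; [exact: kd | exact: fd].
have kn1 := Cn_onS kn; have fn1 := Cn_onS fn.
by apply: Cn_onD => //; apply: IHn => //; [exact: kn' | exact: fn'].
Qed.

Lemma Cn_on_pair n U (f g : R * R -> R) : open U ->
  Cn_on n U f -> Cn_on n U g -> Cn_on n U (fun x => (f x, g x)).
Proof.
move=> oU; elim: n f g => [|n IHn] f g /=.
  by move=> fc gc x Ux; exact: (cvg_pair (fc x Ux) (gc x Ux)).
move=> [fd fn] [gd gn]; split=> [x Ux | v].
  by apply: differentiable_pair; [exact: fd | exact: gd].
apply: (@Cn_on_eq _ _ _ _ (fun x => ('D_v f x, 'D_v g x))) => //; last exact: IHn.
move=> x Ux; have [fdx gdx] := (fd x Ux, gd x Ux).
rewrite (deriveE _ fdx) (deriveE _ gdx) (deriveE _ (differentiable_pair fdx gdx)).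
by rewrite diff_pair.
Qed.

Lemma differentiable_fst W W' (x : W * W') : differentiable fst x.
Proof.
have : continuous (fst : W * W' -> W) by move=> ?; exact: cvg_fst.
exact: linear_differentiable.
Qed.

Lemma differentiable_snd W W' (x : W * W') : differentiable snd x.
Proof.
have : continuous (snd : W * W' -> W') by move=> ?; exact: cvg_snd.
exact: linear_differentiable.
Qed.

Lemma derive_fst W W' W'' (f : W'' -> W * W') x v : differentiable f x ->
  'D_v (fun y => (f y).1) x = ('D_v f x).1.
Proof.
move=> fd; rewrite (@derive_comp _ _ _ fst)//; last exact: differentiable_fst.
rewrite derive_diff; last exact: differentiable_fst.
by rewrite diff_lin//; move=> ?; exact: cvg_fst.
Qed.

Lemma derive_snd W W' W'' (f : W'' -> W * W') x v : differentiable f x ->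
  'D_v (fun y => (f y).2) x = ('D_v f x).2.
Proof.
move=> fd; rewrite (@derive_comp _ _ _ snd)//; last exact: differentiable_snd.
rewrite derive_diff; last exact: differentiable_snd.
by rewrite diff_lin//; move=> ?; exact: cvg_snd.
Qed.

Lemma Cn_on_fst n U (f : R * R -> R * R) : open U ->
  Cn_on n U f -> Cn_on n U (fun x => (f x).1).
Proof.
move=> oU; elim: n f => [|n IHn] f /=.
  by move=> fc x Ux; apply: (cvg_comp _ _ (fc x Ux)); exact: cvg_fst.
move=> [fd fn]; split=> [x Ux | v].
  by apply: (@differentiable_comp _ _ _ _ f fst); [exact: fd | exact: differentiable_fst].
apply: (@Cn_on_eq _ _ _ _ (fun x => ('D_v f x).1)) => //; last exact: IHn.
by move=> x Ux; rewrite derive_fst//; exact: fd.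
Qed.

Lemma Cn_on_snd n U (f : R * R -> R * R) : open U ->
  Cn_on n U f -> Cn_on n U (fun x => (f x).2).
Proof.
move=> oU; elim: n f => [|n IHn] f /=.
  by move=> fc x Ux; apply: (cvg_comp _ _ (fc x Ux)); exact: cvg_snd.
move=> [fd fn]; split=> [x Ux | v].
  by apply: (@differentiable_comp _ _ _ _ f snd); [exact: fd | exact: differentiable_snd].
apply: (@Cn_on_eq _ _ _ _ (fun x => ('D_v f x).2)) => //; last exact: IHn.
by move=> x Ux; rewrite derive_snd//; exact: fd.
Qed.

(** The chain rule produces a derivative of [f] in a direction that varies with the point. Expanded
    on the two coordinate directions, it involves only derivatives of [f] in fixed directions, to
    which the induction hypothesis applies. *)
Lemma Cn_on_comp W n U V (f : R * R -> W) (g : R * R -> R * R) : open U ->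
  (forall x, U x -> V (g x)) -> Cn_on n V f -> Cn_on n U g ->
  Cn_on n U (f \o g).
Proof.
move=> oU UV; elim: n f => [|n IHn] f fn gn.
  by move=> x Ux; apply: (cvg_comp _ _ (gn x Ux)); exact/fn/UV.
have [gd gn'] := gn; have [fd fn'] := fn; split=> [x Ux | v].
  by apply: differentiable_comp; [exact: gd | exact/fd/UV].
apply: (@Cn_on_eq _ _ _ _ (fun x => ('D_v g x).1 *: (partial_u f \o g) x
    + ('D_v g x).2 *: (partial_v f \o g) x)) => // [x Ux | ].
  have fdx := fd _ (UV x Ux).
  by rewrite derive_comp ?derive_plane//; exact: gd.
have gn1 := Cn_onS gn.
have fu := IHn _ (fn' (1, 0)) gn1; have fv := IHn _ (fn' (0, 1)) gn1.
apply: Cn_onD => //; apply: Cn_on_scale => //.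
  by apply: Cn_on_fst => //; exact: gn'.
by apply: Cn_on_snd => //; exact: gn'.
Qed.

Lemma Cn_on_expR n U (f : R * R -> R) : open U -> Cn_on n U f ->
  Cn_on n U (fun x => expR (f x)).
Proof.
move=> oU; elim: n f => [|n IHn] f fn.
  move=> x Ux; apply: (@continuous_comp _ _ _ f expR); [exact: fn | exact: continuous_expR].
have [fd fn'] := fn; split=> [x Ux | v].
  apply: (@differentiable_comp _ _ _ _ f expR); first exact: fd.
  exact/derivable1_diffP/derivable_expR.
apply: (@Cn_on_eq _ _ _ _ (fun x => 'D_v f x *: expR (f x))) => //; last first.
  have fn1 := IHn _ (Cn_onS fn).
  by apply: Cn_on_scale => //; exact: fn'.
move=> x Ux; rewrite (@derive_comp _ _ _ expR); last exact: fd; last first.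
  exact/derivable1_diffP/derivable_expR.
rewrite derive_diff; last exact/derivable1_diffP/derivable_expR.
rewrite deriv1E; last exact/derivable_expR.
by rewrite derive1E derive_val.
Qed.

Lemma derive_expR_scale W (k : R) (f : W -> R) w x : differentiable f x ->
  'D_w (fun y => expR (k * f y)) x = k * 'D_w f x * expR (k * f x).
Proof.
move=> fd.
have kd : differentiable (fun y => k * f y) x.
  by apply: (@differentiable_scale _ _ (cst k) f) => //; exact: differentiable_cst.
have ed (t : R) : differentiable (@expR R) t by exact/derivable1_diffP/derivable_expR.
rewrite (@derive_comp _ _ _ (@expR R) (fun y => k * f y))// (deriveE _ (ed _)).
rewrite deriv1E; last exact/derivable_expR.
rewrite derive1E derive_val.
have fdw : derivable f x w by exact: diff_derivable.
by have -> : 'D_w (fun y => k * f y) x = k * 'D_w f x by exact: (deriveZ k fdw).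
Qed.

Lemma Cn_on_inv n U (f : R * R -> R) : open U -> (forall x, U x -> f x != 0) ->
  Cn_on n U f -> Cn_on n U (fun x => (f x)^-1).
Proof.
move=> oU f0; elim: n => [|n IHn] fn.
  by move=> x Ux; apply: cvgV; [exact: f0 | exact: fn].
have [fd fn'] := fn; split=> [x Ux | v].
  by apply: differentiableV; [exact: fd | exact: f0].
have fVn := IHn (Cn_onS fn).
apply: (@Cn_on_eq _ _ _ _ (fun x => ((f x)^-1 *: (f x)^-1) *: ((- 1) *: 'D_v f x))) => //.
  move=> x Ux; rewrite deriveV; [| exact: f0| by apply: diff_derivable; exact: fd].
  by rewrite scaleN1r scalerN scaleNr expr2 invfM.
apply: Cn_on_scale => //; first exact: Cn_on_scale.
by apply: Cn_on_scale => //; [exact: Cn_on_cst | exact: fn'].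
Qed.

Lemma Cn_on_ln n U (f : R * R -> R) : open U -> (forall x, U x -> 0 < f x) ->
  Cn_on n U f -> Cn_on n U (fun x => ln (f x)).
Proof.
move=> oU f0 ; case: n => [|n] fn.
  move=> x Ux; apply: (@continuous_comp _ _ _ f (@ln R)); first exact: fn.
  by apply: continuous_ln; exact: f0.
have [fd fn'] := fn; split=> [x Ux | v].
  apply: (@differentiable_comp _ _ _ _ f (@ln R)); first exact: fd.
  by apply/derivable1_diffP; apply: ex_derive; apply: is_derive1_ln; exact: f0.
apply: (@Cn_on_eq _ _ _ _ (fun x => (f x)^-1 *: 'D_v f x)) => //; last first.
  apply: Cn_on_scale => //; last exact: fn'.
  apply: Cn_on_inv => //; last exact: Cn_onS fn.
  by move=> x Ux; rewrite gt_eqF// f0.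
move=> x Ux; have ld := is_derive1_ln (f0 x Ux).
have ldr : derivable (@ln R) (f x) 1 by exact: ex_derive.
rewrite (@derive_comp _ _ _ (@ln R)); [|exact/derivable1_diffP | exact: fd].
rewrite derive_diff; last exact/derivable1_diffP.
by rewrite deriv1E// derive1E derive_val; exact: mulrC.
Qed.

End Calculus.

(** * Mean values, symmetry of second derivatives, differentiability from a continuous gradient *)

Section Differentiation.
Context {R : realType}.
Implicit Types W : normedModType R.

Lemma differentiable_approx W W' (f : W -> W') x (L : {linear W -> W'}) :
  continuous L ->
  (forall e, 0 < e -> \forall h \near 0, `|f (x + h) - f x - L h| <= e * `|h|) ->
  differentiable f x /\ 'd f x = L :> (W -> W').
Proof.
move=> Lc fL.
have dE : f \o shift x = cst (f x) + L +o_ 0 id.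
  apply/eqaddoP => e e0; apply: filterS (fL e e0) => h.
  rewrite [x + h]addrC; apply: le_trans; rewrite le_eqVlt; apply/orP; left.
  by apply/eqP; congr `|_|; rewrite -addrA -opprD.
have dfE := diff_unique Lc dE; split; last exact: dfE.
by apply/diff_locallyP; rewrite dfE.
Qed.

Lemma is_derive_line W W' (f : W -> W') x h t : derivable f (x + t *: h) h ->
  is_derive t 1 (fun s : R => f (x + s *: h)) ('D_h f (x + t *: h)).
Proof.
move=> fd.
have E : (fun k : R => k^-1 *: (((fun s : R => f (x + s *: h)) \o shift t) (k *: 1)
    - f (x + t *: h))) =
  (fun k : R => k^-1 *: ((f \o shift (x + t *: h)) (k *: h) - f (x + t *: h))).
  apply/funext => k /=; congr (_ *: (f _ - _)).
  by rewrite scalerDl [k *: 1]mulr1 addrCA.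
by apply: DeriveDef; rewrite /derivable /derive /= E.
Qed.

Lemma mean_value_line W (f : W -> R) x h : (forall y, derivable f y h) ->
  exists2 t : R, 0 <= t <= 1 & f (x + h) - f x = 'D_h f (x + t *: h).
Proof.
move=> fd.
pose g := fun s : R => f (x + s *: h).
have gd (t : R) : is_derive t 1 g ('D_h f (x + t *: h)) by exact: is_derive_line.
have gc : {within `[0, 1], continuous g}.
  by apply: derivable_within_continuous => t _; exact: ex_derive.
have [t t01 E] := MVT ltr01 (fun t _ => gd t) gc.
exists t; first by move: t01; rewrite in_itv/= => /andP[/ltW-> /ltW->].
by move: E; rewrite /g subr0 mulr1 scale1r scale0r addr0.
Qed.

Lemma derive_scale_dir W W' (f : W -> W') x (a : R) v : differentiable f x ->
  'D_(a *: v) f x = a *: 'D_v f x.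
Proof. by move=> fd; rewrite !(deriveE _ fd) linearZ. Qed.

Lemma is_derive_translate W W' (f : W -> W') (a : W) x v :
  derivable f (x + a) v ->
  is_derive x v (fun y => f (y + a)) ('D_v f (x + a)).
Proof.
move=> fd.
have E : (fun k : R => k^-1 *: (((fun y => f (y + a)) \o shift x) (k *: v)
    - f (x + a))) =
  (fun k : R => k^-1 *: ((f \o shift (x + a)) (k *: v) - f (x + a))).
  by apply/funext => k /=; rewrite addrA.
by apply: DeriveDef; rewrite /derivable /derive /= E.
Qed.

(** Two applications of the mean value theorem: along [v] to the increment of [f] by [s *: w], then
    along [w] to the derivative of [f] along [v]. *)
Lemma second_difference W (f : W -> R) x (s : R) v w :
  (forall y, differentiable f y) -> (forall y, differentiable ('D_v f) y) ->
  exists t t' : R, [/\ 0 <= t <= 1, 0 <= t' <= 1 &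
    f (x + s *: v + s *: w) - f (x + s *: v) - (f (x + s *: w) - f x)
    = s * (s * 'D_w ('D_v f) (x + t *: (s *: v) + t' *: (s *: w)))].
Proof.
move=> fd fvd.
pose F y := f (y + s *: w) - f y.
have Fd y u : derivable F y u.
  apply: derivableB; last exact: diff_derivable.
  by apply: (@ex_derive _ _ _ _ _ _ _ (is_derive_translate _)); exact: diff_derivable.
have [t t01 Et] := mean_value_line x (fun y => Fd y (s *: v)).
pose G y := 'D_(s *: v) f y.
have GE y : G y = s *: 'D_v f y by exact: derive_scale_dir.
have Gd y : derivable G y (s *: w).
  have -> : G = s \*: 'D_v f by apply/funext => z; rewrite GE.
  by apply: derivableZ; apply: diff_derivable.
have [t' t01' Et'] := mean_value_line (x + t *: (s *: v)) Gd.
exists t, t'; split=> //; rewrite [LHS]Et deriveB; first last.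
- exact: diff_derivable.
- by apply: (@ex_derive _ _ _ _ _ _ _ (is_derive_translate _)); exact: diff_derivable.
rewrite (@derive_val _ _ _ _ _ _ _ (is_derive_translate _)); last exact: diff_derivable.
rewrite Et'.
have -> : G = s \*: 'D_v f by apply/funext => z; rewrite GE.
rewrite deriveZ; last exact: diff_derivable.
by rewrite derive_scale_dir.
Qed.

(** The second difference over the parallelogram of sides [s *: v] and [s *: w] is symmetric in [v]
    and [w], so the two mixed derivatives agree at some pair of points close to [x]. A gap [e]
    between their values at [x] would contradict continuity of both within [e / 2]. *)
Lemma derive_symmetric W (f : W -> R) x v w :
  (forall y, differentiable f y) -> (forall u y, differentiable ('D_u f) y) ->
  {for x, continuous ('D_w ('D_v f))} -> {for x, continuous ('D_v ('D_w f))} ->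
  'D_w ('D_v f) x = 'D_v ('D_w f) x.
Proof.
move=> fd fdd c1 c2; apply/eqP; rewrite -subr_eq0 -normr_eq0 -[_ == _]negbK.
apply/negP; rewrite -normr_gt0 normr_id => e0.
set e := `|_| in e0.
have e20 : 0 < e / 2 by rewrite divr_gt0.
have /cvgrPdist_lt/(_ _ e20)/nbhs_normP[/= d1 d10 h1] := c1.
have /cvgrPdist_lt/(_ _ e20)/nbhs_normP[/= d2 d20 h2] := c2.
pose d := Num.min d1 d2.
have d0 : 0 < d by rewrite lt_min d10.
have dd1 : d <= d1 by rewrite ge_min lexx.
have dd2 : d <= d2 by rewrite ge_min lexx orbT.
pose C := `|v| + `|w| + 1.
have C0 : 0 < C by rewrite ltr_wpDl// addr_ge0.
(* Both intermediate points lie within [s * C = d / 2] of [x]; the summand 1 in [C] keeps it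
   positive when [v] and [w] vanish. *)
pose s := d / C / 2.
have s0 : 0 < s by rewrite !divr_gt0.
have close (t t' : R) v' w' : `|v'| + `|w'| + 1 = C -> 0 <= t <= 1 -> 0 <= t' <= 1 ->
    `|x - (x + t *: (s *: v') + t' *: (s *: w'))| < d.
  move=> CE /andP[t0 t1] /andP[t0' t1'].
  have nZ (k : R) (z : W) : 0 <= k -> `|k *: z| = k * `|z|.
    by move=> k0; rewrite normrZ ger0_norm.
  rewrite -addrA opprD addrA subrr add0r normrN.
  apply: (le_lt_trans (ler_normD _ _)); rewrite !nZ ?(ltW s0)//.
  have h3 : t * (s * `|v'|) <= s * `|v'| by rewrite ler_piMl// mulr_ge0// ltW.
  have h4 : t' * (s * `|w'|) <= s * `|w'| by rewrite ler_piMl// mulr_ge0// ltW.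
  apply: (le_lt_trans (lerD h3 h4)); rewrite -mulrDr.
  have h5 : s * C = d / 2 by rewrite /s; field; rewrite gt_eqF.
  have : s * (`|v'| + `|w'|) <= s * C by rewrite ler_pM2l// -CE lerDl.
  rewrite h5; lra.
have [t1 [r1 [a1 b1 E1]]] := second_difference x s w fd (fdd v).
have [t2 [r2 [a2 b2 E2]]] := second_difference x s v fd (fdd w).
have E : 'D_w ('D_v f) (x + t1 *: (s *: v) + r1 *: (s *: w)) =
         'D_v ('D_w f) (x + t2 *: (s *: w) + r2 *: (s *: v)).
  have sn0 : s != 0 by rewrite gt_eqF.
  have : s * (s * 'D_w ('D_v f) (x + t1 *: (s *: v) + r1 *: (s *: w))) =
         s * (s * 'D_v ('D_w f) (x + t2 *: (s *: w) + r2 *: (s *: v))).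
    have sw (a b c k : R) : a - b - (c - k) = a - c - (b - k) by ring.
    apply: (etrans (esym E1)); apply: (etrans _ E2).
    rewrite (addrAC x (s *: w)); exact: sw.
  by move=> /(mulfI sn0)/(mulfI sn0).
have /= k1 := h1 _ (lt_le_trans (close t1 r1 v w erefl a1 b1) dd1).
have CE : `|w| + `|v| + 1 = C by rewrite [`|w| + _]addrC.
have /= k2 := h2 _ (lt_le_trans (close t2 r2 w v CE a2 b2) dd2).
suff : e < e by rewrite ltxx.
have near_near (a b c k : R) :
    c = k -> `|a - c| < e / 2 -> `|b - k| < e / 2 -> `|a - b| < e.
  move=> <- ac; rewrite distrC => cb; rewrite (splitr e).
  by rewrite -(subrKA c); apply: (le_lt_trans (ler_normD _ _)); exact: ltrD.
exact: near_near E k1 k2.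
Qed.

Lemma smooth_symmetric (f : R * R -> R) v w : smooth_plane f ->
  'D_w ('D_v f) = 'D_v ('D_w f).
Proof.
move=> fs; apply/funext => x; apply: derive_symmetric.
- by move=> y; exact: (smooth_on_differentiable fs).
- by move=> u y; exact: (smooth_on_differentiable (smooth_on_derive u fs)).
- exact: (smooth_on_continuous (smooth_on_derive w (smooth_on_derive v fs))).
- exact: (smooth_on_continuous (smooth_on_derive v (smooth_on_derive w fs))).
Qed.

(** The mean value theorem on the segment from [x] to [x + h] turns the increment of [f] into the
    gradient at an intermediate point, which continuity of [p] and [q] compares with the gradient at
    [x]. *)
Lemma differentiable_gradient (f : R * R -> R) (p q : R * R -> R) x :
  continuous p -> continuous q ->
  (forall y v, is_derive y v f (v.1 * p y + v.2 * q y)) -> differentiable f x.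
Proof.
move=> pc qc fd.
pose dL (h : R * R) := h.1 * p x + h.2 * q x.
have lindL : linear dL.
  by move=> a u v; rewrite /dL /= /GRing.scale/= ; ring.
pose dLm := GRing.isLinear.Build _ _ _ _ _ lindL.
pose L : {linear (R * R)%type -> R} := HB.pack dL dLm.
apply: (@differentiable_approx _ _ _ _ L _ _).1.
  move=> h; apply: cvgD; apply: cvgMl.
    exact: cvg_fst.
  exact: cvg_snd.
move=> e e0.
have e20 : 0 < e / 2 by rewrite divr_gt0.
have /cvgrPdist_lt/(_ _ e20)/nbhs_normP[/= d1 d10 h1] := pc x.
have /cvgrPdist_lt/(_ _ e20)/nbhs_normP[/= d2 d20 h2] := qc x.
have small (d : R) : 0 < d -> \forall h \near (0 : R * R), `|h| < d.
  by move=> d0; exact: (@nbhs0_lt R (R * R)%type).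
near=> h.
have [t /andP[t0 t1] ->] := @mean_value_line _ f x h (fun y => @ex_derive _ _ _ _ _ _ _ (fd y h)).
rewrite derive_val /L /= /dL.
have hn : `|x - (x + t *: h)| <= `|h|.
  rewrite opprD addrA subrr add0r normrN normrZ ger0_norm//.
  by rewrite ler_piMl.
have k1 : `|p x - p (x + t *: h)| < e / 2.
  apply: h1 => /=; apply: (le_lt_trans hn); near: h; exact: small.
have k2 : `|q x - q (x + t *: h)| < e / 2.
  apply: h2 => /=; apply: (le_lt_trans hn); near: h; exact: small.
rewrite (_ : _ - _ = - (h.1 * (p x - p (x + t *: h)) + h.2 * (q x - q (x + t *: h)))); last by ring.
rewrite normrN; apply: (le_trans (ler_normD _ _)); rewrite !normrM.
have n1 : `|h.1| <= `|h| by rewrite prod_normE le_max lexx.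
have n2 : `|h.2| <= `|h| by rewrite prod_normE le_max lexx orbT.
have := ler_pM (normr_ge0 _) (normr_ge0 _) n1 (ltW k1).
have := ler_pM (normr_ge0 _) (normr_ge0 _) n2 (ltW k2).
lra.
Unshelve. all: by end_near. Qed.

End Differentiation.

(** * Primitives of closed forms *)

Section Poincare.
Context {R : realType}.
Notation mu := (@lebesgue_measure R).

Lemma is_derive_scaled_arg (f : R * R -> R) (t : R) (y v : R * R) :
  differentiable f (t *: y) ->
  is_derive y v (fun z => f (t *: z)) (t * 'D_v f (t *: y)).
Proof.
move=> fd.
have td : differentiable (fun z : R * R => t *: z) y.
  by apply: ex_diff.
have fdt : differentiable (fun z : R * R => f (t *: z)) y.
  exact: (differentiable_comp td fd).
apply: DeriveDef; first exact: diff_derivable.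
rewrite (@derive_comp _ _ _ _ f (fun z : R * R => t *: z))//.
have -> : 'D_v (fun z : R * R => t *: z) y = t *: v.
  by rewrite deriveZ// derive_id.
by rewrite derive_scale_dir.
Qed.

(** The primitive integrates the form along the ray from the origin. After differentiation under the
    integral sign, closedness turns the integrand into an exact derivative in [t]. *)
Lemma poincare_derive (p q : R * R -> R) (x v : R * R) :
  smooth_plane p -> smooth_plane q ->
  (forall y, partial_v p y = partial_u q y) ->
  is_derive x v
    (fun y : R * R => \int[mu]_(t in `[0, 1]) (y.1 * p (t *: y) + y.2 * q (t *: y)))
    (v.1 * p x + v.2 * q x).
Proof.
move=> ps qs pq.
have pd y : differentiable p y by exact: (smooth_on_differentiable ps).
have qd y : differentiable q y by exact: (smooth_on_differentiable qs).
have pc : continuous p by move=> y; exact: (smooth_on_continuous ps).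
have qc : continuous q by move=> y; exact: (smooth_on_continuous qs).
have pvc w : continuous ('D_w p).
  by move=> y; exact: (smooth_on_continuous (smooth_on_derive w ps)).
have qvc w : continuous ('D_w q).
  by move=> y; exact: (smooth_on_continuous (smooth_on_derive w qs)).
pose g (t : R) (y : R * R) := y.1 * p (t *: y) + y.2 * q (t *: y).
pose dg (t : R) (y : R * R) := v.1 * p (t *: y) + v.2 * q (t *: y)
  + t * (y.1 * 'D_v p (t *: y) + y.2 * 'D_v q (t *: y)).
have gd (t : R) y : is_derive y v (g t) (dg t y).
  have d1 : is_derive y v (fun z : R * R => z.1) v.1.
    apply: DeriveDef; first exact/diff_derivable/differentiable_fst.
    by rewrite derive_fst// derive_id.
  have d2 : is_derive y v (fun z : R * R => z.2) v.2.
    apply: DeriveDef; first exact/diff_derivable/differentiable_snd.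
    by rewrite derive_snd// derive_id.
  have d3 := is_derive_scaled_arg v (pd (t *: y)).
  have d4 := is_derive_scaled_arg v (qd (t *: y)).
  have d5 := is_deriveD (is_deriveM d1 d3) (is_deriveM d2 d4).
  apply: (is_derive_eq d5); rewrite /dg /GRing.scale/=; ring.
(* Restriction to the line through [x] along [v]: differentiation under the integral is applied in
   the single real parameter [s]. *)
pose f (s t : R) := g t (x + s *: v).
have fd (s t : R) : is_derive s 1 (f ^~ t) (dg t (x + s *: v)).
  have gdv : derivable (g t) (x + s *: v) v by exact: ex_derive.
  have := is_derive_line gdv.
  by rewrite (@derive_val _ _ _ _ _ _ _ (gd t _)).
have lc : continuous (fun st : R * R => x + st.1 *: v).
  move=> st; apply: cvgD; first exact: cvg_cst.
  by apply: cvgZ; [exact: cvg_fst | exact: cvg_cst].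
have phic : continuous (fun st : R * R => st.2 *: (x + st.1 *: v)).
  by move=> st; apply: cvgZ; [exact: cvg_snd | exact: lc].
have phik (k : R * R -> R) : continuous k ->
    continuous (fun st : R * R => k (st.2 *: (x + st.1 *: v))).
  by move=> kc st; apply: (@continuous_comp _ _ _ (fun st : R * R => st.2 *: (x + st.1 *: v)) k); [exact: phic | exact: kc].
have lc1 : continuous (fun st : R * R => (x + st.1 *: v).1).
  by move=> st; apply: (@continuous_comp _ _ _ (fun st : R * R => x + st.1 *: v) fst); [exact: lc | exact: cvg_fst].
have lc2 : continuous (fun st : R * R => (x + st.1 *: v).2).
  by move=> st; apply: (@continuous_comp _ _ _ (fun st : R * R => x + st.1 *: v) snd); [exact: lc | exact: cvg_snd].
have dgc : continuous (fun st : R * R => dg st.2 (x + st.1 *: v)).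
  move=> st; apply: cvgD; [apply: cvgD|]; apply: cvgM;
    [exact: cvg_cst | exact: (phik p) | exact: cvg_cst | exact: (phik q)
    | exact: cvg_snd |].
  by apply: cvgD; apply: cvgM;
    [exact: lc1 | exact: (phik ('D_v p)) | exact: lc2 | exact: (phik ('D_v q))].
have gc : continuous (fun st : R * R => g st.2 (x + st.1 *: v)).
  by move=> st; apply: cvgD; apply: cvgM; [exact: lc1 | exact: (phik p) | exact: lc2 | exact: (phik q)].
have sec (k : R * R -> R) (s : R) : continuous k -> continuous (fun t : R => k (s, t)).
  move=> kc t; apply: (@continuous_comp _ _ _ (fun t : R => (s, t)) k); last exact: kc.
  have h1 : (fun=> s) u @[u --> t] --> s by exact: cvg_cst.
  have h2 : id u @[u --> t] --> t by exact: cvg_id.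
  exact: (cvg_pair h1 h2).
have int01 (k : R -> R) : continuous k -> mu.-integrable `[0, 1] (EFin \o k).
  move=> kc; apply: continuous_compact_integrable; first exact: segment_compact.
  exact: continuous_subspaceT.
(* The dominating function for the integral is a constant, by compactness of the rectangle of
   parameters. *)
have [C Cge] : exists C : R, forall s t : R, -1 <= s <= 1 -> 0 <= t <= 1 ->
    `|dg t (x + s *: v)| <= C.
  pose A := `[(-1 : R), 1]%classic `*` `[(0 : R), 1]%classic.
  have A0 : A !=set0 by exists (0, 0); split; rewrite /= in_itv/= ?lexx ?lerN10 ?ler01.
  have cA : compact A by apply: compact_setX; exact: segment_compact.
  have nc : {within A, continuous (fun st : R * R => `|dg st.2 (x + st.1 *: v)|)}.
    apply: continuous_subspaceT => st.
    apply: (@continuous_comp _ _ _ (fun st : R * R => dg st.2 (x + st.1 *: v)) Num.norm).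
      exact: dgc.
    exact: norm_continuous.
  have [c _ Hc] := compact_EVT_max A0 cA nc.
  exists `|dg c.2 (x + c.1 *: v)| => s t s1 t1.
  have /= := Hc (s, t); apply; rewrite inE; split; rewrite /= in_itv/=.
  - by [].
  - by [].
have C0 : 0 <= C by apply: le_trans (Cge 0 0 _ _); rewrite ?normr_ge0// ?lexx ?lerN10 ?ler01.
have I0 : `]-1, (1 : R)[%classic 0 by rewrite /= in_itv/= ltrN10 ltr01.
have d1E (s t : R) : partial1of2 f s t = dg t (x + s *: v).
  by rewrite partial1of2E (@derive_val _ _ _ _ _ _ _ (fd s t)).
have key := @cvg_differentiation_under_integral R _ _ mu f `[0, 1]%classic
  (measurable_itv _) 0 (-1) 1 I0 (fun s _ => int01 _ (sec _ s gc))
  (fun s t _ _ => @ex_derive _ _ _ _ _ _ _ (fd s t)) (cst C) (fun=> C0)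
  (int01 _ (@cst_continuous _ _ C)).
have {}key := key _.
have intE : \int[mu]_(t in `[0, 1]) partial1of2 f 0 t = v.1 * p x + v.2 * q x.
  (* [H] is the antiderivative in [t]: closedness is what identifies its derivative with [dg t x],
     and [H 1 - H 0] is the value of the form at [x]. *)
  pose H (t : R) := t * (v.1 * p (t *: x) + v.2 * q (t *: x)).
  have Hd (t : R) : is_derive t 1 H (dg t x).
    have dp : is_derive t 1 (fun t : R => p (t *: x)) ('D_x p (t *: x)).
      have dx : derivable p (0 + t *: x) x by exact: diff_derivable.
      have := is_derive_line dx; rewrite add0r.
      by under eq_fun do rewrite add0r.
    have dq : is_derive t 1 (fun t : R => q (t *: x)) ('D_x q (t *: x)).
      have dx : derivable q (0 + t *: x) x by exact: diff_derivable.
      have := is_derive_line dx; rewrite add0r.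
      by under eq_fun do rewrite add0r.
    have d6 := is_deriveM (is_derive_id t 1)
      (is_deriveD (is_deriveM (is_derive_cst v.1 t 1) dp) (is_deriveM (is_derive_cst v.2 t 1) dq)).
    apply: (is_derive_eq d6); rewrite /dg /GRing.scale/=.
    rewrite !(derive_plane _ (pd _)) !(derive_plane _ (qd _)) pq /GRing.scale/=.
    rewrite !fctE; ring.
  have -> : \int[mu]_(t in `[0, 1]) partial1of2 f 0 t = \int[mu]_(t in `[0, 1]) dg t x.
    by apply: eq_Rintegral => t _; rewrite d1E scale0r addr0.
  have Hc : continuous H.
    by move=> t; apply: differentiable_continuous; apply/derivable1_diffP; exact: ex_derive.
  rewrite /Rintegral (@continuous_FTC2 _ _ H)//.
  - by rewrite -EFinB /= /H mul0r subr0 mul1r scale1r.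
  - apply: continuous_subspaceT => t.
    have := sec _ 0 dgc; rewrite /=.
    by under eq_fun do rewrite scale0r addr0; apply.
  - split=> [t _||].
    + exact: ex_derive.
    + by apply: cvg_at_right_filter; exact: Hc.
    + by apply: cvg_at_left_filter; exact: Hc.
  - by move=> t _; rewrite derive1E (@derive_val _ _ _ _ _ _ _ (Hd t)).
have {}key : h^-1 *: ((fun s => \int[mu]_(t in `[0, 1]) f s t) (h + 0) -
   \int[mu]_(t in `[0, 1]) f 0 t) @[h --> 0^'] --> v.1 * p x + v.2 * q x.
  rewrite -intE; apply: key => s t; rewrite /= !in_itv/= => /andP[s1 s2] t01.
  by rewrite d1E; apply: Cge => //; rewrite !ltW.
pose U (y : R * R) := \int[mu]_(t in `[0, 1]) g t y.
have E : (fun h : R => h^-1 *: ((fun s => \int[mu]_(t in `[0, 1]) f s t) (h + 0) -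
   \int[mu]_(t in `[0, 1]) f 0 t)) =
   (fun h : R => h^-1 *: ((U \o shift x) (h *: v) - U x)).
  apply/funext => h /=; rewrite /U /f addr0 [h *: v + x]addrC.
  by under [in X in _ - X]eq_Rintegral do rewrite scale0r addr0.
rewrite E in key; apply: DeriveDef; first by apply/cvg_ex; exists (v.1 * p x + v.2 * q x).
exact: cvg_lim.
Qed.

Lemma poincare (p q : R * R -> R) : smooth_plane p -> smooth_plane q ->
  (forall x, partial_v p x = partial_u q x) ->
  exists U : R * R -> R, smooth_plane U /\
    forall x v, 'D_v U x = v.1 * p x + v.2 * q x.
Proof.
move=> ps qs pq.
pose U (y : R * R) := \int[mu]_(t in `[0, 1]) (y.1 * p (t *: y) + y.2 * q (t *: y)).
have Ud x v : is_derive x v U _ := poincare_derive x v ps qs pq.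
exists U; split; last by move=> x v; have := Ud x v => dU; rewrite derive_val.
case=> [|n] /=.
  move=> x _; apply: differentiable_continuous; apply: (@differentiable_gradient _ _ p q) => //.
  - by move=> y; exact: (smooth_on_continuous ps).
  - by move=> y; exact: (smooth_on_continuous qs).
split=> [x _|v].
  apply: (@differentiable_gradient _ _ p q) => //.
  - by move=> y; exact: (smooth_on_continuous ps).
  - by move=> y; exact: (smooth_on_continuous qs).
apply: (@Cn_on_eq _ _ _ _ _ (fun x => v.1 *: p x + v.2 *: q x)).
- exact: openT.
- by move=> x _; have := Ud x v => dU; rewrite derive_val.
apply: Cn_onD; first exact: openT.
  by apply: (Cn_on_scale openT); [exact: Cn_on_cst | exact: ps].
by apply: (Cn_on_scale openT); [exact: Cn_on_cst | exact: qs].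
Qed.

End Poincare.

(** * Global inversion of plane maps with uniformly controlled differential *)

Section GlobalInverse.
Context {R : realType}.
Local Notation E := (R * R)%type.

Lemma plane_eq (a b : E) : a.1 = b.1 -> a.2 = b.2 -> a = b.
Proof. by case: a b => [? ?] [? ?] /= -> ->. Qed.

Lemma fstD (a b : E) : (a + b).1 = a.1 + b.1. Proof. by []. Qed.
Lemma sndD (a b : E) : (a + b).2 = a.2 + b.2. Proof. by []. Qed.
Lemma fstN (a : E) : (- a).1 = - a.1. Proof. by []. Qed.
Lemma sndN (a : E) : (- a).2 = - a.2. Proof. by []. Qed.
Lemma fstZ k (a : E) : (k *: a).1 = k * a.1. Proof. by []. Qed.
Lemma sndZ k (a : E) : (k *: a).2 = k * a.2. Proof. by []. Qed.
Definition planeE := (fstD, sndD, fstN, sndN, fstZ, sndZ).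

Lemma norm_fst (z : E) : `|z.1| <= `|z|.
Proof. by rewrite prod_normE le_max lexx. Qed.

Lemma norm_snd (z : E) : `|z.2| <= `|z|.
Proof. by rewrite prod_normE le_max lexx orbT. Qed.

Lemma norm_pair_le (z : E) (c : R) : `|z.1| <= c -> `|z.2| <= c -> `|z| <= c.
Proof. by move=> z1 z2; rewrite prod_normE ge_max z1. Qed.

(** The norm of the plane is the maximum of the coordinates, so real mean values taken separately on
    each coordinate lose no constant; convexity of the ball keeps the intermediate points in it. *)
Lemma mean_value_ineq (G : E -> E) (x y z : E) (r c : R) :
  (forall u, differentiable G u) ->
  (forall u v, `|u - x| <= r -> `|'D_v G u| <= c * `|v|) ->
  `|y - x| <= r -> `|z - x| <= r -> `|G y - G z| <= c * `|y - z|.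
Proof.
move=> Gd Gc yr zr.
have seg (t : R) : 0 <= t <= 1 -> `|z + t *: (y - z) - x| <= r.
  move=> /andP[t0 t1].
  have -> : z + t *: (y - z) - x = (1 - t) *: (z - x) + t *: (y - x).
    by apply: plane_eq; rewrite !planeE; ring.
  apply: (le_trans (ler_normD _ _)); rewrite !normrZ.
  rewrite (ger0_norm t0) ger0_norm ?subr_ge0//.
  have h1 : (1 - t) * `|z - x| <= (1 - t) * r by rewrite ler_wpM2l// subr_ge0.
  have h2 : t * `|y - x| <= t * r by rewrite ler_wpM2l.
  by apply: (le_trans (lerD h1 h2)); rewrite -mulrDl subrK mul1r.
apply: norm_pair_le.
- have d1 u : derivable (fun u => (G u).1) u (y - z).
    by apply/diff_derivable/(differentiable_comp (Gd u)); exact: differentiable_fst.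
  have [t t01] := mean_value_line z d1.
  rewrite (subrKC z y) derive_fst// => e.
  have -> : (G y - G z).1 = (G y).1 - (G z).1 by [].
  by rewrite e; apply: (le_trans (norm_fst _)); apply: Gc; exact: seg.
- have d2 u : derivable (fun u => (G u).2) u (y - z).
    by apply/diff_derivable/(differentiable_comp (Gd u)); exact: differentiable_snd.
  have [t t01] := mean_value_line z d2.
  rewrite (subrKC z y) derive_snd// => e.
  have -> : (G y - G z).2 = (G y).2 - (G z).2 by [].
  by rewrite e; apply: (le_trans (norm_snd _)); apply: Gc; exact: seg.
Qed.

Variables (F : E -> E) (J : E -> E -> E) (K delta : R).
Hypothesis K0 : 0 < K.
Hypothesis delta0 : 0 < delta.
Hypothesis Fd : forall x, differentiable F x.
Hypothesis Jlin : forall x, linear (J x).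
Hypothesis JF : forall x v, J x ('D_v F x) = v.
Hypothesis FJ : forall x w, 'D_(J x w) F x = w.
Hypothesis JK : forall x w, `|J x w| <= K * `|w|.
Hypothesis Fdelta : forall x y v, `|y - x| <= delta ->
  `|J x ('D_v F x - 'D_v F y)| <= 2^-1 * `|v|.

Definition linear_of_fun (f : E -> E) (fl : linear f) : {linear E -> E} :=
  let m := GRing.isLinear.Build _ _ _ _ _ fl in HB.pack f m.

Let Jl x : {linear E -> E} := linear_of_fun (Jlin x).

Let JB x a b : J x (a - b) = J x a - J x b.
Proof. exact: (linearB (Jl x)). Qed.

Let Jc x : continuous (Jl x).
Proof.
move=> w; apply/cvgrPdist_lt => e e0.
near=> w'; have -> : Jl x w - Jl x w' = J x (w - w') by rewrite JB.
apply: (le_lt_trans (JK _ _)); rewrite -ltr_pdivlMl//.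
near: w'; apply: cvgr_dist_lt; last by apply: mulr_gt0; rewrite ?invr_gt0.
exact: cvg_id.
Unshelve. all: by end_near. Qed.

Let newton x (u : E) : E := u - J x (F u).

(** With the inverse differential frozen at [x], the differential of [newton x] at [u] is [J x]
    applied to the difference of the differentials of [F] at [x] and [u]: by [Fdelta] it has norm at
    most 1/2 on the ball of radius [delta]. *)
Let newton_lip x y z r : r <= delta -> `|y - x| <= r -> `|z - x| <= r ->
  `|(y - z) - J x (F y - F z)| <= 2^-1 * `|y - z|.
Proof.
move=> rd yx zx.
have -> : (y - z) - J x (F y - F z) = newton x y - newton x z.
  by rewrite /newton JB; apply: plane_eq; rewrite !planeE; ring.
have Jd u : differentiable (J x) u.
  exact: (@linear_differentiable _ _ _ (Jl x) u (@Jc x)).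
have dJ u : 'd (J x) u = J x :> (E -> E).
  exact: (@diff_lin _ _ _ (Jl x) u (@Jc x)).
have JFd u : differentiable (J x \o F) u.
  apply: differentiable_comp; first exact: Fd.
  exact: Jd.
have dJF u v : 'D_v (J x \o F) u = J x ('D_v F u).
  by rewrite derive_comp// (deriveE _ (Jd _)) dJ.
apply: (@mean_value_ineq _ x _ _ delta).
- by move=> u; apply: differentiableB; [exact: ex_diff | exact: JFd].
- move=> u v ux; have -> : 'D_v (newton x) u = J x ('D_v F x - 'D_v F u).
    have d := is_deriveB (is_derive_id u v) (derivableP (diff_derivable (v := v) (JFd u))).
    apply: (etrans (@derive_val _ _ _ _ _ _ _ d)).
    apply: (etrans (congr1 (fun z => v - z) (dJF u v))).
    apply: esym; apply: (etrans (JB x _ _)).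
    exact: (congr1 (fun y => y - J x ('D_v F u)) (JF x v)).
  exact: Fdelta.
- exact: le_trans rd.
- exact: le_trans rd.
Qed.

(** [y - z] equals [J z (F y - F z)] up to half of its own norm; absorbing that half on the left
    gives the factor 2. *)
Lemma expand_local y z : `|y - z| <= delta -> `|y - z| <= 2 * K * `|F y - F z|.
Proof.
move=> yz.
have z0 : `|z - z| <= delta by rewrite subrr normr0 ltW.
have h := newton_lip (lexx delta) yz z0.
have h1 := JK z (F y - F z).
have h2 : `|y - z| <= `|J z (F y - F z)| + `|(y - z) - J z (F y - F z)|.
  by rewrite -{1}(subrKC (J z (F y - F z)) (y - z)); exact: ler_normD.
lra.
Qed.

(** A solution is a fixed point of the Newton map [T], which preserves the ball of radius [r]: one
    half of the radius is used by the contraction, the other by [J x w]. The ball of the maximum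
    norm is a product of two segments, hence compact, and the fixed point is found by minimization
    instead of iteration. *)
Lemma local_surj x w r : 0 <= r -> r <= delta -> K * `|w| <= r / 2 ->
  exists y, `|y - x| <= r /\ F y = F x + w.
Proof.
move=> r0 rd wr.
pose B := [set y : E | `|y - x| <= r].
pose T (y : E) := y - J x (F y - F x - w).
have TB y : B y -> B (T y).
  move=> By; rewrite /B /= /T.
  have -> : y - J x (F y - F x - w) - x = ((y - x) - J x (F y - F x)) + J x w.
    by rewrite JB; apply: plane_eq; rewrite !planeE; ring.
  apply: (le_trans (ler_normD _ _)).
  have xx : `|x - x| <= r by rewrite subrr normr0.
  have h := newton_lip rd By xx.
  have h1 := JK x w; move: By; rewrite /B /=; lra.
have Tc : {within B, continuous (fun y => `|y - T y|)}.
  apply: continuous_subspaceT => y.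
  apply: (@continuous_comp _ _ _ (fun y : E => y - T y : E) (@Num.norm R E));
    last exact: norm_continuous.
  apply: cvgB; first exact: cvg_id.
  apply: cvgB; first exact: cvg_id.
  apply: (@continuous_comp _ _ _ (fun y : E => F y - F x - w) (J x)); last exact: (@Jc x).
  apply: cvgB; last exact: cvg_cst.
  by apply: cvgB; [apply: differentiable_continuous; exact: Fd | exact: cvg_cst].
have BE : B = `[x.1 - r, x.1 + r]%classic `*` `[x.2 - r, x.2 + r]%classic.
  apply/seteqP; split=> y; rewrite /B /= !in_itv/=.
    move=> yr; rewrite -!ler_distl.
    by split; [exact: (le_trans (norm_fst (y - x))) | exact: (le_trans (norm_snd (y - x)))].
  by rewrite -!ler_distl => -[y1 y2]; exact: norm_pair_le.
have Bc : compact B by rewrite BE; apply: compact_setX; exact: segment_compact.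
have Bx : B !=set0 by exists x; rewrite /B /= subrr normr0.
have [y /set_mem By ymin] := compact_EVT_min Bx Bc Tc.
exists y; split; first exact: By.
(* T being a contraction, a minimizer of the displacement is a fixed point. *)
have yE : y = T y.
  have TTE : T y - T (T y) = (y - T y) - J x (F y - F (T y)).
    by rewrite {1 2}/T !JB; apply: plane_eq; rewrite !planeE; ring.
  have h1 := newton_lip rd By (TB _ By).
  have /= h2 := ymin (T y) (mem_set (TB _ By)).
  apply/eqP; rewrite -subr_eq0 -normr_le0.
  by move: h2; rewrite TTE; lra.
have Jw0 : J x (F y - F x - w) = 0.
  by have /esym := congr1 (fun z => y - z) yE; rewrite /T /= subKr subrr.
have := FJ x (F y - F x - w); rewrite Jw0 derive0 => /esym/eqP.
by rewrite subr_eq0 => /eqP <-; rewrite addrC subrK.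
Qed.

(** The segment from [F 0] to [w] is cut into [n] steps short enough for [local_surj] with radius
    [delta]. Since [K] and [delta] do not depend on the point, [n] can be fixed in advance. *)
Lemma surjective_map w : exists y, F y = w.
Proof.
pose w0 := w - F 0.
pose n := (Num.truncn (2 * K * `|w0| / delta)).+1.
have n0 : (0 : R) < n%:R by rewrite ltr0n.
have wn : K * `|n%:R^-1 *: w0| <= delta / 2.
  rewrite normrZ gtr0_norm ?invr_gt0// mulrCA ler_pdivrMl//.
  have : 2 * K * `|w0| / delta < n%:R by exact: truncnS_gt.
  rewrite ltr_pdivrMr//; lra.
have step (k : nat) : exists y, F y = F 0 + k%:R *: (n%:R^-1 *: w0).
  elim: k => [|k [y yE]]; first by exists 0; rewrite scale0r addr0.
  have [z [_ zE]] := local_surj y (ltW delta0) (lexx _) wn.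
  by exists z; rewrite zE yE -addrA -natr1 scalerDl scale1r.
have [y yE] := step n.
by exists y; rewrite yE scalerA divff ?gt_eqF// scale1r /w0 subrKC.
Qed.

(* Path lifting: the image by F of the segment from x0 to y0 is a loop at F x0.
   Its homothetic images with center F x0 and ratio k / n are lifted step by
   step in k, each lift being x0 at both ends; the n-th one must follow the
   segment. *)
Lemma injective_map x0 y0 : F x0 = F y0 -> x0 = y0.
Proof.
move=> Fxy.
have Fc : continuous F by move=> x; exact: differentiable_continuous.
(* Clamping time to the unit interval makes every path below continuous on the whole line. *)
pose cl : R -> R := cst 0 \max (id \min cst 1).
have clc : continuous cl.
  move=> t; apply: continuous_max; first exact: cvg_cst.
  by apply: continuous_min; [exact: cvg_id | exact: cvg_cst].
have cl01 t : 0 <= cl t <= 1.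
  by rewrite /cl /= le_max lexx ge_max ler01 ge_min lexx orbT.
have clE t : 0 <= t <= 1 -> cl t = t.
  by move=> /andP[t0 t1]; rewrite /cl /= min_l// max_r.
pose c (t : R) := x0 + cl t *: (y0 - x0).
have cc : continuous c.
  move=> t; apply: cvgD; first exact: cvg_cst.
  by apply: cvgZ; [exact: clc | exact: cvg_cst].
pose w (t : R) := F (c t) - F x0.
have wc : continuous w.
  move=> t; apply: cvgB; last exact: cvg_cst.
  by apply: (@continuous_comp _ _ _ c F); [exact: cc | exact: Fc].
have [M wM] : exists M : R, forall t, `|w t| <= M.
  have I0 : `[(0 : R), 1]%classic !=set0 by exists 0; rewrite /= in_itv/= lexx ler01.
  have nc : {within `[(0 : R), 1], continuous (fun t => `|w t|)}.
    apply: continuous_subspaceT => t.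
    apply: (@continuous_comp _ _ _ w (@Num.norm R E));
    last exact: norm_continuous.
    exact: wc.
  have [t _ Ht] := compact_EVT_max I0 (@segment_compact _ 0 1) nc.
  exists `|w t| => t'.
  have -> : w t' = w (cl t') by rewrite /w /c [cl (cl t')]clE.
  by apply: Ht; rewrite inE /= in_itv/=.
(* The factor 8 makes each step satisfy the hypothesis of [local_surj] with radius [delta / 4]. *)
pose n := (Num.truncn (8 * K * M / delta)).+1.
have n0 : (0 : R) < n%:R by rewrite ltr0n.
have wn t : K * `|n%:R^-1 *: w t| <= delta / 4 / 2.
  rewrite normrZ gtr0_norm ?invr_gt0// mulrCA ler_pdivrMl//.
  have : 8 * K * M / delta < n%:R by exact: truncnS_gt.
  have : K * `|w t| <= K * M by rewrite ler_pM2l.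
  rewrite ltr_pdivrMr//; lra.
have d40 : 0 <= delta / 4 by rewrite divr_ge0// ltW.
have d4 : delta / 4 <= delta by rewrite ler_pdivrMr// ler_peMr ?ltW// ltr1n.
pose T (x z : E) := xget x [set y | `|y - x| <= delta / 4 /\ F y = F x + z].
have Tspec x z : K * `|z| <= delta / 4 / 2 ->
    `|T x z - x| <= delta / 4 /\ F (T x z) = F x + z.
  move=> Kz; have := @xgetPex _ x [set y | `|y - x| <= delta / 4 /\ F y = F x + z].
  by apply; exact: local_surj.
pose s := fix s (k : nat) (t : R) : E :=
  if k is k'.+1 then T (s k' t) (n%:R^-1 *: w t) else x0.
have sF k t : F (s k t) = F x0 + k%:R *: (n%:R^-1 *: w t).
  elim: k => [|k IHk] /=; first by rewrite scale0r addr0.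
  have [_ ->] := Tspec (s k t) _ (wn t).
  by rewrite IHk -addrA -natr1 scalerDl scale1r.
have s_end k t : w t = 0 -> s k t = x0.
  move=> wt; elim: k => //= k ->.
  have [Td TF] := Tspec x0 _ (wn t).
  apply/eqP; rewrite -subr_eq0 -normr_le0.
  apply: (le_trans (expand_local (le_trans Td d4))).
  by rewrite TF wt scaler0 addr0 subrr normr0 mulr0.
have sc k : continuous (s k).
  elim: k => [t|k IHk t]; first exact: cvg_cst.
  have Fsc : continuous (fun t => F (s k.+1 t)).
    have -> : (fun t => F (s k.+1 t)) =
        (fun t => F x0 + k.+1%:R *: (n%:R^-1 *: w t)) by apply/funext => ?; rewrite sF.
    move=> t'; apply: cvgD; first exact: cvg_cst.
    by apply: cvgZ; [exact: cvg_cst | apply: cvgZ; [exact: cvg_cst | exact: wc]].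
  apply/cvgrPdist_lt => e e0; near=> t'.
  have [T1 _] := Tspec (s k t) _ (wn t).
  have [T2 _] := Tspec (s k t') _ (wn t').
  have n1 : `|s k t - s k t'| < delta / 4.
    by near: t'; apply: cvgr_dist_lt; [exact: IHk | rewrite divr_gt0].
  have n2 : `|F (s k.+1 t) - F (s k.+1 t')| < e / (2 * K).
    by near: t'; apply: cvgr_dist_lt; [exact: Fsc | rewrite divr_gt0// mulr_gt0].
  (* Three displacements of at most [delta / 4] each: the new lifts are close enough for
     [expand_local], which converts continuity of their images into their own continuity. *)
  have n3 : `|s k.+1 t - s k.+1 t'| <= delta.
    have -> : s k.+1 t - s k.+1 t' = (s k.+1 t - s k t) + (s k t - s k t')
        - (s k.+1 t' - s k t') by apply: plane_eq; rewrite !planeE; ring.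
    apply: (le_trans (ler_normB _ _)).
    have := ler_normD (s k.+1 t - s k t) (s k t - s k t').
    move: T1 T2 n1; rewrite -/(s k.+1 t) -/(s k.+1 t'); lra.
  apply: (le_lt_trans (expand_local n3)).
  by rewrite -ltr_pdivlMl ?mulr_gt0// mulrC.
(* The lift and the segment have the same image, so [expand_local] makes [g] vanish wherever it is
   at most [delta]. Being continuous and null at 0, [g] cannot take the value [delta / 2], hence
   cannot exceed [delta] at 1. *)
pose g (t : R) := `|s n t - c t|.
have gc : continuous g.
  move=> t; apply: (@continuous_comp _ _ _ (fun t => s n t - c t) (@Num.norm R E)).
    by apply: cvgB; [exact: sc | exact: cc].
  exact: norm_continuous.
have Fsn t : F (s n t) = F (c t).
  by rewrite sF scalerA divff ?gt_eqF// scale1r /w subrKC.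
have g_small t : g t <= delta -> g t = 0.
  move=> gt; apply/eqP; rewrite /g normr_eq0 -normr_le0.
  by apply: (le_trans (expand_local gt)); rewrite Fsn subrr normr0 mulr0.
have c0 : c 0 = x0 by rewrite /c clE ?lexx ?ler01// scale0r addr0.
have c1 : c 1 = y0 by rewrite /c clE ?lexx ?ler01// scale1r subrKC.
have w0 : w 0 = 0 by rewrite /w c0 subrr.
have w1 : w 1 = 0 by rewrite /w c1 Fxy subrr.
have g0 : g 0 = 0 by rewrite /g s_end// c0 subrr normr0.
have g1 : g 1 = `|x0 - y0| by rewrite /g s_end// c1.
have [g1d|g1d] := leP (g 1) delta.
  by move/eqP: (g_small _ g1d); rewrite g1 normr_eq0 subr_eq0 => /eqP.
have d20 : 0 < delta / 2 by rewrite divr_gt0.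
have d2 : delta / 2 < delta by rewrite ltr_pdivrMr// ltr_pMr// ltr1n.
have [|t _ gt] := @IVT _ g 0 1 (delta / 2) ler01 (continuous_subspaceT gc).
  by rewrite g0 ge_min le_max (ltW d20) (ltW (lt_trans d2 g1d)) orbT.
have := g_small t; rewrite gt (ltW d2) => /(_ isT) d2E.
by rewrite d2E ltxx in d20.
Unshelve. all: by end_near. Qed.

(** A solution near [Psi w] given by [local_surj] is the value of [Psi] by injectivity, so
    [expand_local] bounds the increments of [Psi] by [2 * K] times those of the argument. This
    yields the differential, and smoothness follows by bootstrap: the derivative of [Psi] along [v]
    is a smooth function composed with [Psi] itself. *)
Lemma global_inverse : (forall v, smooth_plane (fun x => J x v)) ->
  exists Psi : E -> E, [/\ cancel F Psi, cancel Psi F, smooth_plane Psi &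
    forall w v, 'D_v Psi w = J (Psi w) v].
Proof.
move=> Js.
have [Psi PsiK] := choice surjective_map.
have FK : cancel F Psi by move=> x; apply: injective_map; rewrite PsiK.
have Psi_lip (w : E) : \forall h \near (0 : E), `|Psi (w + h) - Psi w| <= 2 * K * `|h|.
  near=> h.
  have hs : K * `|h| <= delta / 2.
    rewrite -ler_pdivlMl// ltW//; near: h; apply: (@nbhs0_lt R E).
    by rewrite mulr_gt0 ?invr_gt0// divr_gt0.
  have [y [yd yE]] := local_surj (Psi w) (ltW delta0) (lexx _) hs.
  have -> : Psi (w + h) = y by rewrite -[in LHS](PsiK w) -yE FK.
  by have := expand_local yd; rewrite yE PsiK addrAC subrr add0r.
have Psid (w : E) : differentiable Psi w /\ 'd Psi w = Jl (Psi w) :> (E -> E).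
  apply: differentiable_approx; first exact: Jc.
  move=> e e0.
  (* One factor [K] comes from applying [J], the factor [2 * K] from the Lipschitz bound on
     [Psi]. *)
  pose e' := e / (K * (2 * K)).
  have e'0 : 0 < e' by rewrite divr_gt0// !mulr_gt0.
  have /diff_locallyP[_ /eqaddoP/(_ _ e'0) Fo] := Fd (Psi w).
  have /nbhs_normP[r /= r0 hr] := Fo.
  near=> h.
  have hlip : `|Psi (w + h) - Psi w| <= 2 * K * `|h| by near: h; exact: Psi_lip.
  set k := Psi (w + h) - Psi w in hlip *.
  have kr : ball_ Num.norm 0 r k.
    rewrite /ball_ /= sub0r normrN; apply: (le_lt_trans hlip).
    rewrite -ltr_pdivlMl ?mulr_gt0//; near: h; apply: (@nbhs0_lt R E).
    by rewrite !mulr_gt0 ?invr_gt0 ?mulr_gt0.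
  have {}hr := hr _ kr.
  have kE : k - Jl (Psi w) h = J (Psi w) ('D_k F (Psi w) - h).
    by rewrite JB JF.
  rewrite kE; apply: (le_trans (JK _ _)).
  have : `|'D_k F (Psi w) - h| <= e' * `|k|.
    have {}hr : `|F (k + Psi w) - (F (Psi w) + 'd F (Psi w) k)| <= e' * `|k| := hr.
    rewrite (deriveE _ (Fd _)) distrC; move: hr; rewrite /k subrK !PsiK.
    by rewrite opprD addrA [w + h]addrC addrK.
  rewrite -(ler_pM2l K0) => hk; apply: (le_trans hk).
  have : K * (e' * `|k|) <= K * (e' * (2 * K * `|h|)) by rewrite !ler_pM2l.
  move=> hk2; apply: (le_trans hk2); rewrite /e' le_eqVlt; apply/orP; left.
  by apply/eqP; field; rewrite gt_eqF.
have PsiD w v : 'D_v Psi w = J (Psi w) v.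
  by have [d dE] := Psid w; rewrite (deriveE _ d) dE.
exists Psi; split=> //.
elim=> [x _|n IHn]; first by apply: differentiable_continuous; exact: (Psid x).1.
split=> [w _|v]; first exact: (Psid w).1.
have -> : 'D_v Psi = (fun x => J x v) \o Psi by apply/funext => w; rewrite PsiD.
by apply: (@Cn_on_comp _ _ _ _ setT) => //; [exact: openT | exact: Js].
Unshelve. all: by end_near. Qed.

End GlobalInverse.

(** * Periodic functions and forms *)

Section Periodic.
Context {R : realType}.
Local Notation E := (R * R)%type.

Definition Z2_periodic (T : Type) (g : E -> T) : Prop :=
  (forall x, g (x + (1, 0)) = g x) /\ (forall x, g (x + (0, 1)) = g x).

Lemma periodic_int (T : Type) (g : E -> T) (e : E) :
  (forall x, g (x + e) = g x) -> forall x (n : int), g (x + n%:~R *: e) = g x.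
Proof.
move=> ge.
have gn (k : nat) x : g (x + k%:R *: e) = g x.
  elim: k => [|k IHk]; first by rewrite scale0r addr0.
  by rewrite -natr1 scalerDl scale1r addrA ge.
move=> x [k|k]; first exact: gn.
by rewrite NegzE rmorphN /= scaleNr -(gn k.+1 (x - _)) subrK.
Qed.

Lemma periodic_bounded (g : E -> R) : continuous g -> Z2_periodic g ->
  exists C, 0 <= C /\ forall x, `|g x| <= C.
Proof.
move=> gc [g1 g2].
pose A := `[(0 : R), 1]%classic `*` `[(0 : R), 1]%classic.
have A0 : A !=set0 by exists (0, 0); split; rewrite /= in_itv/= ?lexx ?ler01.
have cA : compact A by apply: compact_setX; exact: segment_compact.
have nc : {within A, continuous (fun x => `|g x|)}.
  apply: continuous_subspaceT => x.
  apply: (@continuous_comp _ _ _ g Num.norm); first exact: gc.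
  exact: norm_continuous.
have [c _ Hc] := compact_EVT_max A0 cA nc.
exists `|g c|; split=> // x.
pose n1 := - Num.floor x.1; pose n2 := - Num.floor x.2.
rewrite -(periodic_int g1 x n1) -(periodic_int g2 _ n2).
apply: Hc; rewrite inE; split; rewrite /= in_itv/= /GRing.scale/= ?mulr1 ?mulr0 ?addr0 ?add0r;
  rewrite rmorphN /= subr_ge0 lerBlDl.
  by have := floor_itv x.1; rewrite intrD => /andP[-> /ltW].
by have := floor_itv x.2; rewrite intrD => /andP[-> /ltW].
Qed.

Lemma periodic_derive (g : E -> R) v : (forall x, differentiable g x) ->
  Z2_periodic g -> Z2_periodic ('D_v g).
Proof.
move=> gd [g1 g2].
have step (e : E) : (forall x, g (x + e) = g x) -> forall x, 'D_v g (x + e) = 'D_v g x.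
  move=> ge x; have d : derivable g (x + e) v by exact: diff_derivable.
  have dt := is_derive_translate d.
  rewrite -(@derive_val _ _ _ _ _ _ _ dt); congr ('D_v _ x).
  by apply/funext => y; rewrite ge.
by split; apply: step.
Qed.

Lemma periodic_lipschitz (g : E -> R) : smooth_plane g -> Z2_periodic g ->
  exists L, 0 <= L /\ forall x y, `|g x - g y| <= L * `|x - y|.
Proof.
move=> gs gp.
have gd x : differentiable g x by exact: (smooth_on_differentiable gs).
have dbounded v : exists C, 0 <= C /\ forall x, `|'D_v g x| <= C.
  apply: periodic_bounded; last exact: periodic_derive.
  by move=> x; exact: (smooth_on_continuous (smooth_on_derive v gs)).
have [C1 [C10 H1]] := dbounded (1, 0).
have [C2 [C20 H2]] := dbounded (0, 1).
exists (C1 + C2); split=> [|x y]; first exact: addr_ge0.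
have dxy z : derivable g z (x - y) by exact: diff_derivable.
have [t _ e] := mean_value_line y dxy.
rewrite subrKC in e; rewrite e derive_plane//.
apply: (le_trans (ler_normD _ _)); rewrite !normrZ mulrDl.
apply: lerD; rewrite [leRHS]mulrC.
  by rewrite ler_pM// ?H1// (norm_fst (x - y)).
by rewrite ler_pM// ?H2// (norm_snd (x - y)).
Qed.

Lemma derive0_const (g : E -> R) : (forall x v, is_derive x v g 0) ->
  forall x y, g x = g y.
Proof.
move=> gd x y.
have [t _] := mean_value_line y (fun z => @ex_derive _ _ _ _ _ _ _ (gd z (x - y))).
by rewrite derive_val subrKC => /eqP; rewrite subr_eq0 => /eqP.
Qed.

Variables (p1 q1 p2 q2 U1 U2 : E -> R).
Hypotheses (p1s : smooth_plane p1) (q1s : smooth_plane q1).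
Hypotheses (p2s : smooth_plane p2) (q2s : smooth_plane q2).
Hypotheses (p1p : Z2_periodic p1) (q1p : Z2_periodic q1).
Hypotheses (p2p : Z2_periodic p2) (q2p : Z2_periodic q2).
Hypotheses (U1s : smooth_plane U1) (U2s : smooth_plane U2).
Hypothesis U1d : forall x v, 'D_v U1 x = v.1 * p1 x + v.2 * q1 x.
Hypothesis U2d : forall x v, 'D_v U2 x = v.1 * p2 x + v.2 * q2 x.
Let det x := p1 x * q2 x - q1 x * p2 x.
Hypothesis det0 : forall x, p1 x * q2 x - q1 x * p2 x != 0.
Let Phi x : E := (U1 x, U2 x).
(** Cramer's formula for the inverse of the differential of [Phi], whose matrix has rows [(p1, q1)]
    and [(p2, q2)]. *)
Let J x (w : E) : E := ((w.1 * q2 x - w.2 * q1 x) / det x,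
                        (w.2 * p1 x - w.1 * p2 x) / det x).

Let smooth_det : smooth_plane det.
Proof.
move=> n; have -> : det = (fun x => p1 x *: q2 x + ((-1) *: q1 x) *: p2 x).
  by apply/funext => x; rewrite /det /GRing.scale /=; ring.
apply: (Cn_onD openT); first by apply: (Cn_on_scale openT).
apply: (Cn_on_scale openT) => //; apply: (Cn_on_scale openT) => //; exact: Cn_on_cst.
Qed.

Let smooth_div (f : E -> R) : smooth_plane f -> smooth_plane (fun x => f x / det x).
Proof.
move=> fs n; apply: (@Cn_on_scale _ R _ _ f (fun x => (det x)^-1)) => //.
  exact: openT.
by apply: Cn_on_inv; [exact: openT | move=> x _; exact: det0 | exact: smooth_det].
Qed.

Let periodic_div (f : E -> R) : Z2_periodic f -> Z2_periodic (fun x => f x / det x).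
Proof.
move: p1p q1p p2p q2p => [a1 a2] [b1 b2] [c1 c2] [d1 d2] [f1 f2].
split=> x; rewrite /det; first by rewrite f1 a1 b1 c1 d1.
by rewrite f2 a2 b2 c2 d2.
Qed.

Let div_bounded (f : E -> R) : smooth_plane f -> Z2_periodic f ->
  exists C, 0 <= C /\ forall x, `|f x / det x| <= C.
Proof.
move=> fs fp; apply: periodic_bounded; last exact: periodic_div.
by move=> x; exact: (smooth_on_continuous (smooth_div fs)).
Qed.

Let Phid x : differentiable Phi x.
Proof.
by apply: differentiable_pair; [exact: (smooth_on_differentiable U1s)
  | exact: (smooth_on_differentiable U2s)].
Qed.

Let PhiD x v : 'D_v Phi x = (v.1 * p1 x + v.2 * q1 x, v.1 * p2 x + v.2 * q2 x).
Proof.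
rewrite [LHS]surjective_pairing -derive_fst// -derive_snd//.
by congr pair; [exact: U1d | exact: U2d].
Qed.

(** Periodicity provides the uniform constants of the global inversion: [K] bounds the inverse
    differential through the entries of its matrix, and [L] is a Lipschitz constant of the
    differential. *)
Lemma periodic_inverse : exists Psi : E -> E,
  [/\ forall x, Psi (U1 x, U2 x) = x, forall w, (U1 (Psi w), U2 (Psi w)) = w,
      smooth_plane Psi &
      forall w v, 'D_v Psi w =
        ((v.1 * q2 (Psi w) - v.2 * q1 (Psi w)) / det (Psi w),
         (v.2 * p1 (Psi w) - v.1 * p2 (Psi w)) / det (Psi w))].
Proof.
have [A1 [A10 HA1]] := div_bounded p1s p1p.
have [B1 [B10 HB1]] := div_bounded q1s q1p.
have [A2 [A20 HA2]] := div_bounded p2s p2p.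
have [B2 [B20 HB2]] := div_bounded q2s q2p.
have [a1 [a10 Ha1]] := periodic_lipschitz p1s p1p.
have [b1 [b10 Hb1]] := periodic_lipschitz q1s q1p.
have [a2 [a20 Ha2]] := periodic_lipschitz p2s p2p.
have [b2 [b20 Hb2]] := periodic_lipschitz q2s q2p.
pose K := A1 + B1 + A2 + B2 + 1.
pose L := a1 + b1 + a2 + b2.
have K0 : 0 < K by rewrite ltr_wpDl// !addr_ge0.
have L0 : 0 <= L by rewrite !addr_ge0.
(* Chosen so that [K * (L + 1) * delta = 1/2]; [L + 1] replaces [L], which may vanish. *)
pose delta := (2 * K * (L + 1))^-1.
have delta0 : 0 < delta by rewrite invr_gt0 !mulr_gt0// ltr_wpDl.
have two (a b : R) (s t c : R) : `|a| <= c -> `|b| <= c -> 0 <= s -> 0 <= t ->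
    `|a| * s + `|b| * t <= (s + t) * c.
  move=> ac bc s0 t0; rewrite mulrDl ![_ * c]mulrC; apply: lerD; exact: ler_wpM2r.
have JK x w : `|J x w| <= K * `|w|.
  have w1 := norm_fst w; have w2 := norm_snd w.
  apply: norm_pair_le => /=.
  - have -> : (w.1 * q2 x - w.2 * q1 x) / det x =
      w.1 * (q2 x / det x) - w.2 * (q1 x / det x) by field; exact: det0.
    apply: (le_trans (ler_normB _ _)); rewrite !normrM.
    have h1 := ler_pM (normr_ge0 _) (normr_ge0 _) w1 (HB2 x).
    have h2 := ler_pM (normr_ge0 _) (normr_ge0 _) w2 (HB1 x).
    rewrite !normrM in h1 h2; apply: (le_trans (lerD h1 h2)).
    rewrite -mulrDr mulrC ler_wpM2r// /K; lra.
  - have -> : (w.2 * p1 x - w.1 * p2 x) / det x =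
      w.2 * (p1 x / det x) - w.1 * (p2 x / det x) by field; exact: det0.
    apply: (le_trans (ler_normB _ _)); rewrite !normrM.
    have h1 := ler_pM (normr_ge0 _) (normr_ge0 _) w2 (HA1 x).
    have h2 := ler_pM (normr_ge0 _) (normr_ge0 _) w1 (HA2 x).
    rewrite !normrM in h1 h2; apply: (le_trans (lerD h1 h2)).
    rewrite -mulrDr mulrC ler_wpM2r// /K; lra.
have DL x y v : `|'D_v Phi x - 'D_v Phi y| <= L * `|x - y| * `|v|.
  have v1 := norm_fst v; have v2 := norm_snd v.
  rewrite !PhiD; apply: norm_pair_le; rewrite planeE /=.
  - have -> : v.1 * p1 x + v.2 * q1 x - (v.1 * p1 y + v.2 * q1 y) =
      v.1 * (p1 x - p1 y) + v.2 * (q1 x - q1 y) by ring.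
    apply: (le_trans (ler_normD _ _)); rewrite !normrM.
    have h1 := ler_pM (normr_ge0 _) (normr_ge0 _) v1 (Ha1 x y).
    have h2 := ler_pM (normr_ge0 _) (normr_ge0 _) v2 (Hb1 x y).
    apply: (le_trans (lerD h1 h2)).
    rewrite -mulrDr mulrC ler_wpM2r// -mulrDl ler_wpM2r// /L; lra.
  - have -> : v.1 * p2 x + v.2 * q2 x - (v.1 * p2 y + v.2 * q2 y) =
      v.1 * (p2 x - p2 y) + v.2 * (q2 x - q2 y) by ring.
    apply: (le_trans (ler_normD _ _)); rewrite !normrM.
    have h1 := ler_pM (normr_ge0 _) (normr_ge0 _) v1 (Ha2 x y).
    have h2 := ler_pM (normr_ge0 _) (normr_ge0 _) v2 (Hb2 x y).
    apply: (le_trans (lerD h1 h2)).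
    rewrite -mulrDr mulrC ler_wpM2r// -mulrDl ler_wpM2r// /L; lra.
have Jlin x : linear (J x).
  move=> k u v; apply: plane_eq.
    change (((k * u.1 + v.1) * q2 x - (k * u.2 + v.2) * q1 x) / det x =
      k * ((u.1 * q2 x - u.2 * q1 x) / det x) + (v.1 * q2 x - v.2 * q1 x) / det x).
    by field; exact: det0.
  change (((k * u.2 + v.2) * p1 x - (k * u.1 + v.1) * p2 x) / det x =
    k * ((u.2 * p1 x - u.1 * p2 x) / det x) + (v.2 * p1 x - v.1 * p2 x) / det x).
  by field; exact: det0.
have JF x v : J x ('D_v Phi x) = v.
  by rewrite PhiD; apply: plane_eq; rewrite /J /det /=; field; exact: det0.
have FJ x w : 'D_(J x w) Phi x = w.
  by rewrite PhiD; apply: plane_eq; rewrite /J /det /=; field; exact: det0.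
have Fdelta x y v : `|y - x| <= delta ->
    `|J x ('D_v Phi x - 'D_v Phi y)| <= 2^-1 * `|v|.
  move=> yx; apply: (le_trans (JK _ _)).
  have h := DL x y v; rewrite -(ler_pM2l K0) in h; apply: (le_trans h).
  rewrite mulrA ler_wpM2r//.
  have h3 : L * `|x - y| <= (L + 1) * delta.
    by rewrite ler_pM// ?lerDl// distrC.
  rewrite -(ler_pM2l K0) in h3; apply: (le_trans h3).
  rewrite le_eqVlt; apply/orP; left; apply/eqP; rewrite /delta.
  have Kn0 : K != 0 by rewrite gt_eqF.
  have Ln0 : L + 1 != 0 by rewrite gt_eqF// ltr_wpDl.
  by clearbody K L; field; rewrite Kn0 Ln0.
have Js v : smooth_plane (fun x => J x v).
  have lin (a b : R) (f g : E -> R) : smooth_plane f -> smooth_plane g ->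
      smooth_plane (fun x => a * f x - b * g x).
    move=> fs gs n; have -> : (fun x => a * f x - b * g x) =
        (fun x => a *: f x + (- b) *: g x).
      by apply/funext => x; rewrite scaleNr.
    by apply: (Cn_onD openT); apply: (Cn_on_scale openT) => //; exact: Cn_on_cst.
  move=> n; apply: (Cn_on_pair openT);
    by apply: smooth_div; apply: lin.
have [Psi [PhiK PsiK Psis PsiD]] :=
  global_inverse K0 delta0 Phid Jlin JF FJ JK Fdelta Js.
by exists Psi; split.
Qed.

(** The difference between the translate of [U] by [e] and [U] has zero differential, so it keeps
    its value at the origin. *)
Let shift_const (U p q : E -> R) (e x : E) : smooth_plane U ->
  (forall x v, 'D_v U x = v.1 * p x + v.2 * q x) ->
  (forall x, p (x + e) = p x) -> (forall x, q (x + e) = q x) ->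
  U (x + e) = U x + (U e - U 0).
Proof.
move=> Us Ud pe qe.
have gd y v : is_derive y v (fun z => U (z + e) - U z) 0.
  have d z : derivable U z v by apply/diff_derivable/(smooth_on_differentiable Us).
  have dt := is_derive_translate (d (y + e)).
  apply: (is_derive_eq (is_deriveB dt (derivableP (d y)))).
  by rewrite !Ud pe qe subrr.
have := derive0_const gd x 0; rewrite add0r => <-.
by rewrite /= subrKC.
Qed.

Lemma periods_independent :
  (forall w : E, exists x, (U1 x, U2 x) = w) ->
  exists c1 c2 : E, [/\ c1.1 * c2.2 - c1.2 * c2.1 != 0,
    forall x, (U1 (x + (1, 0)), U2 (x + (1, 0))) = (U1 x, U2 x) + c1 &
    forall x, (U1 (x + (0, 1)), U2 (x + (0, 1))) = (U1 x, U2 x) + c2].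
Proof.
move=> surj; move: p1p q1p p2p q2p => [a1 a2] [b1 b2] [c1 c2] [d1 d2].
pose k1 : E := (U1 (1, 0) - U1 0, U2 (1, 0) - U2 0).
pose k2 : E := (U1 (0, 1) - U1 0, U2 (0, 1) - U2 0).
have Hk1 x : (U1 (x + (1, 0)), U2 (x + (1, 0))) = (U1 x, U2 x) + k1.
  by rewrite (shift_const _ U1s U1d a1 b1) (shift_const _ U2s U2d c1 d1).
have Hk2 x : (U1 (x + (0, 1)), U2 (x + (0, 1))) = (U1 x, U2 x) + k2.
  by rewrite (shift_const _ U1s U1d a2 b2) (shift_const _ U2s U2d c2 d2).
exists k1, k2; split=> //; clearbody k1 k2; apply/negP => /eqP kdet.
(* Otherwise some nonzero linear form vanishes on both periods; composed with
   the surjection it is periodic, hence bounded. *)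
have [l [l0 [l1 l2]]] : exists l : E, l != 0 /\
    l.1 * k1.1 + l.2 * k1.2 = 0 /\ l.1 * k2.1 + l.2 * k2.2 = 0.
  (* A quarter turn of a nonzero period annihilates that period, and also the other one because the
     determinant vanishes; if both periods are zero, any nonzero form will do. *)
  have [k10|k10] := eqVneq k1 0; last first.
    exists (- k1.2, k1.1); split=> /=; last by split; [ring | rewrite -kdet; ring].
    apply: contra k10 => /eqP[/eqP]; rewrite oppr_eq0 => /eqP e2 e1.
    by apply/eqP/plane_eq.
  have [k20|k20] := eqVneq k2 0; last first.
    exists (- k2.2, k2.1); split=> /=; last by split; [rewrite k10 /=; ring | ring].
    apply: contra k20 => /eqP[/eqP]; rewrite oppr_eq0 => /eqP e2 e1.
    by apply/eqP/plane_eq.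
  exists (1, 0); rewrite k10 k20 /= !mulr0 addr0; split=> //.
  by apply/negP => /eqP[/eqP]; rewrite oner_eq0.
pose g x := l.1 * U1 x + l.2 * U2 x.
have gc : continuous g.
  move=> x; apply: cvgD; apply: cvgM; [exact: cvg_cst |
    exact: (smooth_on_continuous U1s) | exact: cvg_cst |
    exact: (smooth_on_continuous U2s)].
have gp : Z2_periodic g.
  split=> x; rewrite /g.
    have := Hk1 x => -[-> ->]; rewrite -[RHS]addr0 -l1 /=; ring.
  have := Hk2 x => -[-> ->]; rewrite -[RHS]addr0 -l2 /=; ring.
have [C [C0 HC]] := periodic_bounded gc gp.
pose D := l.1 ^+ 2 + l.2 ^+ 2.
have D0 : D != 0.
  apply: contra l0; rewrite paddr_eq0 ?sqr_ge0// !sqrf_eq0 => /andP[/eqP e1 /eqP e2].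
  by apply/eqP/plane_eq.
(* The multiple of [l] on which the linear form takes the value [C + 1], beyond the bound [C]. *)
have [x [e1 e2]] := surj ((C + 1) * l.1 / D, (C + 1) * l.2 / D).
have := HC x; have -> : g x = C + 1.
  by rewrite /g e1 e2 /D; field; rewrite -/D.
by rewrite ger0_norm ?addr_ge0// gerDl ler10.
Qed.

End Periodic.

(** * Moving frames in R^4 *)

Section Dot.
Context {R : realType}.
Implicit Types x y z : 'cV[R]_4.

Lemma dotC x y : dot x y = dot y x.
Proof. by apply: eq_bigr => i _; rewrite mulrC. Qed.

Lemma dotDl x y z : dot (x + y) z = dot x z + dot y z.
Proof. by rewrite -big_split; apply: eq_bigr => i _; rewrite mxE mulrDl. Qed.

Lemma dotZl k x z : dot (k *: x) z = k * dot x z.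
Proof. by rewrite /dot mulr_sumr; apply: eq_bigr => i _; rewrite mxE mulrA. Qed.

Lemma dotNl x z : dot (- x) z = - dot x z.
Proof. by rewrite -scaleN1r dotZl mulN1r. Qed.

Lemma dotDr x y z : dot z (x + y) = dot z x + dot z y.
Proof. by rewrite dotC dotDl ![dot _ z]dotC. Qed.

Lemma dotZr k x z : dot z (k *: x) = k * dot z x.
Proof. by rewrite dotC dotZl dotC. Qed.

Lemma dotNr x z : dot z (- x) = - dot z x.
Proof. by rewrite dotC dotNl dotC. Qed.

Definition dotE := (dotDl, dotDr, dotZl, dotZr, dotNl, dotNr).

Lemma dot0l x : dot 0 x = 0.
Proof. by rewrite -(scale0r x) dotZl mul0r. Qed.

Definition orthonormal_frame (a b c d : 'cV[R]_4) : Prop :=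
  [/\ [/\ dot a a = 1, dot b b = 1, dot c c = 1 & dot d d = 1],
      [/\ dot a b = 0, dot a c = 0 & dot a d = 0],
      dot b c = 0, dot b d = 0 & dot c d = 0].

(** The matrix with the frame as rows is orthogonal, hence invertible, and its product with a vector
    lists the four inner products. *)
Lemma frame_ext (a b c d x y : 'cV[R]_4) : orthonormal_frame a b c d ->
  dot x a = dot y a -> dot x b = dot y b -> dot x c = dot y c ->
  dot x d = dot y d -> x = y.
Proof.
move=> [[aa bb cc dd] [ab ac ad] bc bd cd] xa xb xc xd.
pose e (i : 'I_4) := nth 0 [:: a; b; c; d] i.
pose Q : 'M[R]_4 := \matrix_(i, j) e i j 0.
have QQ : Q *m Q^T = 1%:M.
  apply/matrixP => i j; rewrite !mxE.
  transitivity (dot (e i) (e j)); first by apply: eq_bigr => k _; rewrite !mxE.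
  case: i => [[|[|[|[|//]]]] Hi]; case: j => [[|[|[|[|//]]]] Hj];
    by rewrite /e /= -?(eqP (_ : _ == _)) //= ?aa ?bb ?cc ?dd ?ab ?ac ?ad ?bc ?bd ?cd
      // dotC ?ab ?ac ?ad ?bc ?bd ?cd.
have Qx : Q *m x = Q *m y.
  apply/matrixP => i j; rewrite !mxE (ord1 j).
  transitivity (dot x (e i)).
    by rewrite dotC; apply: eq_bigr => k _; rewrite !mxE.
  transitivity (dot y (e i)); last first.
    by rewrite dotC; apply: eq_bigr => k _; rewrite !mxE.
  by case: i => [[|[|[|[|//]]]] Hi]; rewrite /e.
by rewrite -[x]mul1mx -[y]mul1mx -(mulmx1C QQ) -!mulmxA Qx.
Qed.

End Dot.

(** * Differentiation of inner products and matrix products *)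

Section SmoothDot.
Context {R : realType}.
Local Notation E := (R * R)%type.

Lemma differentiable_entry (W : normedModType R) m n (f : W -> 'M[R]_(m, n)) x i j :
  differentiable f x -> differentiable (fun y => f y i j) x.
Proof.
move=> fd; apply: (@differentiable_comp _ _ _ _ f (fun A => A i j)) => //.
exact: differentiable_coord.
Qed.

Lemma is_derive_dot (W : normedModType R) (f g : W -> 'cV[R]_4) x v :
  differentiable f x -> differentiable g x ->
  is_derive x v (fun y => dot (f y) (g y)) (dot ('D_v f x) (g x) + dot (f x) ('D_v g x)).
Proof.
move=> fd gd.
have de (h : W -> 'cV[R]_4) i : differentiable h x ->
    is_derive x v (fun y => h y i 0) ('D_v h x i 0).
  move=> hd; apply: DeriveDef; first exact/diff_derivable/differentiable_entry.
  by rewrite derive_entry//; exact: diff_derivable.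
have d := is_derive_sum (fun i => is_deriveM (de f i fd) (de g i gd)).
have -> : (fun y => dot (f y) (g y)) =
    \sum_(i < 4) ((fun y => f y i 0) * (fun y => g y i 0)).
  by apply/funext => y; rewrite fct_sumE.
apply: (is_derive_eq d); rewrite /dot -big_split; apply: eq_bigr => i _ /=.
by rewrite addrC; congr (_ + _); exact: mulrC.
Qed.

Lemma derive_dot (W : normedModType R) (f g : W -> 'cV[R]_4) x v :
  differentiable f x -> differentiable g x ->
  'D_v (fun y => dot (f y) (g y)) x = dot ('D_v f x) (g x) + dot (f x) ('D_v g x).
Proof. by move=> fd gd; have := is_derive_dot v fd gd => d; rewrite derive_val. Qed.

Lemma differentiable_dot (W : normedModType R) (f g : W -> 'cV[R]_4) x :
  differentiable f x -> differentiable g x ->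
  differentiable (fun y => dot (f y) (g y)) x.
Proof.
move=> fd gd.
have -> : (fun y => dot (f y) (g y)) =
    \sum_(i < 4) ((fun y => f y i 0) * (fun y => g y i 0)).
  by apply/funext => y; rewrite fct_sumE.
apply: differentiable_sum => i.
by apply: differentiableM; exact: differentiable_entry.
Qed.

Lemma Cn_on_dot (U : set E) n (f g : E -> 'cV[R]_4) : open U ->
  Cn_on n U f -> Cn_on n U g -> Cn_on n U (fun x => dot (f x) (g x)).
Proof.
move=> oU; elim: n f g => [|n IHn] f g.
  move=> fc gc x Ux.
  have entry (h : E -> 'cV[R]_4) i : {for x, continuous h} ->
      {for x, continuous (fun y => h y i 0)}.
    move=> hc; apply: (@continuous_comp _ _ _ h (fun A : 'cV[R]_4 => A i 0)) => //.
    exact: coord_continuous.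
  have -> : (fun y => dot (f y) (g y)) =
      \sum_(i < 4) ((fun y => f y i 0) * (fun y => g y i 0)).
    by apply/funext => y; rewrite fct_sumE.
  elim/big_ind: _ => [|h k hc kc|i _]; first exact: cst_continuous.
    exact: continuousD.
  by apply: continuousM; apply: entry; [exact: fc | exact: gc].
move=> fn gn; have [fd fn'] := fn; have [gd gn'] := gn.
split=> [x Ux | v]; first by apply: differentiable_dot; [exact: fd | exact: gd].
apply: (@Cn_on_eq _ _ _ _ _
  (fun x => dot ('D_v f x) (g x) + dot (f x) ('D_v g x))) => //.
  by move=> x Ux; apply: derive_dot; [exact: fd | exact: gd].
have fn1 := Cn_onS fn; have gn1 := Cn_onS gn.
by apply: Cn_onD => //; apply: IHn => //; [exact: fn' | exact: gn'].
Qed.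

Lemma mulmx_differentiable (W : normedModType R) (B : 'M[R]_4) (f : W -> 'cV[R]_4) x v :
  differentiable f x -> differentiable (fun y => B *m f y) x /\
  'D_v (fun y => B *m f y) x = B *m 'D_v f x.
Proof.
move=> fd.
have Bc : continuous (mulmx B : 'cV[R]_4 -> 'cV[R]_4).
  move=> A; apply: differentiable_continuous.
  have -> : (mulmx B : 'cV[R]_4 -> 'cV[R]_4) =
      \sum_(k < 4) (fun A : 'cV[R]_4 => A k 0 *: col k B).
    apply/funext => C; rewrite fct_sumE; apply/matrixP => i j.
    by rewrite summxE !mxE (ord1 j); apply: eq_bigr => k _; rewrite !mxE mulrC.
  apply: differentiable_sum => k; apply: differentiableZl; exact: differentiable_coord.
have Bd y : differentiable (mulmx B : 'cV[R]_4 -> 'cV[R]_4) y.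
  exact: linear_differentiable.
split; first exact: (differentiable_comp fd (Bd _)).
rewrite (@derive_comp _ _ _ _ (mulmx B) f)// (deriveE _ (Bd _)).
by rewrite (diff_lin _ Bc).
Qed.

Lemma smooth_symmetric_mx (f : E -> 'cV[R]_4) v w : smooth_plane f ->
  'D_w ('D_v f) = 'D_v ('D_w f).
Proof.
move=> fs; apply/funext => x; apply/matrixP => i j.
have entry_smooth (h : E -> 'cV[R]_4) : smooth_plane h -> smooth_plane (fun y => h y i j).
  move=> hs n; elim: n h hs => [h hs y _|n IHn h hs].
    apply: (@continuous_comp _ _ _ h (fun A : 'cV[R]_4 => A i j)); first exact: (hs 0).
    exact: coord_continuous.
  split=> [y _|u].
    by apply: differentiable_entry; exact: (smooth_on_differentiable hs).
  have -> : 'D_u (fun y => h y i j) = (fun y => 'D_u h y i j).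
    apply/funext => y; rewrite derive_entry//.
    by apply: diff_derivable; exact: (smooth_on_differentiable hs).
  by apply: IHn; exact: smooth_on_derive.
have dd (h : E -> 'cV[R]_4) u : smooth_plane h ->
    (fun y => 'D_u h y i j) = 'D_u (fun y => h y i j).
  move=> hs; apply/funext => y; rewrite derive_entry//.
  by apply: diff_derivable; exact: (smooth_on_differentiable hs).
have key u u' : 'D_u ('D_u' f) x i j = 'D_u ('D_u' (fun y => f y i j)) x.
  transitivity ('D_u (fun y => 'D_u' f y i j) x); last by rewrite dd.
  exact: (congr1 (fun h => h x) (dd _ u (smooth_on_derive u' fs))).
apply: (etrans (key _ _)); apply: (etrans _ (esym (key _ _))).
exact: (congr1 (fun h => h x) (smooth_symmetric v w (entry_smooth _ fs))).
Qed.

End SmoothDot.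

(** * Structure equations of the frame, Gauss equation and the system *)

Section FrameEquations.
Context {R : realType}.
Local Notation E := (R * R)%type.
Variables (theta : R) (p nu V1 V2 : E -> 'cV[R]_4) (r : E -> R).
Hypotheses (ps : smooth_plane p) (nus : smooth_plane nu) (rs : smooth_plane r).
Hypotheses (V1s : smooth_plane V1) (V2s : smooth_plane V2).
Hypothesis frame : forall x, orthonormal_frame (p x) (nu x) (V1 x) (V2 x).
Hypothesis p_u : forall x, partial_u p x =
  expR (- r x) *: (cos theta *: V1 x + sin theta *: V2 x).
Hypothesis p_v : forall x, partial_v p x =
  expR (- r x) *: (cos theta *: V2 x - sin theta *: V1 x).
Hypothesis nu_u : forall x, partial_u nu x =
  expR (r x) *: (- cos theta *: V1 x + sin theta *: V2 x).
Hypothesis nu_v : forall x, partial_v nu x =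
  expR (r x) *: (sin theta *: V1 x + cos theta *: V2 x).

(* The derivatives are abstracted by variables, as conversion would otherwise
   unfold them into limits. *)
Variables (X Y Xu Xv Yv Nu Nv : E -> 'cV[R]_4) (ru rv : E -> R).
Hypotheses (XE : X = partial_u p) (YE : Y = partial_v p).
Hypotheses (XuE : Xu = partial_u X) (XvE : Xv = partial_v X) (YvE : Yv = partial_v Y).
Hypotheses (NuE : Nu = partial_u nu) (NvE : Nv = partial_v nu).
Hypotheses (ruE : ru = partial_u r) (rvE : rv = partial_v r).
Let E2 x := expR (- 2 * r x).
Local Notation c := (cos theta).
Local Notation s := (sin theta).

Let smoothT_diff (W : normedModType R) (f : E -> W) x :
  smooth_plane f -> differentiable f x.
Proof. by move=> fs; exact: (smooth_on_differentiable fs). Qed.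

Let Xs : smooth_plane X. Proof. by rewrite XE; exact: smooth_on_derive. Qed.
Let Ys : smooth_plane Y. Proof. by rewrite YE; exact: smooth_on_derive. Qed.

Lemma expR_mulN x : expR (- r x) * expR (r x) = 1.
Proof. by rewrite -expRD addNr expR0. Qed.

Lemma expR_2 x : expR (2 * r x) = expR (r x) * expR (r x).
Proof. by rewrite -expRD; congr expR; ring. Qed.

Lemma expR_N2 x : expR (- 2 * r x) = expR (- r x) * expR (- r x).
Proof. by rewrite -expRD; congr expR; ring. Qed.

Lemma sin2E : s * s = 1 - c * c.
Proof. by rewrite -!expr2; apply/eqP; rewrite eq_sym subr_eq addrC cos2Dsin2. Qed.

Lemma cos_double : cos (2 * theta) = c * c - s * s.
Proof. by rewrite mulr_natl mulr2n cosD. Qed.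

Lemma sin_double : sin (2 * theta) = 2 * (s * c).
Proof. by rewrite mulr_natl mulr2n sinD [c * s]mulrC mulr_natl mulr2n. Qed.

Lemma V1_rotated x : V1 x = expR (r x) *: (c *: X x - s *: Y x).
Proof.
have h := expR_mulN x; rewrite XE YE p_u p_v; apply/matrixP => i j; rewrite !mxE.
ring: h sin2E.
Qed.

Lemma V2_rotated x : V2 x = expR (r x) *: (s *: X x + c *: Y x).
Proof.
have h := expR_mulN x; rewrite XE YE p_u p_v; apply/matrixP => i j; rewrite !mxE.
ring: h sin2E.
Qed.

Let tab x :
  [/\ [/\ dot (X x) (X x) = E2 x, dot (Y x) (Y x) = E2 x & dot (X x) (Y x) = 0],
      dot (X x) (p x) = 0, dot (Y x) (p x) = 0,
      dot (X x) (nu x) = 0 & dot (Y x) (nu x) = 0].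
Proof.
have [[pp nn aa bb] [pn pa pb] na nb ab] := frame x.
have pa' : dot (V1 x) (p x) = 0 by rewrite dotC.
have pb' : dot (V2 x) (p x) = 0 by rewrite dotC.
have na' : dot (V1 x) (nu x) = 0 by rewrite dotC.
have nb' : dot (V2 x) (nu x) = 0 by rewrite dotC.
have ab' : dot (V2 x) (V1 x) = 0 by rewrite dotC.
have h := expR_mulN x; have s2 := sin2E.
rewrite XE YE p_u p_v /E2 expR_N2 !dotE aa bb ab ab' pa' pb' na' nb'.
by split; [split; ring: s2 | ring..].
Qed.

Let tabn x :
  [/\ dot (X x) (Nu x) = - cos (2 * theta), dot (X x) (Nv x) = sin (2 * theta),
      dot (Y x) (Nu x) = sin (2 * theta) & dot (Y x) (Nv x) = cos (2 * theta)].
Proof.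
have [[pp nn aa bb] [pn pa pb] na nb ab] := frame x.
have ab' : dot (V2 x) (V1 x) = 0 by rewrite dotC.
have h := expR_mulN x; have s2 := sin2E.
rewrite XE YE NuE NvE p_u p_v nu_u nu_v cos_double sin_double !dotE aa bb ab ab'.
by split; ring: h s2.
Qed.

Let rule_u (f g : E -> 'cV[R]_4) (k : E -> R) x :
  smooth_plane f -> smooth_plane g -> (forall y, dot (f y) (g y) = k y) ->
  dot (partial_u f x) (g x) + dot (f x) (partial_u g x) = partial_u k x.
Proof.
move=> fs gs fgk; rewrite /partial_u -derive_dot; [|exact: smoothT_diff..].
by congr ('D_ _ _ x); apply/funext.
Qed.

Let rule_v (f g : E -> 'cV[R]_4) (k : E -> R) x :
  smooth_plane f -> smooth_plane g -> (forall y, dot (f y) (g y) = k y) ->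
  dot (partial_v f x) (g x) + dot (f x) (partial_v g x) = partial_v k x.
Proof.
move=> fs gs fgk; rewrite /partial_v -derive_dot; [|exact: smoothT_diff..].
by congr ('D_ _ _ x); apply/funext.
Qed.

Let derive_expR_scaled (k : R) w x :
  'D_w (fun y => expR (k * r y)) x = k * 'D_w r x * expR (k * r x).
Proof. by apply: derive_expR_scale; exact: smoothT_diff. Qed.

Let E2_u x : partial_u E2 x = - 2 * ru x * E2 x.
Proof. rewrite ruE; exact: derive_expR_scaled. Qed.

Let E2_v x : partial_v E2 x = - 2 * rv x * E2 x.
Proof. rewrite rvE; exact: derive_expR_scaled. Qed.

Let YuE : Xv = partial_u Y.
Proof. by rewrite XvE XE YE; exact: (smooth_symmetric_mx (1, 0) (0, 1) ps). Qed.

Let ext x (z z' : 'cV[R]_4) : dot z (p x) = dot z' (p x) ->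
  dot z (nu x) = dot z' (nu x) -> dot z (X x) = dot z' (X x) ->
  dot z (Y x) = dot z' (Y x) -> z = z'.
Proof.
move=> zp zn zX zY; apply: (frame_ext (frame x)) => //.
  by rewrite V1_rotated !dotE zX zY.
by rewrite V2_rotated !dotE zX zY.
Qed.

(** Differentiating the inner products of [tab] along u and v gives fourteen linear relations. Since
    the two mixed derivatives of [p] coincide, the unknowns are the twelve components of [Xu], [Xv],
    [Yv], and the relations determine them as Christoffel symbols are determined by a metric. *)
Let derives x :
  [/\ dot (Xu x) (p x) = - E2 x, dot (Xu x) (nu x) = cos (2 * theta),
      dot (Xu x) (X x) = - ru x * E2 x & dot (Xu x) (Y x) = rv x * E2 x] /\
  [/\ dot (Xv x) (p x) = 0, dot (Xv x) (nu x) = - sin (2 * theta),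
      dot (Xv x) (X x) = - rv x * E2 x & dot (Xv x) (Y x) = - ru x * E2 x] /\
  [/\ dot (Yv x) (p x) = - E2 x, dot (Yv x) (nu x) = - cos (2 * theta),
      dot (Yv x) (X x) = ru x * E2 x & dot (Yv x) (Y x) = - rv x * E2 x].
Proof.
have [[XX YY XY] Xp Yp Xn Yn] := tab x.
have [Xnu Xnv Ynu Ynv] := tabn x.
have uXp : dot (Xu x) (p x) + dot (X x) (X x) = 0.
  have := @rule_u X p (cst 0) x Xs ps (fun y => let: And5 _ e _ _ _ := tab y in e).
  by rewrite -XuE -XE [partial_u (cst 0) x]derive_cst.
have vXp : dot (Xv x) (p x) + dot (X x) (Y x) = 0.
  have := @rule_v X p (cst 0) x Xs ps (fun y => let: And5 _ e _ _ _ := tab y in e).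
  by rewrite -XvE -YE [partial_v (cst 0) x]derive_cst.
have uYp : dot (Xv x) (p x) + dot (Y x) (X x) = 0.
  have := @rule_u Y p (cst 0) x Ys ps (fun y => let: And5 _ _ e _ _ := tab y in e).
  by rewrite -YuE -XE [partial_u (cst 0) x]derive_cst.
have vYp : dot (Yv x) (p x) + dot (Y x) (Y x) = 0.
  have := @rule_v Y p (cst 0) x Ys ps (fun y => let: And5 _ _ e _ _ := tab y in e).
  by rewrite -YvE -YE [partial_v (cst 0) x]derive_cst.
have uXnu : dot (Xu x) (nu x) + dot (X x) (Nu x) = 0.
  have := @rule_u X nu (cst 0) x Xs nus (fun y => let: And5 _ _ _ e _ := tab y in e).
  by rewrite -XuE -NuE [partial_u (cst 0) x]derive_cst.
have vXnu : dot (Xv x) (nu x) + dot (X x) (Nv x) = 0.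
  have := @rule_v X nu (cst 0) x Xs nus (fun y => let: And5 _ _ _ e _ := tab y in e).
  by rewrite -XvE -NvE [partial_v (cst 0) x]derive_cst.
have uYnu : dot (Xv x) (nu x) + dot (Y x) (Nu x) = 0.
  have := @rule_u Y nu (cst 0) x Ys nus (fun y => let: And5 _ _ _ _ e := tab y in e).
  by rewrite -YuE -NuE [partial_u (cst 0) x]derive_cst.
have vYnu : dot (Yv x) (nu x) + dot (Y x) (Nv x) = 0.
  have := @rule_v Y nu (cst 0) x Ys nus (fun y => let: And5 _ _ _ _ e := tab y in e).
  by rewrite -YvE -NvE [partial_v (cst 0) x]derive_cst.
have uXX : dot (Xu x) (X x) + dot (X x) (Xu x) = - 2 * ru x * E2 x.
  have := @rule_u X X (E2) x Xs Xs (fun y => let: And5 (And3 e _ _) _ _ _ _ := tab y in e).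
  by rewrite -XuE E2_u.
have vXX : dot (Xv x) (X x) + dot (X x) (Xv x) = - 2 * rv x * E2 x.
  have := @rule_v X X (E2) x Xs Xs (fun y => let: And5 (And3 e _ _) _ _ _ _ := tab y in e).
  by rewrite -XvE E2_v.
have uYY : dot (Xv x) (Y x) + dot (Y x) (Xv x) = - 2 * ru x * E2 x.
  have := @rule_u Y Y (E2) x Ys Ys (fun y => let: And5 (And3 _ e _) _ _ _ _ := tab y in e).
  by rewrite -YuE E2_u.
have vYY : dot (Yv x) (Y x) + dot (Y x) (Yv x) = - 2 * rv x * E2 x.
  have := @rule_v Y Y (E2) x Ys Ys (fun y => let: And5 (And3 _ e _) _ _ _ _ := tab y in e).
  by rewrite -YvE E2_v.
have uXY : dot (Xu x) (Y x) + dot (X x) (Xv x) = 0.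
  have := @rule_u X Y (cst 0) x Xs Ys (fun y => let: And5 (And3 _ _ e) _ _ _ _ := tab y in e).
  by rewrite -XuE -YuE [partial_u (cst 0) x]derive_cst.
have vXY : dot (Xv x) (Y x) + dot (X x) (Yv x) = 0.
  have := @rule_v X Y (cst 0) x Xs Ys (fun y => let: And5 (And3 _ _ e) _ _ _ _ := tab y in e).
  by rewrite -XvE -YvE [partial_v (cst 0) x]derive_cst.
have YX : dot (Y x) (X x) = 0 by rewrite dotC.
rewrite XX in uXp; rewrite XY in vXp; rewrite YX in uYp; rewrite YY in vYp.
rewrite Xnu in uXnu; rewrite Xnv in vXnu; rewrite Ynu in uYnu; rewrite Ynv in vYnu.
rewrite (dotC (X x) (Xu x)) in uXX; rewrite (dotC (X x) (Xv x)) in vXX.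
rewrite (dotC (Y x) (Xv x)) in uYY; rewrite (dotC (Y x) (Yv x)) in vYY.
rewrite (dotC (X x) (Xv x)) in uXY; rewrite (dotC (X x) (Yv x)) in vXY.
split; [split; lra | split; [split | split]]; lra.
Qed.

Let comb_ext x (z : 'cV[R]_4) (k1 k2 k3 k4 : R) :
  dot z (p x) = k4 -> dot z (nu x) = k3 -> dot z (X x) = k1 * E2 x ->
  dot z (Y x) = k2 * E2 x ->
  z = k1 *: X x + k2 *: Y x + k3 *: nu x + k4 *: p x.
Proof.
have [[XX YY XY] Xp Yp Xn Yn] := tab x.
have [[pp nn _ _] [pn _ _] _ _ _] := frame x.
have np : dot (nu x) (p x) = 0 by rewrite dotC.
have pX : dot (p x) (X x) = 0 by rewrite dotC.
have pY : dot (p x) (Y x) = 0 by rewrite dotC.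
have nX : dot (nu x) (X x) = 0 by rewrite dotC.
have nY : dot (nu x) (Y x) = 0 by rewrite dotC.
have YX : dot (Y x) (X x) = 0 by rewrite dotC.
move=> zp zn zX zY; apply: (@ext x); rewrite !dotE.
- by rewrite zp Xp Yp np pp; ring.
- by rewrite zn Xn Yn nn pn; ring.
- by rewrite zX XX YX nX pX; ring.
- by rewrite zY XY YY nY pY; ring.
Qed.

Lemma frame_uu x : Xu x = - ru x *: X x + rv x *: Y x
  + cos (2 * theta) *: nu x - expR (- 2 * r x) *: p x.
Proof. by have [[a1 a2 a3 a4] _] := derives x; rewrite -scaleNr; exact: comb_ext. Qed.

Lemma frame_uv x : Xv x = - rv x *: X x - ru x *: Y x - sin (2 * theta) *: nu x.
Proof.
have [_ [[a1 a2 a3 a4] _]] := derives x.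
by rewrite -!scaleNr -[RHS]addr0 -(scale0r (p x)); exact: comb_ext.
Qed.

Lemma frame_vv x : Yv x = ru x *: X x - rv x *: Y x
  - cos (2 * theta) *: nu x - expR (- 2 * r x) *: p x.
Proof. by have [_ [_ [a1 a2 a3 a4]]] := derives x; rewrite -!scaleNr; exact: comb_ext. Qed.

Lemma frame_nu_u x : Nu x = expR (2 * r x) *:
  (- cos (2 * theta) *: X x + sin (2 * theta) *: Y x).
Proof.
have h := expR_mulN x.
rewrite XE YE NuE p_u p_v nu_u expR_2 cos_double sin_double.
by apply/matrixP => i j; rewrite !mxE; ring: h sin2E.
Qed.

Lemma frame_nu_v x : Nv x = expR (2 * r x) *:
  (sin (2 * theta) *: X x + cos (2 * theta) *: Y x).
Proof.
have h := expR_mulN x.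
rewrite XE YE NvE p_u p_v nu_v expR_2 cos_double sin_double.
by apply/matrixP => i j; rewrite !mxE; ring: h sin2E.
Qed.

Lemma frame_norm x : [/\ dot (X x) (X x) = expR (- 2 * r x),
  dot (Y x) (Y x) = expR (- 2 * r x) & dot (X x) (Y x) = 0].
Proof. by have [] := tab x. Qed.

(* Gauss equation: <X_u, Y_v> - <X_v, X_v> = d_v <X_u, Y> - d_u <X_v, Y>. *)
Lemma frame_sinh_gordon x : partial_u ru x + partial_v rv x
  + (expR (2 * r x) - expR (- 2 * r x)) = 0.
Proof.
have rus : smooth_plane ru by rewrite ruE; exact: smooth_on_derive.
have rvs : smooth_plane rv by rewrite rvE; exact: smooth_on_derive.
have E2s : smooth_plane E2.
  move=> n; apply: (Cn_on_expR openT); apply: (Cn_on_scale openT); first exact: Cn_on_cst.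
  exact: rs.
have Xus : smooth_plane Xu by rewrite XuE; exact: smooth_on_derive.
have Xvs : smooth_plane Xv by rewrite XvE; exact: smooth_on_derive.
have h1 := @rule_v Xu Y (fun y => rv y * E2 y) x Xus Ys
  (fun y => let: conj (And4 _ _ _ e) _ := derives y in e).
have h2 := @rule_u Xv Y (fun y => - ru y * E2 y) x Xvs Ys
  (fun y => let: conj _ (conj (And4 _ _ _ e) _) := derives y in e).
have sy : partial_v Xu = partial_u Xv.
  by rewrite XuE XvE; exact: (smooth_symmetric_mx (1, 0) (0, 1) Xs).
have d1 : partial_v (fun y => rv y * E2 y) x = partial_v rv x * E2 x + rv x * partial_v E2 x.
  exact: (@derive_scale _ _ _ rv E2 x (0, 1) (smoothT_diff _ rvs) (smoothT_diff _ E2s)).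
have nrud : differentiable (fun y => - ru y) x by apply: differentiableN; exact: smoothT_diff.
have d2 : partial_u (fun y => - ru y * E2 y) x = - (partial_u ru x * E2 x + ru x * partial_u E2 x).
  apply: (etrans (@derive_scale _ _ _ (fun y => - ru y) E2 x (1, 0) nrud (smoothT_diff _ E2s))).
  rewrite deriveN; last by apply: diff_derivable; exact: smoothT_diff.
  by rewrite scaleNr scaleNr -opprD.
rewrite d1 -YvE sy E2_v in h1; rewrite d2 -YuE E2_u in h2.
have h3 : dot (Xu x) (Yv x) - dot (Xv x) (Xv x) =
    (partial_u ru x + partial_v rv x - 2 * (ru x * ru x + rv x * rv x)) * E2 x.
  transitivity ((dot (partial_u Xv x) (Y x) + dot (Xu x) (Yv x)) -
    (dot (partial_u Xv x) (Y x) + dot (Xv x) (Xv x))); first by ring.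
  by rewrite h1 h2; ring.
have [[a1 a2 a3 a4] [[b1 b2 b3 b4] _]] := derives x.
(* The same difference from the structure equations: the components along [nu] contribute [- 1],
   those along [p] contribute [E2 * E2]. *)
have h4 : dot (Xu x) (Yv x) - dot (Xv x) (Xv x) =
    - 2 * (ru x * ru x + rv x * rv x) * E2 x + E2 x * E2 x - 1.
  rewrite {1}frame_vv {1}frame_uv !dotE a1 a2 a3 a4.
  rewrite (dotC (X x)) (dotC (Y x)) (dotC (nu x)) b2 b3 b4 cos_double sin_double -/(E2 x).
  ring: sin2E.
have h := expR_mulN x.
have e2 : E2 x * expR (2 * r x) = 1 by rewrite /E2 expR_N2 expR_2; ring: h.
have h5 : E2 x * (partial_u ru x + partial_v rv x + (expR (2 * r x) - E2 x)) = 0.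
  have : (partial_u ru x + partial_v rv x) * E2 x = E2 x * E2 x - 1.
    by move: h3; rewrite h4; lra.
  move=> h6; transitivity ((partial_u ru x + partial_v rv x) * E2 x
    + E2 x * expR (2 * r x) - E2 x * E2 x); first by ring.
  by rewrite h6 e2; ring.
have E20 : E2 x != 0 by rewrite gt_eqF// expR_gt0.
by move/eqP: h5; rewrite mulf_eq0 (negbTE E20) => /eqP.
Qed.

Let derive_V (V : E -> 'cV[R]_4) (a b : R) w x :
  (forall y, V y = expR (r y) *: (a *: X y + b *: Y y)) ->
  'D_w V x = 'D_w r x *: V x + expR (r x) *: (a *: 'D_w X x + b *: 'D_w Y x).
Proof.
move=> VE.
have -> : V = (fun y => expR (r y) *: (a *: X y + b *: Y y)) by apply/funext.
have Xd := smoothT_diff x Xs; have Yd := smoothT_diff x Ys.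
have lin : is_derive x w (fun y => a *: X y + b *: Y y) (a *: 'D_w X x + b *: 'D_w Y x).
  have dX : is_derive x w X ('D_w X x) by exact/derivableP/diff_derivable.
  have dY : is_derive x w Y ('D_w Y x) by exact/derivableP/diff_derivable.
  exact: (is_deriveD (is_deriveZ a dX) (is_deriveZ b dY)).
have lind : differentiable (fun y => a *: X y + b *: Y y) x.
  by apply: differentiableD; apply: differentiableZ.
have ed : differentiable (fun y => expR (r y)) x.
  have es : smooth_plane (fun y => expR (r y)) by move=> n; exact: (Cn_on_expR openT (rs n)).
  exact: smoothT_diff.
rewrite derive_scale// (@derive_val _ _ _ _ _ _ _ lin) scalerA; congr (_ *: _ + _).
have -> : (fun y => expR (r y)) = (fun y => expR (1 * r y)).
  by apply/funext => y; rewrite mul1r.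
by rewrite derive_expR_scaled !mul1r.
Qed.

(** The derivative of the factor e^r cancels the [ru] part of the second derivatives, so [rv] alone
    remains as rotation rate in the tangent plane. The angle [2 * theta] of the second fundamental
    form and the angle [theta] of the frame combine into [theta]. The three other derivatives of the
    frame follow the same pattern. *)
Lemma frame_V1_u x : partial_u V1 x =
  rv x *: V2 x + c *: (expR (r x) *: nu x - expR (- r x) *: p x).
Proof.
have VE y : V1 y = expR (r y) *: (c *: X y + (- s) *: Y y).
  by rewrite V1_rotated scaleNr.
have -> : partial_u V1 x = ru x *: V1 x + expR (r x) *: (c *: Xu x + (- s) *: Xv x).
  by rewrite XuE YuE ruE; exact: (derive_V (1, 0) x VE).
rewrite frame_uu frame_uv V1_rotated V2_rotated expR_N2 cos_double sin_double.
have h := expR_mulN x.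
by apply/matrixP => i j; rewrite !mxE; ring: h sin2E.
Qed.

Lemma frame_V1_v x : partial_v V1 x =
  - ru x *: V2 x + s *: (- expR (r x) *: nu x + expR (- r x) *: p x).
Proof.
have VE y : V1 y = expR (r y) *: (c *: X y + (- s) *: Y y).
  by rewrite V1_rotated scaleNr.
have -> : partial_v V1 x = rv x *: V1 x + expR (r x) *: (c *: Xv x + (- s) *: Yv x).
  by rewrite XvE YvE rvE; exact: (derive_V (0, 1) x VE).
rewrite frame_uv frame_vv V1_rotated V2_rotated expR_N2 cos_double sin_double.
have h := expR_mulN x.
by apply/matrixP => i j; rewrite !mxE; ring: h sin2E.
Qed.

Lemma frame_V2_u x : partial_u V2 x =
  - rv x *: V1 x - s *: (expR (r x) *: nu x + expR (- r x) *: p x).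
Proof.
have -> : partial_u V2 x = ru x *: V2 x + expR (r x) *: (s *: Xu x + c *: Xv x).
  by rewrite XuE YuE ruE; exact: (derive_V (1, 0) x V2_rotated).
rewrite frame_uu frame_uv V1_rotated V2_rotated expR_N2 cos_double sin_double.
have h := expR_mulN x.
by apply/matrixP => i j; rewrite !mxE; ring: h sin2E.
Qed.

Lemma frame_V2_v x : partial_v V2 x =
  ru x *: V1 x - c *: (expR (r x) *: nu x + expR (- r x) *: p x).
Proof.
have -> : partial_v V2 x = rv x *: V2 x + expR (r x) *: (s *: Xv x + c *: Yv x).
  by rewrite XvE YvE rvE; exact: (derive_V (0, 1) x V2_rotated).
rewrite frame_uv frame_vv V1_rotated V2_rotated expR_N2 cos_double sin_double.
have h := expR_mulN x.
by apply/matrixP => i j; rewrite !mxE; ring: h sin2E.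
Qed.

Variable B : 'M[R]_4.
Hypothesis B_so4 : so4 B.
Hypothesis r_u : forall x, ru x = dot (B *m p x) (nu x).

Let so4_dot (y z : 'cV[R]_4) : dot (B *m y) z = - dot (B *m z) y.
Proof.
have dotM (a b : 'cV[R]_4) : dot a b = (a^T *m b) 0 0.
  by rewrite mxE; apply: eq_bigr => i _; rewrite mxE.
rewrite [dot (B *m z) y]dotC !dotM trmx_mul B_so4 mulmxN mulNmx mulmxA.
by rewrite [LHS]mxE.
Qed.

Let dotB (w : E) x : 'D_w ru x = dot (B *m 'D_w p x) (nu x) + dot (B *m p x) ('D_w nu x).
Proof.
have -> : ru = (fun y => dot (B *m p y) (nu y)) by apply/funext.
have [d1 d2] := mulmx_differentiable B w (smoothT_diff x ps).
by rewrite (derive_dot w d1 (smoothT_diff x nus)) d2.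
Qed.

(** By symmetry of second derivatives the left side is the derivative along v of [<Bp, nu>];
    skewness of [B] then moves it from [p] to the tangent frame. *)
Lemma frame_s_u x : partial_u rv x =
  c * dot (B *m V2 x) (expR (- r x) *: nu x - expR (r x) *: p x)
  - s * dot (B *m V1 x) (expR (- r x) *: nu x + expR (r x) *: p x).
Proof.
have -> : partial_u rv = partial_v ru.
  by rewrite rvE ruE; exact: (smooth_symmetric (0, 1) (1, 0) rs).
rewrite [LHS](_ : _ = dot (B *m partial_v p x) (nu x) + dot (B *m p x) (partial_v nu x));
    last exact: dotB.
  rewrite p_v nu_v.
rewrite !(mulmxDr, =^~ scalemxAr, mulmxN) !dotE.
rewrite (so4_dot (p x) (V1 x)) (so4_dot (p x) (V2 x)); ring.
Qed.

(** Only the derivative of [r] along u is known through [B]. The sinh-Gordon equation trades the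
    second derivative along v for the one along u, which is the u-derivative of [<Bp, nu>]. *)
Lemma frame_s_v x : partial_v rv x =
  expR (- 2 * r x) - expR (2 * r x)
  - s * dot (B *m V2 x) (expR (- r x) *: nu x - expR (r x) *: p x)
  - c * dot (B *m V1 x) (expR (- r x) *: nu x + expR (r x) *: p x).
Proof.
have uu : partial_u ru x =
  s * dot (B *m V2 x) (expR (- r x) *: nu x - expR (r x) *: p x)
  + c * dot (B *m V1 x) (expR (- r x) *: nu x + expR (r x) *: p x).
  rewrite [LHS](_ : _ = dot (B *m partial_u p x) (nu x) + dot (B *m p x) (partial_u nu x));
    last exact: dotB.
  rewrite p_u nu_u.
  rewrite !(mulmxDr, =^~ scalemxAr, mulmxN) !dotE.
  rewrite (so4_dot (p x) (V1 x)) (so4_dot (p x) (V2 x)); ring.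
by have := frame_sinh_gordon x; rewrite uu; lra.
Qed.

End FrameEquations.

(** * Codazzi equations *)

Section Codazzi.
Context {R : realType}.
Local Notation E := (R * R)%type.
Variables (P n V : E -> 'cV[R]_4) (L : E -> R) (sg : R).
Hypotheses (Ps : smooth_plane P) (ns : smooth_plane n) (Vs : smooth_plane V).
Hypotheses (Ls : smooth_plane L) (sg0 : sg != 0).
Hypothesis nV : forall w x,
  dot ('D_w n x) (V x) = sg * expR (2 * L x) * dot ('D_w P x) (V x).
Hypothesis nVd : forall w w' x,
  dot ('D_w n x) ('D_w' V x) = - sg * expR (2 * L x) * dot ('D_w P x) ('D_w' V x).

(* Differentiating <dP, V> and <dn, V> gives the curl of <dP, V> and, the two
   differing by the factor sg e^(2L), also its product with dL; in the curl of
   e^L <dP, V> the two contributions cancel. *)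
Lemma codazzi_closed x :
  partial_v (fun y => expR (L y) * dot (partial_u P y) (V y)) x =
  partial_u (fun y => expR (L y) * dot (partial_v P y) (V y)) x.
Proof.
have sd (W : normedModType R) (f : E -> W) y : smooth_plane f -> differentiable f y.
  by move=> fs; exact: (smooth_on_differentiable fs).
(* The elimination is carried out on real variables: [A] and [B] stand for the mixed second
   derivatives of [n] and [P] against [V], [a1] and [a2] for [<dP, V>], [b] and [c] for [<dP, dV>]
   and [<dn, dV>], [e] for e^(2L). *)
have alg1 (e lu lv a1 a2 b1 b2 A A' B B' c1 c2 : R) : e != 0 ->
    A + c1 = sg * (2 * lv * e * a1 + e * (B + b1)) ->
    A' + c2 = sg * (2 * lu * e * a2 + e * (B' + b2)) ->
    c1 = - sg * e * b1 -> c2 = - sg * e * b2 -> A = A' -> B = B' ->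
    lv * a1 - lu * a2 + (b1 - b2) = 0.
  move=> e0 h1 h2 h3 h4 h5 h6; rewrite h3 h5 h6 in h1; rewrite h4 in h2.
  have : 2 * (sg * e) * (lv * a1 - lu * a2 + (b1 - b2)) = 0.
    transitivity ((sg * (2 * lv * e * a1 + e * (B' + b1)) - (A' + - sg * e * b1))
      - (sg * (2 * lu * e * a2 + e * (B' + b2)) - (A' + - sg * e * b2))); first by ring.
    by rewrite -h1 -h2 !subrr.
  by move/eqP; rewrite !mulf_eq0 pnatr_eq0 (negbTE sg0) (negbTE e0) => /eqP.
have alg2 (e lu lv a1 a2 b1 b2 B B' : R) :
    lv * a1 - lu * a2 + (b1 - b2) = 0 -> B = B' ->
    1 * lv * e * a1 + e * (B + b1) = 1 * lu * e * a2 + e * (B' + b2).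
  move=> h <-; apply/eqP; rewrite -subr_eq0; apply/eqP.
  transitivity (e * (lv * a1 - lu * a2 + (b1 - b2))); first by ring.
  by rewrite h mulr0.
have e2 : expR (2 * L x) != 0 by rewrite gt_eqF// expR_gt0.
pose u : E := (1, 0); pose v : E := (0, 1).
have ded w (f : E -> 'cV[R]_4) y : smooth_plane f ->
    'D_w (fun z => dot (f z) (V z)) y = dot ('D_w f y) (V y) + dot (f y) ('D_w V y).
  by move=> fs; apply: derive_dot; exact: sd.
have dPs w : smooth_plane ('D_w P) by exact: smooth_on_derive.
have dns w : smooth_plane ('D_w n) by exact: smooth_on_derive.
have fsm (f : E -> 'cV[R]_4) : smooth_plane f -> smooth_plane (fun z => dot (f z) (V z)).
  by move=> fs k; exact: Cn_on_dot openT (fs k) (Vs k).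
have expL (k : R) : smooth_plane (fun y => expR (k * L y)).
  move=> m; apply: (Cn_on_expR openT).
  by apply: (Cn_on_scale openT); [exact: Cn_on_cst | exact: Ls].
have dexpL (k : R) w y : 'D_w (fun z => expR (k * L z)) y = k * 'D_w L y * expR (k * L y).
  by apply: derive_expR_scale; exact: sd.
have prodL (k : R) w (f : E -> 'cV[R]_4) y : smooth_plane f ->
    'D_w (fun z => expR (k * L z) * dot (f z) (V z)) y =
    k * 'D_w L y * expR (k * L y) * dot (f y) (V y) +
    expR (k * L y) * (dot ('D_w f y) (V y) + dot (f y) ('D_w V y)).
  move=> fs.
  apply: (etrans (derive_scale w (sd _ _ y (expL k)) (sd _ _ y (fsm f fs)))).
  by congr (_ + _ *: _); [rewrite dexpL | exact: ded].
have symP : 'D_v ('D_u P) x = 'D_u ('D_v P) x.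
  exact: (congr1 (fun h => h x) (smooth_symmetric_mx u v Ps)).
have symn : 'D_v ('D_u n) x = 'D_u ('D_v n) x.
  exact: (congr1 (fun h => h x) (smooth_symmetric_mx u v ns)).
have second w w' : dot ('D_w' ('D_w n) x) (V x) + dot ('D_w n x) ('D_w' V x) =
   sg * (2 * 'D_w' L x * expR (2 * L x) * dot ('D_w P x) (V x) +
    expR (2 * L x) * (dot ('D_w' ('D_w P) x) (V x) + dot ('D_w P x) ('D_w' V x))).
  apply: (etrans (esym (ded w' ('D_w n) x (dns w)))).
  apply: (etrans _ (congr1 (fun t => sg * t) (prodL 2 w' ('D_w P) x (dPs w)))).
  have -> : (fun z => dot ('D_w n z) (V z)) =
      (fun z => sg * (expR (2 * L z) * dot ('D_w P z) (V z))).
    by apply/funext => z; rewrite nV mulrA.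
  apply: (deriveZ sg); apply: diff_derivable.
  apply: (@differentiable_scale _ _ _ (fun z => expR (2 * L z))
    (fun z => dot ('D_w P z) (V z))); apply: sd; [exact: expL | exact: fsm].
have H1 := second u v; have H2 := second v u.

have key : 'D_v L x * dot ('D_u P x) (V x) - 'D_u L x * dot ('D_v P x) (V x)
   + (dot ('D_u P x) ('D_v V x) - dot ('D_v P x) ('D_u V x)) = 0.
  exact: (alg1 _ _ _ _ _ _ _ _ _ _ _ _ _ e2 H1 H2 (nVd u v x) (nVd v u x)
    (congr1 (fun z => dot z (V x)) symn) (congr1 (fun z => dot z (V x)) symP)).
have one (f : E -> 'cV[R]_4) : (fun y => expR (L y) * dot (f y) (V y)) =
    (fun y => expR (1 * L y) * dot (f y) (V y)).
  by apply/funext => y; rewrite mul1r.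
apply: (etrans (congr1 (fun h => 'D_v h x) (one ('D_u P)))).
apply: (etrans _ (esym (congr1 (fun h => 'D_u h x) (one ('D_v P))))).
apply: (etrans (prodL 1 v ('D_u P) x (dPs u))).
apply: (etrans _ (esym (prodL 1 u ('D_v P) x (dPs v)))).
exact: (alg2 _ _ _ _ _ _ _ _ _ key (congr1 (fun z => dot z (V x)) symP)).
Qed.

End Codazzi.

(** * Coverings and charts *)

Section Covering.
Context {R : realType}.
Local Notation E := (R * R)%type.

Lemma torus_dom_shift (x0 : E) (n1 n2 : int) (z : torus_space R) :
  torus_dom x0 z -> torus_dom (x0 + (n1%:~R, n2%:~R)) z.
Proof.
move=> [x [h1 h2] <-]; exists (x + (n1%:~R, n2%:~R)); last exact: torus_proj_shift.
by split; rewrite /ball /= opprD addrACA subrr addr0.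
Qed.

(** Serves to show that the sheets over a square, which are its integer translates, are disjoint. *)
Lemma int_dist_lt1 (x y : R) (m n : int) :
  `|x + m%:~R - y| < 2^-1 -> `|x + n%:~R - y| < 2^-1 -> m = n.
Proof.
rewrite !ltr_norml => /andP[a1 a2] /andP[b1 b2].
have h1 : (m%:~R : R) < n%:~R + 1 by lra.
have h2 : (n%:~R : R) < m%:~R + 1 by lra.
rewrite -(intrD _ _ 1) ltr_int in h1; rewrite -(intrD _ _ 1) ltr_int in h2.
by apply/eqP; rewrite eq_le -!ltzD1 h1 h2.
Qed.

(** The open unit square around a representative is a ball of radius 1/2 for the maximum norm. Its
    integer translates are the sheets, and the chart coordinate centered at a translate is the
    section with values in it. *)
Lemma torus_proj_covering : covering_map (@torus_proj R).
Proof.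
split.
- exact: torus_proj_continuous.
- by apply/seteqP; split=> // y _; exists (repr y) => //; exact: reprK.
- move=> y; exists (torus_dom (repr y)); split.
  + by apply: torus_proj_open; apply: ball_open; exact: half_gt0.
  + exact: torus_dom_repr.
  pose sh (n : int * int) : E := repr y + (n.1%:~R, n.2%:~R).
  exists [set ball (sh n) 2^-1 | n in [set: int * int]]; split.
  + apply/seteqP; split=> [x|x [_ [n _ <-] Bx]].
      move=> [x' Bx' /torus_proj_eq[n1 [n2 xE]]].
      exists (ball (sh (n1, n2)) 2^-1); first by exists (n1, n2).
      rewrite xE; move: Bx' => [h1 h2].
      by split; rewrite /ball /= opprD addrACA subrr addr0.
    rewrite /preimage /= -(torus_proj_shift x (- n.1) (- n.2)).
    exists (x + ((- n.1)%:~R, (- n.2)%:~R)) => //.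
    move: Bx => [h1 h2].
    by split; [move: h1 | move: h2]; rewrite /sh /ball /= rmorphN /= opprD opprK addrA addrAC.
  + move=> _ _ [m _ <-] [n _ <-] [x [[m1 m2] [n1 n2]]].
    by congr (ball (sh _) _); rewrite (surjective_pairing m) (surjective_pairing n);
      rewrite (int_dist_lt1 m1 n1) (int_dist_lt1 m2 n2).
  + move=> _ [n _ <-]; split; first by apply: ball_open; exact: half_gt0.
    exists (torus_coord (sh n)); split.
    * move=> z /(torus_dom_shift n.1 n.2) zn.
      by split; [exact: torus_coord_cod | exact: torus_projK].
    * by move=> x Bx; exact: torus_coordK.
    * by move=> z /(torus_dom_shift n.1 n.2) zn; exact: torus_coord_continuous.
Qed.

(** Evenly covered sets are pulled back by [f] and sheets by [h]. It transfers the covering of the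
    flat torus to the surface and to the new coordinates of the plane. *)
Lemma covering_comp_homeo (X X' Y Y' : topologicalType) (p : X -> Y)
    (h : X' -> X) (k : X -> X') (g : Y -> Y') (f : Y' -> Y) :
  continuous h -> continuous k -> cancel h k -> cancel k h ->
  continuous g -> continuous f -> cancel g f -> cancel f g ->
  covering_map p -> covering_map (g \o p \o h).
Proof.
move=> hc kc hK kK gc fc gK fK [pc pr pU]; split.
- move=> x; apply: continuous_comp; first exact: hc.
  by apply: continuous_comp; [exact: pc | exact: gc].
- apply/seteqP; split=> // y _.
  have [x _ xE] : range p (f y) by rewrite pr.
  by exists (k x) => //=; rewrite kK xE fK.
- move=> y; have [U [oU Uy [F [FU Ftriv FS]]]] := pU (f y).
  exists (f @^-1` U); split => //; first by apply: open_comp => // z _; exact: fc.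
  exists [set h @^-1` S | S in F]; split.
  + apply/seteqP; split=> [x|x [_ [S FS' <-] Sx]].
      rewrite /preimage /= gK => Ux.
      have : (p @^-1` U) (h x) by [].
      by rewrite FU => -[S FS' Sx]; exists (h @^-1` S) => //; exists S.
    rewrite /preimage /= gK.
    have : (\bigcup_(S in F) S) (h x) by exists S.
    by rewrite -FU.
  + move=> _ _ [S FS1 <-] [S' FS2 <-] [x [Sx Sx']].
    by rewrite (Ftriv S S' FS1 FS2)//; exists (h x).
  + move=> _ [S FS1 <-]; have [oS [q [q1 q2 q3]]] := FS S FS1.
    split; first by apply: open_comp => // z _; exact: hc.
    exists (k \o q \o f); split.
    * move=> z Uz; have [Sq pq] := q1 _ Uz.
      by rewrite /preimage /= !kK; split=> //=; rewrite pq fK.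
    * by move=> x Sx; rewrite /= gK q2// hK.
    * move=> z Uz; apply: continuous_comp; first exact: fc.
      by apply: continuous_comp; [exact: q3 | exact: kc].
Qed.

End Covering.

Local Notation coord := Defs.coord.

(** * Maps from the plane to a surface *)

Section PlaneToSurface.
Context {R : realType} {M : smooth_surface R}.
Local Notation E := (R * R)%type.

(* The velocity of tau along v, in the chart that represents tangent vectors. *)
Definition velocity (tau : E -> M) (x v : E) : E :=
  'D_v (coord (chart_at (tau x)) \o tau) x.

Variable tau : E -> M.
Hypotheses (tau_cont : continuous tau) (tau_smooth : smooth_into tau).

Lemma preimage_dom_open (d : chart R M) : open (tau @^-1` dom d).
Proof. by apply: open_comp; [move=> x _; exact: tau_cont | exact: dom_open]. Qed.

Lemma smooth_fun_comp (W : normedModType R) (f : M -> W) :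
  smooth_fun f -> smooth_plane (f \o tau).
Proof.
move=> fs n; apply: Cn_on_near => x _.
pose d := chart_at (tau x).
have da : atlas d by exact: chart_at_atlas.
exists (tau @^-1` dom d), ((f \o param d) \o (coord d \o tau)); split.
- exact: chart_at_dom.
- apply: (@Cn_on_comp _ _ _ _ (cod d)).
  + exact: preimage_dom_open.
  + by move=> y yd; exact: coord_cod.
  + exact: fs.
  + exact: tau_smooth.
- have : nbhs x (tau @^-1` dom d).
    by apply: open_nbhs_nbhs; split; [exact: preimage_dom_open | exact: chart_at_dom].
  by apply: filterS => y yd /=; rewrite coordK.
Qed.

Lemma velocity_differentiable x :
  differentiable (coord (chart_at (tau x)) \o tau) x.
Proof.
have da := chart_at_atlas (tau x).
by apply: (smooth_on_differentiable (tau_smooth da)); exact: chart_at_dom.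
Qed.

Lemma smooth_fun_differentiable (W : normedModType R) (f : M -> W) (m : M) :
  smooth_fun f -> differentiable (f \o param (chart_at m)) (coord (chart_at m) m).
Proof.
move=> fs; have da := chart_at_atlas m.
by apply: (smooth_on_differentiable (fs _ da)); apply: coord_cod; exact: chart_at_dom.
Qed.

(** Near [x] the composite factors through the chart chosen at [tau x], in which both [dmap] and
    [velocity] are expressed. *)
Lemma derive_fun_comp (W : normedModType R) (f : M -> W) x v : smooth_fun f ->
  'D_v (f \o tau) x = dmap f (tau x) (velocity tau x v).
Proof.
move=> fs; pose d := chart_at (tau x).
have eq : \near x, (f \o tau) x = ((f \o param d) \o (coord d \o tau)) x.
  have : nbhs x (tau @^-1` dom d).
    by apply: open_nbhs_nbhs; split; [exact: preimage_dom_open | exact: chart_at_dom].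
  by apply: filterS => y yd /=; rewrite coordK.
rewrite (near_eq_derive _ eq) derive_comp//; last exact: velocity_differentiable.
exact: smooth_fun_differentiable.
Qed.

Lemma dmap_linear (W : normedModType R) (f : M -> W) m a xi eta : smooth_fun f ->
  dmap f m (a *: xi + eta) = a *: dmap f m xi + dmap f m eta.
Proof. by move=> fs; apply: derive_linear; exact: smooth_fun_differentiable. Qed.

Lemma dmap_comb (W : normedModType R) (h : M -> W) m k1 k2 (xi eta : E) : smooth_fun h ->
  dmap h m (k1 *: xi + k2 *: eta) = k1 *: dmap h m xi + k2 *: dmap h m eta.
Proof.
move=> hs; apply: (etrans (dmap_linear m k1 xi (k2 *: eta) hs)).
congr (_ + _); have h0 : dmap h m 0 = 0 by exact: derive0.
have := dmap_linear m k2 eta 0 hs; rewrite addr0 => ->.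
by rewrite h0 addr0.
Qed.

Lemma smooth_into_comp (Psi : E -> E) : smooth_plane Psi -> smooth_into (tau \o Psi).
Proof.
move=> Psis d da n.
have Psic : continuous Psi by move=> x; exact: (smooth_on_continuous Psis).
have -> : coord d \o (tau \o Psi) = (coord d \o tau) \o Psi by [].
apply: (@Cn_on_comp _ _ _ _ (tau @^-1` dom d)).
- have -> : (tau \o Psi) @^-1` dom d = Psi @^-1` (tau @^-1` dom d) by [].
  apply: open_comp; first by move=> x _; exact: Psic.
  exact: preimage_dom_open.
- by [].
- exact: tau_smooth.
- by apply: (@Cn_on_sub _ _ _ _ setT) => //; exact: Psis.
Qed.

End PlaneToSurface.

(** * Parametrization of the surface by the universal covering of the torus *)

Section TorusParametrization.
Context {R : realType} {M : smooth_surface R}.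
Local Notation E := (R * R)%type.
Variables (f : M -> torus R) (g : torus R -> M).
Hypotheses (gK : cancel g f) (fK : cancel f g).
Hypotheses (fs : smooth_map f) (gs : smooth_map g).
Local Notation F := (g \o @torus_proj R : E -> M).

Lemma torus_param_continuous : continuous F.
Proof.
by move=> x; apply: continuous_comp; [exact: torus_proj_continuous | exact: gs.1].
Qed.

Lemma torus_param_smooth : smooth_into F.
Proof.
move=> d da n; apply: Cn_on_near => x Fx.
have ca : @atlas R (torus R) (torus_chart x) by exists x.
have := gs.2 _ _ ca da n => H.
exists (cod (torus_chart x) `&` (g \o param (torus_chart x)) @^-1` dom d),
  (coord d \o g \o param (torus_chart x)); split=> //.
- by split=> //=; apply: ballxx; rewrite invr_gt0 ltr0n.
- by apply: filterE.
Qed.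

(** Followed by [f] read in the torus chart at [x], the parametrization is the identity near [x], so
    its differential has a left inverse. *)
Lemma torus_param_immersion x v : velocity F x v = 0 -> v = 0.
Proof.
pose d := chart_at (F x).
have da : atlas d by exact: chart_at_atlas.
have ca : @atlas R (torus R) (torus_chart x) by exists x.
pose H := coord d \o F; pose G := coord (torus_chart x) \o f \o param d.
have Hd : differentiable H x by exact: (velocity_differentiable torus_param_smooth).
have xB : ball x (2^-1 : R) x.
  by apply: ballxx; rewrite invr_gt0 ltr0n.
have FHx : param d (H x) = F x by rewrite /H /= coordK//; exact: chart_at_dom.
have Gd : differentiable G (H x).
  apply: (smooth_on_differentiable (fs.2 _ _ da ca)); split.
    by apply: coord_cod; exact: chart_at_dom.
  by rewrite /preimage /= FHx /= gK; exists x.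
have GH : \near x, id x = (G \o H) x.
  have n1 : nbhs x (F @^-1` dom d).
    apply: open_nbhs_nbhs; split; first exact: (preimage_dom_open torus_param_continuous).
    exact: chart_at_dom.
  have n2 : nbhs x (ball x (2^-1 : R)).
    by apply: open_nbhs_nbhs; split=> //; apply: ball_open; exact: half_gt0.
  apply: filterS (filterI n1 n2) => y [yd yB].
  by rewrite /G /H /= coordK//= gK torus_coordK.
move=> v0; have Hv : 'D_v H x = 0 := v0.
have GHd : 'D_v id x = 'D_v (G \o H) x by exact: near_eq_derive.
by move: GHd; rewrite derive_id derive_comp// Hv derive0.
Qed.

Lemma torus_param_periodic : Z2_periodic F.
Proof.
split=> x /=.
  by have := torus_proj_shift x 1 0 => /= ->.
by have := torus_proj_shift x 0 1 => /= ->.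
Qed.

Lemma torus_param_surj m : exists x, F x = m.
Proof. by exists (repr (f m)); rewrite /= [torus_proj _](reprK (f m)). Qed.

End TorusParametrization.

(** * Independence and orthogonality of the principal directions *)

Section FrameAlgebra.
Context {R : realType}.
Variables (a k1 k2 l1 l2 : R) (z1 z2 : 'cV[R]_4).
Hypotheses (a0 : a != 0) (z11 : dot z1 z1 = 1) (z22 : dot z2 z2 = 1).

(** The eigenvalues are opposite and nonzero: [a] times the first relation, minus or plus the
    second, isolates each coefficient. *)
Lemma eigenvectors_independent : k1 *: z1 + k2 *: z2 = 0 ->
  k1 *: (- a *: z1) + k2 *: (a *: z2) = 0 -> k1 = 0 /\ k2 = 0.
Proof.
move=> e1 e2.
have f1 : (2 * a * k1) *: z1 = 0.
  have -> : (2 * a * k1) *: z1 = a *: (k1 *: z1 + k2 *: z2)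
      - (k1 *: (- a *: z1) + k2 *: (a *: z2)).
    by apply/matrixP => i j; rewrite !mxE; ring.
  by rewrite e1 e2 scaler0 subr0.
have f2 : (2 * a * k2) *: z2 = 0.
  have -> : (2 * a * k2) *: z2 = a *: (k1 *: z1 + k2 *: z2)
      + (k1 *: (- a *: z1) + k2 *: (a *: z2)).
    by apply/matrixP => i j; rewrite !mxE; ring.
  by rewrite e1 e2 scaler0 addr0.
have unit_neq0 (z : 'cV[R]_4) (k : R) : dot z z = 1 -> (2 * a * k) *: z = 0 -> k = 0.
  move=> zz kz; have := congr1 (fun y => dot y z) kz.
  rewrite /= dotZl zz mulr1 dot0l => /eqP.
  by rewrite !mulf_eq0 pnatr_eq0 (negbTE a0) => /eqP.
by split; [exact: unit_neq0 f1 | exact: unit_neq0 f2].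
Qed.

(** The second hypothesis is the symmetry of the second fundamental form on two tangent vectors of
    components [k] and [l]. Its diagonal terms cancel, leaving [2 * a] times the determinant times
    [dot z1 z2]. *)
Lemma eigenvectors_orthogonal : k1 * l2 - k2 * l1 != 0 ->
  dot (a *: (- k1 *: z1 + k2 *: z2)) (l1 *: z1 + l2 *: z2) =
  dot (a *: (- l1 *: z1 + l2 *: z2)) (k1 *: z1 + k2 *: z2) ->
  dot z1 z2 = 0.
Proof.
move=> det0; rewrite !dotE z11 z22 [dot z2 z1]dotC => h.
have : 2 * a * ((k1 * l2 - k2 * l1) * dot z1 z2) = 0.
  by move: h; move: (dot _ _) => c h; lra.
by move/eqP; rewrite !mulf_eq0 pnatr_eq0 (negbTE det0) (negbTE a0) => /eqP.
Qed.

End FrameAlgebra.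

Section PrincipalFrame.
Context {R : realType} {M : smooth_surface R}.
Local Notation E := (R * R)%type.
Variables (rhoM N : M -> 'cV[R]_4) (a : M -> R) (W1 W2 : M -> E).
Hypotheses (rho_immersion : immersion_S3 rhoM) (N_gauss : gauss_map rhoM N).
Hypothesis a_gt0 : forall m, 0 < a m.
Hypotheses (W1_principal : principal_field rhoM N a W1)
  (W2_principal : principal_field rhoM N (fun m => - a m) W2).
Variable F : E -> M.
Hypotheses (F_cont : continuous F) (F_smooth : smooth_into F).
Hypothesis F_immersion : forall x v, velocity F x v = 0 -> v = 0.
Hypothesis F_surj : forall m, exists x, F x = m.

Local Notation V1 m := (dmap rhoM m (W1 m)).
Local Notation V2 m := (dmap rhoM m (W2 m)).

Let rho_smooth : smooth_fun rhoM. Proof. by have [] := rho_immersion. Qed.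
Let N_smooth : smooth_fun N. Proof. by have [] := N_gauss. Qed.

Lemma principal_independent m k1 k2 :
  k1 *: W1 m + k2 *: W2 m = 0 -> k1 = 0 /\ k2 = 0.
Proof.
move=> k0.
have [_ n1 d1] := W1_principal; have [_ n2 d2] := W2_principal.
have h0 (h : M -> 'cV[R]_4) : dmap h m 0 = 0 by exact: derive0.
have e1 : k1 *: V1 m + k2 *: V2 m = 0.
  apply: (etrans (esym (dmap_comb m k1 k2 (W1 m) (W2 m) rho_smooth))).
  by rewrite k0; exact: h0.
have e2 : k1 *: dmap N m (W1 m) + k2 *: dmap N m (W2 m) = 0.
  apply: (etrans (esym (dmap_comb m k1 k2 (W1 m) (W2 m) N_smooth))).
  by rewrite k0; exact: h0.
rewrite d1 d2 opprK in e2.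
apply: (eigenvectors_independent _ (n1 m) (n2 m) e1 e2).
by rewrite gt_eqF.
Qed.

Lemma principal_span m (xi : E) : exists k1 k2, xi = k1 *: W1 m + k2 *: W2 m.
Proof.
pose A := W1 m; pose B := W2 m.
(* If the determinant vanished, both [(B.2, - A.2)] and [(B.1, - A.1)] would be coefficients of a
   vanishing combination of [A] and [B], so that [A = 0], against independence. *)
have det0 : A.1 * B.2 - A.2 * B.1 != 0.
  apply/negP => /eqP d0.
  have [b2 a2] : B.2 = 0 /\ - A.2 = 0.
    apply: (@principal_independent m); apply: plane_eq; rewrite !planeE -/A -/B.
      by rewrite -[RHS]d0; ring.
    by rewrite /=; ring.
  have [b1 a1] : B.1 = 0 /\ - A.1 = 0.
    apply: (@principal_independent m); apply: plane_eq; rewrite !planeE -/A -/B.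
      by rewrite /=; ring.
    by rewrite -[RHS]oppr0 -[in RHS]d0; ring.
  have A0 : A = 0.
    by apply: plane_eq; rewrite -[LHS]opprK ?a1 ?a2 oppr0.
  have [] := @principal_independent m 1 0.
    by rewrite scale0r addr0 scale1r; exact: A0.
  by move=> /eqP; rewrite oner_eq0.
exists ((xi.1 * B.2 - xi.2 * B.1) / (A.1 * B.2 - A.2 * B.1)),
  ((A.1 * xi.2 - A.2 * xi.1) / (A.1 * B.2 - A.2 * B.1)).
by apply: plane_eq; rewrite !planeE -/A -/B; field.
Qed.

Lemma dmap_principal m k1 k2 :
  dmap rhoM m (k1 *: W1 m + k2 *: W2 m) = k1 *: V1 m + k2 *: V2 m /\
  dmap N m (k1 *: W1 m + k2 *: W2 m) = a m *: (- k1 *: V1 m + k2 *: V2 m).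
Proof.
have [_ _ d1] := W1_principal; have [_ _ d2] := W2_principal.
split; first exact: dmap_comb rho_smooth.
apply: (etrans (dmap_comb m k1 k2 (W1 m) (W2 m) N_smooth)).
rewrite d1 d2 opprK; move: (V1 m) (V2 m) => z1 z2.
by apply/matrixP => i j; rewrite !mxE; ring.
Qed.

Let P := rhoM \o F.
Let n := N \o F.

Let Ps : smooth_plane P. Proof. exact: smooth_fun_comp. Qed.
Let ns : smooth_plane n. Proof. exact: smooth_fun_comp. Qed.

(** Differentiating [<n, dP> = 0] expresses [<dn, dP>] as minus the inner product of [n] with a
    second derivative of [P], which is symmetric. *)
Let second_form_sym (w w' : E) x : dot ('D_w n x) ('D_w' P x) = dot ('D_w' n x) ('D_w P x).
Proof.
have alg (s t k : R) : s + k = 0 -> t + k = 0 -> s = t by move=> e1 e2; lra.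
have sd (h : E -> 'cV[R]_4) y : smooth_plane h -> differentiable h y.
  by move=> hs; exact: (smooth_on_differentiable hs).
have [_ _ nP _] := N_gauss.
have rule (w1 w2 : E) : dot ('D_w1 n x) ('D_w2 P x) + dot (n x) ('D_w1 ('D_w2 P) x) = 0.
  have d := derive_dot w1 (sd _ x ns) (sd _ x (smooth_on_derive w2 Ps)).
  apply: (etrans (esym d)).
  have -> : (fun y => dot (n y) ('D_w2 P y)) = cst 0.
    by apply/funext => y; rewrite (derive_fun_comp F_cont F_smooth)//; exact: nP.
  exact: derive_cst.
have h1 := rule w w'; have h2 := rule w' w.
have sy : 'D_w' ('D_w P) x = 'D_w ('D_w' P) x.
  exact: (congr1 (fun h => h x) (smooth_symmetric_mx w w' Ps)).
rewrite sy in h2.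
exact: alg h1 h2.
Qed.

(** The symmetry of the second fundamental form is known along the coordinate directions of the
    plane; their velocities are independent because [F] is an immersion, so their components in the
    principal basis have nonzero determinant. *)
Lemma principal_orthogonal m : dot (V1 m) (V2 m) = 0.
Proof.
have [x <-] := F_surj m; set y := F x.
have [_ n1 _] := W1_principal; have [_ n2 _] := W2_principal.
have n1y : dot (V1 y) (V1 y) = 1 by exact: n1.
have n2y : dot (V2 y) (V2 y) = 1 by exact: n2.
have vel k1 k2 (v w : E) : velocity F x (k1 *: v + k2 *: w) =
    k1 *: velocity F x v + k2 *: velocity F x w.
  have vd := velocity_differentiable F_smooth x.
  by rewrite /velocity !(deriveE _ vd) linearD !linearZ.
have [x1 [x2 xE]] := principal_span y (velocity F x (1, 0)).
have [y1 [y2 yE]] := principal_span y (velocity F x (0, 1)).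
have det0 : x1 * y2 - x2 * y1 != 0.
  apply/negP => /eqP d0.
  have zero k1 k2 : k1 * x1 + k2 * y1 = 0 -> k1 * x2 + k2 * y2 = 0 -> k1 = 0 /\ k2 = 0.
    move=> e1 e2; have : velocity F x (k1 *: (1, 0) + k2 *: (0, 1)) = 0.
      rewrite vel xE yE !scalerDr !scalerA addrACA -!scalerDl e1 e2.
      by rewrite !scale0r addr0.
    move=> /F_immersion e; have e1' := congr1 fst e; have e2' := congr1 snd e.
    move: e1' e2'; rewrite !planeE /= !mulr1 !mulr0 addr0 add0r => -> ->.
    by [].
  have [y20 x20] : y2 = 0 /\ - x2 = 0 by apply: zero; [rewrite -[RHS]d0; ring | ring].
  have [y10 x10] : y1 = 0 /\ - x1 = 0.
    by apply: zero; [ring | rewrite -[RHS]oppr0 -[in RHS]d0; ring].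
  have [] := zero 1 0.
  - by rewrite y10 -[x1]opprK x10; ring.
  - by rewrite y20 -[x2]opprK x20; ring.
  by move=> /eqP; rewrite oner_eq0.
have [p1 q1] := dmap_principal y x1 x2; have [p2 q2] := dmap_principal y y1 y2.
have DPu := etrans (derive_fun_comp F_cont F_smooth x (1, 0) rho_smooth)
  (etrans (congr1 (dmap rhoM y) xE) p1).
have DPv := etrans (derive_fun_comp F_cont F_smooth x (0, 1) rho_smooth)
  (etrans (congr1 (dmap rhoM y) yE) p2).
have Dnu := etrans (derive_fun_comp F_cont F_smooth x (1, 0) N_smooth)
  (etrans (congr1 (dmap N y) xE) q1).
have Dnv := etrans (derive_fun_comp F_cont F_smooth x (0, 1) N_smooth)
  (etrans (congr1 (dmap N y) yE) q2).
have ay0 : a y != 0 by rewrite gt_eqF.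
apply: (eigenvectors_orthogonal ay0 n1y n2y det0).
exact: (etrans (congr2 (@dot R) (esym Dnu) (esym DPv))
  (etrans (second_form_sym (1, 0) (0, 1) x) (congr2 (@dot R) Dnv DPu))).
Qed.

Lemma principal_frame m : orthonormal_frame (rhoM m) (N m) (V1 m) (V2 m).
Proof.
have [_ n1 _] := W1_principal; have [_ n2 _] := W2_principal.
have [_ rr _] := rho_immersion; have [_ nn nT nr] := N_gauss.
have rT xi : dot (rhoM m) (dmap rhoM m xi) = 0.
  pose c := chart_at m; pose h := rhoM \o param c.
  have hd : differentiable h (Defs.coord c m) by exact: smooth_fun_differentiable.
  have := derive_dot xi hd hd.
  have -> : (fun y => dot (h y) (h y)) = cst 1 by apply/funext => y; exact: rr.
  rewrite derive_cst; have hE : h (Defs.coord c m) = rhoM m.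
    by rewrite /h /= coordK//; exact: chart_at_dom.
  rewrite hE -/(dmap rhoM m xi) [dot (dmap _ _ _) _]dotC; lra.
split; [split| split |..] => //.
- exact: n1.
- exact: n2.
- by rewrite dotC.
- exact: principal_orthogonal.
Qed.

End PrincipalFrame.

(** * Coordinates adapted to the rotated principal frame *)

Section Isothermal.
Context {R : realType}.
Local Notation E := (R * R)%type.
Variables (P n V1 V2 : E -> 'cV[R]_4) (L : E -> R) (theta : R).
Hypotheses (Ps : smooth_plane P) (ns : smooth_plane n).
Hypotheses (V1s : smooth_plane V1) (V2s : smooth_plane V2) (Ls : smooth_plane L).
Hypotheses (Pp : Z2_periodic P) (V1p : Z2_periodic V1) (V2p : Z2_periodic V2).
Hypothesis Lp : Z2_periodic L.
Hypothesis frame : forall x, orthonormal_frame (P x) (n x) (V1 x) (V2 x).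
Hypothesis DP : forall w x, exists k1 k2, 'D_w P x = k1 *: V1 x + k2 *: V2 x /\
  'D_w n x = expR (2 * L x) *: (- k1 *: V1 x + k2 *: V2 x).
Hypothesis P_immersion : forall x v, 'D_v P x = 0 -> v = 0.
Local Notation c := (cos theta).
Local Notation s := (sin theta).

Let sd (W : normedModType R) (h : E -> W) y : smooth_plane h -> differentiable h y.
Proof. by move=> hs; exact: (smooth_on_differentiable hs). Qed.

Let form_u (V : E -> 'cV[R]_4) x := expR (L x) * dot (partial_u P x) (V x).
Let form_v (V : E -> 'cV[R]_4) x := expR (L x) * dot (partial_v P x) (V x).

Let unit_derive (V : E -> 'cV[R]_4) w x : smooth_plane V ->
  (forall y, dot (V y) (V y) = 1) -> dot (V x) ('D_w V x) = 0.
Proof.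
move=> Vs VV; have alg (t t' : R) : t' + t = 0 -> t' = t -> t = 0 by move=> h1 h2; lra.
have d := derive_dot w (sd x Vs) (sd x Vs).
have e : (fun y => dot (V y) (V y)) = cst 1 by apply/funext => y; exact: VV.
have e0 := etrans (esym d) (etrans (congr1 (fun h => 'D_w h x) e) (derive_cst _ _ _)).
exact: (alg _ _ e0 (dotC _ _)).
Qed.

(** The sign is [- 1] because dn = - a dP along [V1]. As [V1] has unit length, its derivative is
    orthogonal to it and meets dP only through the [V2] component, where dn = a dP: this is the
    opposite sign asked for by [codazzi_closed]. The roles are exchanged for [V2]. *)
Let closed1 x : partial_v (form_u V1) x = partial_u (form_v V1) x.
Proof.
apply: (@codazzi_closed _ P n V1 L (-1) Ps ns V1s Ls); first by rewrite oppr_eq0 oner_neq0.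
- move=> w y; have [k1 [k2 [-> ->]]] := DP w y.
  have [[_ _ v11 _] _ _ _ v12] := frame y.
  by rewrite !dotE v11 [dot (V2 y) (V1 y)]dotC v12; ring.
- move=> w w' y; have [k1 [k2 [-> ->]]] := DP w y.
  have v1d : dot (V1 y) ('D_w' V1 y) = 0.
    by apply: unit_derive => // z; have [[_ _ v11 _] _ _ _ _] := frame z.
  by rewrite !dotE v1d; move: (dot _ _) => t; ring.
Qed.

Let closed2 x : partial_v (form_u V2) x = partial_u (form_v V2) x.
Proof.
apply: (@codazzi_closed _ P n V2 L 1 Ps ns V2s Ls); first exact: oner_neq0.
- move=> w y; have [k1 [k2 [-> ->]]] := DP w y.
  have [[_ _ _ v22] _ _ _ v12] := frame y.
  by rewrite !dotE v22 v12; ring.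
- move=> w w' y; have [k1 [k2 [-> ->]]] := DP w y.
  have v2d : dot (V2 y) ('D_w' V2 y) = 0.
    by apply: unit_derive => // z; have [[_ _ _ v22] _ _ _ _] := frame z.
  by rewrite !dotE v2d; move: (dot _ _) => t; ring.
Qed.

Let form_smooth (h V : E -> 'cV[R]_4) : smooth_plane h -> smooth_plane V ->
  smooth_plane (fun x => expR (L x) * dot (h x) (V x)).
Proof.
move=> hs Vs k; apply: (Cn_on_scale openT); first exact: (Cn_on_expR openT (Ls k)).
exact: Cn_on_dot openT (hs k) (Vs k).
Qed.

Let partial_periodic w : Z2_periodic ('D_w P).
Proof.
move: Pp => [p1 p2].
have step (e : E) : (forall x, P (x + e) = P x) -> forall x, 'D_w P (x + e) = 'D_w P x.
  move=> Pe x; have d : derivable P (x + e) w by exact/diff_derivable/sd.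
  have dt := is_derive_translate d.
  rewrite -(@derive_val _ _ _ _ _ _ _ dt); congr ('D_w _ x).
  by apply/funext => y; rewrite Pe.
by split; apply: step.
Qed.

Let form_periodic w (V : E -> 'cV[R]_4) : Z2_periodic V ->
  Z2_periodic (fun x => expR (L x) * dot ('D_w P x) (V x)).
Proof.
move: Lp (partial_periodic w) => [l1 l2] [d1 d2] [v1 v2].
by split=> x; [rewrite l1 d1 v1 | rewrite l2 d2 v2].
Qed.

Let comb (k1 k2 : R) (f g : E -> R) x := k1 * f x + k2 * g x.

Let comb_smooth k1 k2 (f g : E -> R) : smooth_plane f -> smooth_plane g ->
  smooth_plane (comb k1 k2 f g).
Proof.
move=> fs gs k; apply: (Cn_onD openT); apply: (Cn_on_scale openT);
  [exact: Cn_on_cst | exact: fs | exact: Cn_on_cst | exact: gs].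
Qed.

Let comb_periodic k1 k2 (f g : E -> R) : Z2_periodic f -> Z2_periodic g ->
  Z2_periodic (comb k1 k2 f g).
Proof. by move=> [f1 f2] [g1 g2]; split=> x; rewrite /comb ?f1 ?g1 ?f2 ?g2. Qed.

Let comb_derive k1 k2 (f g : E -> R) w x : smooth_plane f -> smooth_plane g ->
  'D_w (comb k1 k2 f g) x = k1 * 'D_w f x + k2 * 'D_w g x.
Proof.
move=> fs gs.
have df : is_derive x w f ('D_w f x) by exact/derivableP/diff_derivable/sd.
have dg : is_derive x w g ('D_w g x) by exact/derivableP/diff_derivable/sd.
have d := is_deriveD (is_deriveZ k1 df) (is_deriveZ k2 dg).
exact: (@derive_val _ _ _ _ _ _ _ d).
Qed.

(** Coefficients of e^L [<dP, .>] against the rotated frame: [(p1, q1)] belongs to [c V1 + s V2],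
    and [(p2, q2)] to [- s V1 + c V2]. *)
Let p1 := comb c s (form_u V1) (form_u V2).
Let q1 := comb c s (form_v V1) (form_v V2).
Let p2 := comb (- s) c (form_u V1) (form_u V2).
Let q2 := comb (- s) c (form_v V1) (form_v V2).

Let us (V : E -> 'cV[R]_4) : smooth_plane V -> smooth_plane (form_u V).
Proof. by move=> Vs; apply: form_smooth => //; exact: smooth_on_derive. Qed.

Let vs (V : E -> 'cV[R]_4) : smooth_plane V -> smooth_plane (form_v V).
Proof. by move=> Vs; apply: form_smooth => //; exact: smooth_on_derive. Qed.

Let comb_closed k1 k2 x : partial_v (comb k1 k2 (form_u V1) (form_u V2)) x =
  partial_u (comb k1 k2 (form_v V1) (form_v V2)) x.
Proof.
apply: (etrans (comb_derive k1 k2 (0, 1) x (us V1s) (us V2s))).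
apply: (etrans _ (esym (comb_derive k1 k2 (1, 0) x (vs V1s) (vs V2s)))).
exact: (congr2 (fun y z => k1 * y + k2 * z) (closed1 x) (closed2 x)).
Qed.

Let coframe x (xi : E) : exists k1 k2,
  [/\ 'D_xi P x = k1 *: V1 x + k2 *: V2 x,
      'D_xi n x = expR (2 * L x) *: (- k1 *: V1 x + k2 *: V2 x),
      xi.1 * form_u V1 x + xi.2 * form_v V1 x = expR (L x) * k1 &
      xi.1 * form_u V2 x + xi.2 * form_v V2 x = expR (L x) * k2].
Proof.
have [k1 [k2 [e1 e2]]] := DP xi x; exists k1, k2.
have e3 : 'D_xi P x = xi.1 *: partial_u P x + xi.2 *: partial_v P x.
  exact: derive_plane (sd x Ps).
have [[_ _ v11 v22] _ _ _ v12] := frame x.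
have lin (z : 'cV[R]_4) : xi.1 * (expR (L x) * dot (partial_u P x) z) +
    xi.2 * (expR (L x) * dot (partial_v P x) z) = expR (L x) * dot ('D_xi P x) z.
  rewrite e3 dotDl !dotZl; move: (dot _ _) (dot _ _) => t t'; ring.
split=> //; rewrite /form_u /form_v lin e1 !dotE.
  by rewrite v11 [dot (V2 x) (V1 x)]dotC v12; ring.
by rewrite v12 v22; ring.
Qed.

(** The rotation does not change the determinant. Were it zero, some nonzero vector would be
    annihilated by both forms, hence by dP, whose values are combinations of [V1] and [V2]. *)
Let det0 x : p1 x * q2 x - q1 x * p2 x != 0.
Proof.
have detE : p1 x * q2 x - q1 x * p2 x =
    form_u V1 x * form_v V2 x - form_v V1 x * form_u V2 x.
  rewrite /p1 /p2 /q1 /q2 /comb.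
  move: (form_u V1 x) (form_u V2 x) (form_v V1 x) (form_v V2 x) => f1 f2 g1 g2.
  ring: (sin2E theta).
rewrite detE; apply/negP => /eqP d0.
have zero (xi : E) : xi.1 * form_u V1 x + xi.2 * form_v V1 x = 0 ->
    xi.1 * form_u V2 x + xi.2 * form_v V2 x = 0 -> xi = 0.
  move=> h1 h2; apply: (@P_immersion x).
  have [k1 [k2 [e1 _ e3 e4]]] := coframe x xi.
  have eL : expR (L x) != 0 by rewrite gt_eqF// expR_gt0.
  rewrite h1 in e3; rewrite h2 in e4.
  have k10 : k1 = 0 by apply/eqP; move/esym/eqP: e3; rewrite mulf_eq0 (negbTE eL).
  have k20 : k2 = 0 by apply/eqP; move/esym/eqP: e4; rewrite mulf_eq0 (negbTE eL).
  by rewrite e1 k10 k20 !scale0r addr0.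
move: d0 zero; move: (form_u V1 x) (form_u V2 x) (form_v V1 x) (form_v V2 x).
move=> f1 f2 g1 g2 d0 zero.
have h1 := zero (g2, - f2); have h2 := zero (- g1, f1).
have e1 : (g2, - f2) = 0 :> E.
  by apply: h1 => /=; [rewrite -[RHS]d0; ring | ring].
have e2 : (- g1, f1) = 0 :> E.
  by apply: h2 => /=; [ring | rewrite -[RHS]d0; ring].
have /= g20 := congr1 fst e1; have /= f20 := congr1 snd e1.
have /= g10 := congr1 fst e2; have /= f10 := congr1 snd e2.
have {}f20 : f2 = 0 by rewrite -[f2]opprK f20 oppr0.
have {}g10 : g1 = 0 by rewrite -[g1]opprK g10 oppr0.
have := zero (1, 0); rewrite /= f10 f20 !mulr0 !mul0r addr0.
by move=> /(_ erefl erefl)/(congr1 fst)/= /eqP; rewrite oner_eq0.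
Qed.

Let coeffs_u (K1 K2 : R) : c * K1 + s * K2 = 1 -> - s * K1 + c * K2 = 0 ->
  K1 = c /\ K2 = s.
Proof.
move=> h1 h2; split.
  transitivity (c * (c * K1 + s * K2) - s * (- s * K1 + c * K2)); last by rewrite h1 h2; ring.
  by ring: (sin2E theta).
transitivity (s * (c * K1 + s * K2) + c * (- s * K1 + c * K2)); last by rewrite h1 h2; ring.
by ring: (sin2E theta).
Qed.

Let coeffs_v (K1 K2 : R) : c * K1 + s * K2 = 0 -> - s * K1 + c * K2 = 1 ->
  K1 = - s /\ K2 = c.
Proof.
move=> h1 h2; split.
  transitivity (c * (c * K1 + s * K2) - s * (- s * K1 + c * K2)); last by rewrite h1 h2; ring.
  by ring: (sin2E theta).
transitivity (s * (c * K1 + s * K2) + c * (- s * K1 + c * K2)); last by rewrite h1 h2; ring.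
by ring: (sin2E theta).
Qed.

(** Since [Psi] inverts the pair of primitives, the two rotated forms take on its coordinate vectors
    the values of the identity matrix; undoing the rotation gives the derivatives of [P \o Psi].
    Those of [n \o Psi] differ by a factor e^(2L) and by the sign of the [V1] component. The unit
    periods of the initial plane become [w1] and [w2]. *)
Lemma isothermal_coordinates : exists (Phi Psi : E -> E) (w1 w2 : E),
  [/\ [/\ continuous Phi, smooth_plane Psi, cancel Phi Psi & cancel Psi Phi],
      [/\ w1.1 * w2.2 - w1.2 * w2.1 != 0,
          forall w, Psi (w + w1) = Psi w + (1, 0) &
          forall w, Psi (w + w2) = Psi w + (0, 1)],
      forall w, partial_u (P \o Psi) w =
          expR (- L (Psi w)) *: (c *: V1 (Psi w) + s *: V2 (Psi w)) /\
        partial_v (P \o Psi) w =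
          expR (- L (Psi w)) *: (c *: V2 (Psi w) - s *: V1 (Psi w)) &
      forall w, partial_u (n \o Psi) w =
          expR (L (Psi w)) *: (- c *: V1 (Psi w) + s *: V2 (Psi w)) /\
        partial_v (n \o Psi) w =
          expR (L (Psi w)) *: (s *: V1 (Psi w) + c *: V2 (Psi w))].
Proof.
have p1s : smooth_plane p1 := comb_smooth c s (us V1s) (us V2s).
have q1s : smooth_plane q1 := comb_smooth c s (vs V1s) (vs V2s).
have p2s : smooth_plane p2 := comb_smooth (- s) c (us V1s) (us V2s).
have q2s : smooth_plane q2 := comb_smooth (- s) c (vs V1s) (vs V2s).
have pu V : Z2_periodic V -> Z2_periodic (form_u V) := @form_periodic (1, 0) V.
have pv V : Z2_periodic V -> Z2_periodic (form_v V) := @form_periodic (0, 1) V.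
have p1p : Z2_periodic p1 := comb_periodic c s (pu _ V1p) (pu _ V2p).
have q1p : Z2_periodic q1 := comb_periodic c s (pv _ V1p) (pv _ V2p).
have p2p : Z2_periodic p2 := comb_periodic (- s) c (pu _ V1p) (pu _ V2p).
have q2p : Z2_periodic q2 := comb_periodic (- s) c (pv _ V1p) (pv _ V2p).
have [U1 [U1s U1d]] := poincare p1s q1s (comb_closed c s).
have [U2 [U2s U2d]] := poincare p2s q2s (comb_closed (- s) c).
have [Psi [PhiK PsiK Psis PsiD]] :=
  periodic_inverse p1s q1s p2s q2s p1p q1p p2p q2p U1s U2s U1d U2d det0.
have [w1 [w2 [wdet Hw1 Hw2]]] :=
  periods_independent p1p q1p p2p q2p U1s U2s U1d U2d (fun w => ex_intro _ (Psi w) (PsiK w)).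
(* [K1] and [K2] are the components of the derivative of [P \o Psi] scaled by e^L; the last two
   equations express that the differential of the primitives composed with that of [Psi] fixes
   [e]. *)
have key (e w : E) : exists K1 K2,
    [/\ 'D_e (P \o Psi) w =
          expR (- L (Psi w)) *: (K1 *: V1 (Psi w) + K2 *: V2 (Psi w)),
        'D_e (n \o Psi) w =
          expR (L (Psi w)) *: (- K1 *: V1 (Psi w) + K2 *: V2 (Psi w)),
        c * K1 + s * K2 = e.1 & - s * K1 + c * K2 = e.2].
  have [k1 [k2 [d1 d2 h1 h2]]] := coframe (Psi w) ('D_e Psi w).
  have h := expR_mulN L (Psi w).
  have eP : 'D_e (P \o Psi) w = k1 *: V1 (Psi w) + k2 *: V2 (Psi w).
    exact: (etrans (derive_comp e (sd _ Ps) (sd _ Psis)) d1).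
  have en := etrans (derive_comp e (sd (Psi w) ns) (sd w Psis)) d2.
  exists (expR (L (Psi w)) * k1), (expR (L (Psi w)) * k2); split.
  - rewrite eP; apply/matrixP => i j; rewrite !mxE; ring: h.
  - rewrite en expR_2; apply/matrixP => i j; rewrite !mxE; ring.
  - rewrite -h1 -h2 PsiD /= -[RHS]mul1r -(divff (det0 (Psi w))) /p1 /p2 /q1 /q2 /comb.
    by field; exact: det0.
  - rewrite -h1 -h2 PsiD /= -[RHS]mul1r -(divff (det0 (Psi w))) /p1 /p2 /q1 /q2 /comb.
    by field; exact: det0.
exists (fun x => (U1 x, U2 x)), Psi, w1, w2; split.
- split=> // x.
  have h1 : {for x, continuous U1} by exact: (smooth_on_continuous U1s).
  have h2 : {for x, continuous U2} by exact: (smooth_on_continuous U2s).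
  exact: (cvg_pair h1 h2).
- split=> // w.
    by rewrite -[in LHS](PsiK w) -Hw1 PhiK.
  by rewrite -[in LHS](PsiK w) -Hw2 PhiK.
- move=> w; split.
    have [K1 [K2 [e _ a1 a2]]] := key (1, 0) w.
    by have [E1 E2] := coeffs_u a1 a2; apply: (etrans e); rewrite E1 E2.
  have [K1 [K2 [e _ a1 a2]]] := key (0, 1) w.
  have [E1 E2] := coeffs_v a1 a2; apply: (etrans e).
  by rewrite E1 E2 scaleNr addrC.
- move=> w; split.
    have [K1 [K2 [_ e a1 a2]]] := key (1, 0) w.
    by have [E1 E2] := coeffs_u a1 a2; apply: (etrans e); rewrite E1 E2.
  have [K1 [K2 [_ e a1 a2]]] := key (0, 1) w.
  have [E1 E2] := coeffs_v a1 a2; apply: (etrans e).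
  by rewrite E1 E2 opprK.
Qed.

End Isothermal.

(** * Adapted coordinates of the torus and the resulting solution of the system *)

Theorem theorem3p12 (R : realType) (M : smooth_surface R)
  (rhoM N : M -> 'cV[R]_4) (a : M -> R) (W1 W2 : M -> R * R)
  (M_hausdorff : hausdorff_space M) (M_compact : compact [set: M])
  (M_oriented : oriented M) (M_torus : diffeomorphic M (torus R))
  (rho_immersion : immersion_S3 rhoM) (N_gauss : gauss_map rhoM N)
  (rho_minimal : minimal rhoM N)
  (a_curvature : nonneg_principal_curvature rhoM N a)
  (a_gt0 : forall m, 0 < a m) (a_smooth : smooth_fun a)
  (W1_principal : principal_field rhoM N a W1)
  (W2_principal : principal_field rhoM N (fun m => - a m) W2)
  (theta : R) (B : 'M[R]_4) (B_so4 : so4 B)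
  (hB : forall m, h_fun a W1 W2 theta m = 2 * killing_fun rhoM N B m) :
  exists (tau : R * R -> M) (rho nu V1 V2 : R * R -> 'cV[R]_4)
    (r : R * R -> R),
    adapted_data rhoM N a W1 W2 tau rho nu V1 V2 r /\
    solution_S B theta rho V1 V2 nu r (partial_v r).
Proof.
have [f [g [fK gK fs gs]]] := M_torus.
pose F : R * R -> M := g \o @torus_proj R.
have Fc : continuous F by exact: torus_param_continuous gs.
have Fs : smooth_into F by exact: torus_param_smooth gs.
have Fi x v : velocity F x v = 0 -> v = 0 by exact: torus_param_immersion gK fs gs x v.
have Fp : Z2_periodic F by exact: torus_param_periodic.
have Fsurj m : exists x, F x = m by exact: torus_param_surj fK m.
have frame m := principal_frame rho_immersion N_gauss a_gt0 W1_principal W2_principal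
  Fc Fs Fi Fsurj m.
have [rho_smooth _ rho_inj] := rho_immersion.
have [N_smooth _ _ _] := N_gauss.
have [V1_smooth _ _] := W1_principal; have [V2_smooth _ _] := W2_principal.
pose V1M m := dmap rhoM m (W1 m); pose V2M m := dmap rhoM m (W2 m).
pose LM m := 2^-1 * ln (a m).
have LMs (tau : R * R -> M) : continuous tau -> smooth_into tau -> smooth_plane (LM \o tau).
  move=> tc ts n; apply: (Cn_on_scale openT); first exact: Cn_on_cst.
  apply: (Cn_on_ln openT); first by move=> x _; exact: a_gt0.
  exact: (smooth_fun_comp tc ts a_smooth).
have aE m : a m = expR (2 * LM m).
  by rewrite /LM mulrA divff ?mul1r ?lnK ?posrE// pnatr_eq0.
have periodic_comp (T : Type) (h : M -> T) : Z2_periodic (h \o F).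
  by case: Fp => F1 F2; split=> x; [exact: (congr1 h (F1 x)) | exact: (congr1 h (F2 x))].
have DP w x : exists k1 k2, 'D_w (rhoM \o F) x = k1 *: V1M (F x) + k2 *: V2M (F x) /\
    'D_w (N \o F) x = expR (2 * LM (F x)) *: (- k1 *: V1M (F x) + k2 *: V2M (F x)).
  have [k1 [k2 kE]] := principal_span rho_immersion N_gauss a_gt0 W1_principal
    W2_principal (F x) (velocity F x w).
  have [d1 d2] := dmap_principal rho_immersion N_gauss W1_principal W2_principal (F x) k1 k2.
  exists k1, k2; rewrite -aE; split.
    exact: (etrans (derive_fun_comp Fc Fs x w rho_smooth)
      (etrans (congr1 (dmap rhoM (F x)) kE) d1)).
  exact: (etrans (derive_fun_comp Fc Fs x w N_smooth)
    (etrans (congr1 (dmap N (F x)) kE) d2)).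
have Pi x v : 'D_v (rhoM \o F) x = 0 -> v = 0.
  move=> Dv; apply: (Fi x); apply: (rho_inj (F x)).
  exact: (etrans (esym (derive_fun_comp Fc Fs x v rho_smooth)) Dv).
have [Phi [Psi [w1 [w2 [[Phic Psis PhiK PsiK] [wdet Hw1 Hw2] Hrho Hnu]]]]] :=
  isothermal_coordinates theta (smooth_fun_comp Fc Fs rho_smooth)
    (smooth_fun_comp Fc Fs N_smooth) (smooth_fun_comp Fc Fs V1_smooth)
    (smooth_fun_comp Fc Fs V2_smooth) (LMs F Fc Fs) (periodic_comp _ rhoM)
    (periodic_comp _ V1M) (periodic_comp _ V2M) (periodic_comp _ LM)
    (fun x => frame (F x)) DP Pi.
have Psic : continuous Psi by move=> x; exact: (smooth_on_continuous Psis).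
pose tau := F \o Psi.
have tauc : continuous tau.
  by move=> x; apply: continuous_comp; [exact: Psic | exact: Fc].
have taus : smooth_into tau by exact: smooth_into_comp.
pose rho := rhoM \o tau; pose nu := N \o tau.
pose V1 := V1M \o tau; pose V2 := V2M \o tau; pose r := LM \o tau.
have rhos : smooth_plane rho := smooth_fun_comp tauc taus rho_smooth.
have nus : smooth_plane nu := smooth_fun_comp tauc taus N_smooth.
have V1s : smooth_plane V1 := smooth_fun_comp tauc taus V1_smooth.
have V2s : smooth_plane V2 := smooth_fun_comp tauc taus V2_smooth.
have rs : smooth_plane r := LMs tau tauc taus.
have fr x : orthonormal_frame (rho x) (nu x) (V1 x) (V2 x) by exact: frame.
have rho_u x := (Hrho x).1; have rho_v x := (Hrho x).2.
have nu_u x := (Hnu x).1; have nu_v x := (Hnu x).2.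
(* The u-derivative of [a \o tau] is computed twice: from a = e^(2r), and through the velocity of
   [tau], where the combination defining [h_fun] appears. *)
have r_u x : partial_u r x = dot (B *m rho x) (nu x).
  pose m := tau x; pose e := expR (- r x).
  pose da1 := dmap a m (W1 m); pose da2 := dmap a m (W2 m).
  have h : e * expR (r x) = 1 by rewrite /e -expRD addNr expR0.
  (* The formula for the u-derivative of [rho] determines the velocity of [tau], since the
     differential of [rhoM] is injective. *)
  have velE : velocity tau x (1, 0) =
      (e * cos theta) *: W1 m + (e * sin theta) *: W2 m.
    set eta := (X in _ = X).
    have drho : dmap rhoM m (velocity tau x (1, 0)) = dmap rhoM m eta.
      rewrite -(derive_fun_comp tauc taus x (1, 0) rho_smooth).
      apply: (etrans (rho_u x)).
      have [-> _] := dmap_principal rho_immersion N_gauss W1_principal W2_principal m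
        (e * cos theta) (e * sin theta).
      by rewrite scalerDr !scalerA.
    have := dmap_linear m (-1) eta (velocity tau x (1, 0)) rho_smooth.
    rewrite drho [X in _ = X](_ : _ = 0); last by rewrite scaleN1r addNr.
    move=> /rho_inj/eqP.
    by rewrite addrC scaleN1r subr_eq0 => /eqP.
  have Dau : partial_u (a \o tau) x = e * cos theta * da1 + e * sin theta * da2.
    rewrite [LHS](derive_fun_comp tauc taus x (1, 0) a_smooth) velE.
    exact: (dmap_comb m _ _ _ _ a_smooth).
  have Dae : partial_u (a \o tau) x = 2 * partial_u r x * expR (2 * r x).
    have -> : a \o tau = (fun y => expR (2 * r y)) by apply/funext => y; exact: aE.
    by apply: derive_expR_scale; exact: (smooth_on_differentiable rs).
  (* [e] is a^(-1/2), so the weight of [h_fun] is its cube. *)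
  have powE : a m `^ (- (3 / 2)) = e * e * e.
    rewrite /powR gt_eqF// /e -!expRD; congr expR.
    have -> : ln (a m) = 2 * LM m by rewrite /LM mulrA divff ?mul1r ?pnatr_eq0.
    have -> : LM m = r x by [].
    by move: (r x) => t; field.
  have hBm := hB m; rewrite /h_fun powE -/da1 -/da2 in hBm.
  have : 2 * partial_u r x = 2 * killing_fun rhoM N B m.
    rewrite -hBm; have e2 := expR_2 r x; rewrite Dae e2 in Dau.
    transitivity (2 * partial_u r x * (expR (r x) * expR (r x)) * (e * e)); first by ring: h.
    by rewrite Dau; ring.
  by move/(mulfI (_ : 2 != 0)) => ->//; rewrite pnatr_eq0.
have sd (W : normedModType R) (h : R * R -> W) x : smooth_plane h -> differentiable h x.
  by move=> hs; exact: (smooth_on_differentiable hs).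
exists tau, rho, nu, V1, V2, r; split.
  exists theta; split.
  - have -> : tau = g \o @torus_proj R \o Psi by [].
    apply: (covering_comp_homeo Psic Phic PsiK PhiK gs.1 fs.1 gK fK).
    exact: torus_proj_covering.
  - exact: taus.
  - by [].
  - by [].
  - by [].
  - by [].
  - exact: rhos.
  - exists w1, w2; split=> // x.
      by rewrite /rho /tau /= Hw1; exact: (congr1 rhoM (Fp.1 (Psi x))).
    by rewrite /rho /tau /= Hw2; exact: (congr1 rhoM (Fp.2 (Psi x))).
  - exact: rs.
  - by move=> x; have [] := frame_norm fr rho_u rho_v erefl erefl x.
  - by move=> x; have [] := frame_norm fr rho_u rho_v erefl erefl x.
  - by move=> x; have [] := frame_norm fr rho_u rho_v erefl erefl x.
  - by move=> x; exact: aE.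
  - exact: (V1_rotated rho_u rho_v erefl erefl).
  - exact: (V2_rotated rho_u rho_v erefl erefl).
  - exact: (frame_uu rhos nus rs fr rho_u rho_v nu_u nu_v
      erefl erefl erefl erefl erefl erefl erefl erefl erefl).
  - exact: (frame_vv rhos nus rs fr rho_u rho_v nu_u nu_v
      erefl erefl erefl erefl erefl erefl erefl erefl erefl).
  - exact: (frame_uv rhos nus rs fr rho_u rho_v nu_u nu_v
      erefl erefl erefl erefl erefl erefl erefl erefl erefl).
  - exact: (frame_nu_u rho_u rho_v nu_u erefl erefl erefl).
  - exact: (frame_nu_v rho_u rho_v nu_v erefl erefl erefl).
  - exact: (frame_sinh_gordon rhos nus rs fr rho_u rho_v nu_u nu_v
      erefl erefl erefl erefl erefl erefl erefl erefl erefl).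
split.
- move=> x; split; split; apply: sd => //; exact: smooth_on_derive.
- exact: rho_u.
- exact: (frame_V1_u rhos nus rs fr rho_u rho_v nu_u nu_v
      erefl erefl erefl erefl erefl erefl erefl erefl erefl).
- exact: (frame_V2_u rhos nus rs fr rho_u rho_v nu_u nu_v
      erefl erefl erefl erefl erefl erefl erefl erefl erefl).
- exact: nu_u.
- exact: r_u.
- exact: (frame_s_u rhos nus rs rho_v nu_v erefl erefl B_so4 r_u).
- exact: rho_v.
(* The system writes the rotation rate along v as [<Bp, nu>], where the structure equation has the
   u-derivative of [r]. *)
- by move=> x; rewrite -r_u; exact: (frame_V1_v rhos nus rs fr rho_u rho_v nu_u nu_v
      erefl erefl erefl erefl erefl erefl erefl erefl erefl).
- by move=> x; rewrite -r_u; exact: (frame_V2_v rhos nus rs fr rho_u rho_v nu_u nu_v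
      erefl erefl erefl erefl erefl erefl erefl erefl erefl).
- exact: nu_v.
- by [].
- exact: (frame_s_v rhos nus rs fr rho_u rho_v nu_u nu_v
      erefl erefl erefl erefl erefl erefl erefl erefl erefl B_so4 r_u).
Qed.
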